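(* In each dimension $d\ge3$ the obstruction density $\mathcal B$ (of hypersurfaces $\Sigma$ in conformal $d$-manifolds $(M,\boldsymbol c)$) is a conformal hypersurface invariant.
   Context: $(M,\boldsymbol c)$ is a smooth oriented $d$-manifold with a conformal class of Riemannian metrics, $\Sigma$ a smoothly embedded codimension-1 submanifold. $\mathcal E[w]$ is the bundle of conformal densities of weight $w$ (oriented $\frac w{2d}$-th root of $(\Lambda^dTM)^2$; a section is represented by functions $f_g$, $g\in\boldsymbol c$, with $f_{\Omega^2g}=\Omega^wf_g$); $\boldsymbol g$ is the conformal metric. For $\sigma\in\Gamma(\mathcal E[1])$ let $I_\sigma^2:=\boldsymbol g^{ab}(\nabla_a\sigma)(\nabla_b\sigma)-\frac2d\sigma(\Delta\sigma+\mathrm J\sigma)$ with $\nabla$, $\Delta=\boldsymbol g^{ab}\nabla_a\nabla_b$, $\mathrm J=\mathrm{Sc}/(2(d-1))$ those of any $g\in\boldsymbol c$. The obstruction density is $\mathcal B=B_{\bar\sigma}|_\Sigma\in\Gamma(\mathcal E\Sigma[-d])$, where $\bar\sigma\in\Gamma(\mathcal E[1])$ is a smooth defining density for $\Sigma$ (zero locus $\Sigma$, $\nabla\bar\sigma\ne0$ on $\Sigma$) with $I^2_{\bar\sigma}=1+\bar\sigma^dB_{\bar\sigma}$, $B_{\bar\sigma}\in\Gamma(\mathcal E[-d])$ smooth; it depends only on the (oriented) conformal embedding. Conformal hypersurface invariants: a scalar Riemannian pre-invariant assigns to each Riemannian $d$-manifold $(M,g)$ (with volume form $\omega$) and hypersurface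 defining function $s$ ($\boldsymbol ds\neq0$ on $\Sigma=\{s=0\}$) a function $P(s;g)$ such that (i) $P(\phi^*s;\phi^*g)=\phi^*P(s;g)$ for every diffeomorphism $\phi$; (ii) $P(s;g)|_\Sigma=P(s';g)|_\Sigma$ whenever $s,s'$ are compatibly oriented defining functions of the same $\Sigma$ (same induced orientation); (iii) $P$ is given in local coordinates by a universal polynomial in $g_{ab}$ and its partial derivatives up to some finite order, $(\det g)^{-1}$, $s$ and its partial derivatives up to some finite order, $\|\boldsymbol ds\|_g^{-1}$, and the components of $\omega$. The restriction $P(\Sigma;g)=P(s;g)|_\Sigma$ is a Riemannian hypersurface invariant; if $P(\Sigma;\Omega^2g)=\Omega^wP(\Sigma;g)$ for all smooth positive $\Omega$, the resulting section of $\mathcal E\Sigma[w]$ is called a conformal (hypersurface) invariant of $\Sigma$. *)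

(* Defs.v *)
From HB Require Import structures.
From mathcomp Require Import all_boot all_order all_algebra.
From mathcomp Require Import all_classical all_reals all_analysis.
From mathcomp Require mpoly.
Set Implicit Arguments.
Unset Strict Implicit.
Unset Printing Implicit Defensive.
Import Order.TTheory GRing.Theory Num.Theory.
Import numFieldNormedType.Exports.
Local Open Scope classical_set_scope.
Local Open Scope ring_scope.

Section Euclidean.
Context {R : realType} {d : nat}.
Local Notation V := 'rV[R]_d.

Definition pderiv (a : 'I_d) (f : V -> R) : V -> R :=
  fun x => 'D_(delta_mx 0 a) f x.

Definition pderivs (l : seq 'I_d) (f : V -> R) : V -> R := foldr pderiv f l.

(* C^oo on U; meaningful for open U. *)
Definition smooth_on (U : set V) (f : V -> R) : Prop :=
  forall (l : seq 'I_d) (x : V), U x ->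
    {for x, continuous (pderivs l f)} /\
    forall a : 'I_d, derivable (pderivs l f) x (delta_mx 0 a).

Definition smooth_map_on (U : set V) (F : V -> V) : Prop :=
  forall b : 'I_d, smooth_on U (fun x => F x 0 b).

(* Below, h is the matrix of components of a metric in a coordinate system. *)
Implicit Types (h : V -> 'M[R]_d) (f : V -> R) (x : V).

(* christoffel h c a b is Gamma^c_ab. *)
Definition christoffel h (c a b : 'I_d) : V -> R := fun x =>
  2^-1 * \sum_(e < d) invmx (h x) c e *
    (pderiv a (fun y => h y b e) x + pderiv b (fun y => h y a e) x
     - pderiv e (fun y => h y a b) x).

(* R_ab = d_c Gamma^c_ab - d_a Gamma^c_cb
          + Gamma^c_ce Gamma^e_ab - Gamma^c_ae Gamma^e_cb;
   with this sign round spheres have positive scalar curvature. *)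
Definition ricci h (a b : 'I_d) : V -> R := fun x =>
  \sum_(c < d)
    (pderiv c (christoffel h c a b) x - pderiv a (christoffel h c c b) x
     + \sum_(e < d) (christoffel h c c e x * christoffel h e a b x
                     - christoffel h c a e x * christoffel h e c b x)).

Definition scal h : V -> R := fun x =>
  \sum_(a < d) \sum_(b < d) invmx (h x) a b * ricci h a b x.

Definition Jtrace h : V -> R := fun x => scal h x / (2 * (d.-1)%:R).

Definition grad_sqnorm h f : V -> R := fun x =>
  \sum_(a < d) \sum_(b < d) invmx (h x) a b * pderiv a f x * pderiv b f x.

Definition laplacian h f : V -> R := fun x =>
  \sum_(a < d) \sum_(b < d) invmx (h x) a b *
    (pderiv a (pderiv b f) x
     - \sum_(c < d) christoffel h c a b x * pderiv c f x).

Definition Isq h f : V -> R := fun x =>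
  grad_sqnorm h f x
  - 2 / d%:R * f x * (laplacian h f x + Jtrace h x * f x).

End Euclidean.

(* A smooth d-manifold, presented by a smooth atlas indexed by [chart]:
   [coord i] is a homeomorphism from the open set [dom i] onto an open subset
   of R^d, with inverse [param i]; [coord i] and [param i] are total functions
   with irrelevant values elsewhere. *)
Record manifold (R : realType) (d : nat) := Manifold {
  mspace :> topologicalType;
  chart : Type;
  dom : chart -> set mspace;
  coord : chart -> mspace -> 'rV[R]_d;
  param : chart -> 'rV[R]_d -> mspace;
  manifold_hausdorff : hausdorff_space mspace;
  manifold_second_countable : @second_countable mspace;
  dom_open : forall i, open (dom i);
  dom_cover : forall p, exists i, dom i p;
  range_open : forall i, open (coord i @` dom i);
  coordK : forall i p, dom i p -> param i (coord i p) = p;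
  coord_cont : forall i p, dom i p -> {for p, continuous (coord i)};
  param_cont : forall i p, dom i p -> {for coord i p, continuous (param i)};
  transition_smooth : forall i j,
    smooth_map_on (coord i @` (dom i `&` dom j)) (coord j \o param i)
}.

Section Manifolds.
Context {R : realType} {d : nat}.
Implicit Types M N : manifold R d.

Definition smooth_fun M (f : M -> R) : Prop :=
  forall i : chart M, smooth_on (coord i @` dom i) (f \o param i).

Definition local_deriv M (i : chart M) (l : seq 'I_d) (f : M -> R) (p : M) : R :=
  pderivs l (f \o param i) (coord i p).

Definition smooth_map M N (phi : M -> N) : Prop :=
  continuous phi /\
  forall (i : chart M) (j : chart N),
    smooth_map_on (coord i @` (dom i `&` phi @^-1` dom j))
                  (coord j \o phi \o param i).

Definition diffeomorphism M N (phi : M -> N) : Prop :=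
  exists psi : N -> M,
    [/\ cancel phi psi, cancel psi phi, smooth_map phi & smooth_map psi].

(* Entry (a, b) is d_a phi^b, so covariant tensors pull back by J g J^T. *)
Definition local_jacobian M N (phi : M -> N) (i : chart M) (j : chart N)
    (p : M) : 'M[R]_d :=
  jacobian (coord j \o phi \o param i) (coord i p).

Definition pullback_comp M N (phi : M -> N)
    (gN : chart N -> N -> 'M[R]_d) (gM : chart M -> M -> 'M[R]_d) : Prop :=
  forall (i : chart M) (j : chart N) (p : M), dom i p -> dom j (phi p) ->
    gM i p = local_jacobian phi i j p *m gN j (phi p)
             *m (local_jacobian phi i j p)^T.

Definition pullback_sign M N (phi : M -> N)
    (oN : chart N -> N -> bool) (oM : chart M -> M -> bool) : Prop :=
  forall (i : chart M) (j : chart N) (p : M), dom i p -> dom j (phi p) ->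
    (oM i p == oN j (phi p)) = (0 < \det (local_jacobian phi i j p)).

End Manifolds.

(* [mcomp i p] is the matrix of components at p in the chart i. *)
Record metric (R : realType) (d : nat) (M : manifold R d) := Metric {
  mcomp :> chart M -> M -> 'M[R]_d;
  metric_sym : forall i p, dom i p -> (mcomp i p)^T = mcomp i p;
  metric_pos : forall i p (v : 'rV[R]_d), dom i p -> v != 0 ->
    0 < (v *m mcomp i p *m v^T) 0 0;
  metric_smooth : forall i a b,
    smooth_on (coord i @` dom i) (fun x => mcomp i (param i x) a b);
  metric_change : pullback_comp (@idfun M) mcomp mcomp
}.

(* [osign i p] tells whether the chart i is positively oriented at p. *)
Record orientation (R : realType) (d : nat) (M : manifold R d) := Orientation {
  osign :> chart M -> M -> bool;
  osign_locally_constant : forall i p, dom i p ->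
    \forall q \near p, osign i q = osign i p;
  osign_change : pullback_sign (@idfun M) osign osign
}.

Section Conformal.
Context {R : realType} {d : nat}.
Implicit Types M N : manifold R d.

(* The component omega_{a_1 ... a_d} of the volume form of g; the last factor
   is the Levi-Civita symbol of (a_1, ..., a_d). *)
Definition volume_comp M (o : orientation M) (g : metric M) (i : chart M)
    (a : 'I_d -> 'I_d) (p : M) : R :=
  (-1) ^+ (~~ o i p) * Num.sqrt (\det (g i p)) *
  \det (\matrix_(k < d, l < d) (a k == l)%:R).

Definition rescaled M (Omega : M -> R) (g g' : metric M) : Prop :=
  [/\ smooth_fun Omega, forall p, 0 < Omega p
    & forall (i : chart M) p, dom i p -> g' i p = Omega p ^+ 2 *: g i p].

Definition conformal_class M (c : set (metric M)) : Prop :=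
  exists g0 : metric M, c = [set g | exists Omega, rescaled Omega g0 g].

(* Smooth sections of E[w]; [dens g] represents the section for g in c. *)
Record density M (c : set (metric M)) (w : R) := Density {
  dens :> metric M -> M -> R;
  density_smooth : forall g, c g -> smooth_fun (dens g);
  density_rescale : forall (g g' : metric M) (Omega : M -> R),
    c g -> rescaled Omega g g' ->
    forall p, dens g' p = Omega p `^ w * dens g p
}.

Definition differential_neq0 M (s : M -> R) (p : M) : Prop :=
  forall i : chart M, dom i p -> exists a, local_deriv i [:: a] s p != 0.

Definition zero_locus M (s : M -> R) : set M := [set p | s p = 0].

Definition defining_function M (s : M -> R) : Prop :=
  smooth_fun s /\ forall p, zero_locus s p -> differential_neq0 s p.

(* Same zero locus and, on it, conormals that are positive multiples of each
   other. *)
Definition compatible M (s s' : M -> R) : Prop :=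
  zero_locus s = zero_locus s' /\
  forall p, zero_locus s p -> exists2 lambda : R, 0 < lambda &
    forall (i : chart M) (a : 'I_d), dom i p ->
      local_deriv i [:: a] s' p = lambda * local_deriv i [:: a] s p.

(* The local coordinate quantities in which pre-invariants are polynomial:
   the partial derivatives of the metric components and of s along the list of
   indices l, the inverse determinant of the metric, the inverse norm of ds,
   and the components of the volume form. *)
Inductive jet_var : Type :=
| MetricJet (a b : 'I_d) (l : seq 'I_d)
| InvDet
| FunctionJet (l : seq 'I_d)
| InvNorm
| VolumeForm (a : 'I_d -> 'I_d).

Definition jet_val M (o : orientation M) (g : metric M) (s : M -> R)
    (i : chart M) (p : M) (v : jet_var) : R :=
  match v with
  | MetricJet a b l => local_deriv i l (fun q => g i q a b) p
  | InvDet => (\det (g i p))^-1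
  | FunctionJet l => local_deriv i l s p
  | InvNorm =>
      (Num.sqrt (grad_sqnorm (g i \o param i) (s \o param i) (coord i p)))^-1
  | VolumeForm a => volume_comp o g i a p
  end.

Definition assignment : Type :=
  forall M : manifold R d, orientation M -> metric M -> (M -> R) -> M -> R.

Implicit Type P : assignment.

(* The orientation, through which the volume form enters, is pulled back along
   with the metric. *)
Definition natural P : Prop :=
  forall (M N : manifold R d) (phi : M -> N),
    diffeomorphism phi ->
    forall (oM : orientation M) (oN : orientation N)
           (gM : metric M) (gN : metric N) (s : N -> R),
      pullback_sign phi oN oM -> pullback_comp phi gN gM ->
      defining_function s ->
      forall p, P M oM gM (s \o phi) p = P N oN gN s (phi p).

Definition defining_function_independent P : Prop :=
  forall (M : manifold R d) (o : orientation M) (g : metric M) (s s' : M -> R),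
    defining_function s -> defining_function s' -> compatible s s' ->
    forall p, zero_locus s p -> P M o g s p = P M o g s' p.

(* One polynomial serves all manifolds, charts and points; the order of the
   derivatives involved is bounded since only finitely many jet variables
   occur. The formula is required where 1/|ds| makes sense, in particular in a
   neighbourhood of the hypersurface. *)
Definition universal_polynomial P : Prop :=
  exists (n : nat) (vars : 'I_n -> jet_var) (Q : mpoly.mpoly n R),
  forall (M : manifold R d) (o : orientation M) (g : metric M) (s : M -> R),
    defining_function s ->
    forall (i : chart M) (p : M), dom i p -> differential_neq0 s p ->
      P M o g s p = mpoly.meval (fun k => jet_val o g s i p (vars k)) Q.

Definition preinvariant P : Prop :=
  [/\ natural P, defining_function_independent P & universal_polynomial P].

Definition conformally_covariant (w : R) P : Prop :=
  forall (M : manifold R d) (o : orientation M) (g g' : metric M)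
         (Omega : M -> R) (s : M -> R),
    rescaled Omega g g' -> defining_function s ->
    forall p, zero_locus s p -> P M o g' s p = Omega p `^ w * P M o g s p.

(* [F M c s b] means that the family b of functions, indexed by the metrics
   of c and considered on the zero locus of s only, represents the section
   that F attaches to this hypersurface, oriented by s. *)
Definition conformal_hypersurface_invariant (w : R)
    (F : forall M : manifold R d,
           set (metric M) -> (M -> R) -> (metric M -> M -> R) -> Prop) : Prop :=
  exists P : assignment,
    [/\ preinvariant P, conformally_covariant w P
      & forall (M : manifold R d) (o : orientation M) (c : set (metric M))
               (s : M -> R) (b : metric M -> M -> R),
          conformal_class c -> defining_function s -> F M c s b ->
          forall (g : metric M) (p : M), c g -> zero_locus s p ->
            b g p = P M o g s p].

(* The density sigma is a defining density for the zero locus of s, with the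
   orientation given by s. *)
Definition defining_density M (c : set (metric M)) (s : M -> R)
    (sigma : density c 1) : Prop :=
  forall g, c g -> defining_function (sigma g) /\ compatible s (sigma g).

Definition obstruction_density M (c : set (metric M)) (s : M -> R)
    (b : metric M -> M -> R) : Prop :=
  exists (sigma : density c 1) (B : density c (- d%:R)),
    [/\ defining_density s sigma,
        forall (g : metric M) (i : chart M) (p : M), c g -> dom i p ->
          Isq (g i \o param i) (sigma g \o param i) (coord i p)
          = 1 + sigma g p ^+ d * B g p
      & forall (g : metric M) (p : M), c g -> zero_locus s p ->
          b g p = B g p].

End Conformal.

(* Main.v *)
(* Starting from sigma = s / |ds|, for which I^2 = 1 on {s = 0}, correct sigma
   successively by multiples of sigma^(k+1) G^k (I^2 - 1), where
   G = <d sigma, d ->. The variation of I^2 under sigma |-> sigma + w with w of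
   order k+1 is 2 (1 - k/d) G w to leading order, so that for 1 <= k < d the
   error I^2 - 1 can be pushed from order k to order k+1. After d - 1 steps
   I^2 - 1 = O(s^d), and P := G^d (I^2 - 1) / d! is a polynomial in the jets of
   the metric and of s, in 1/det g and in 1/|ds|. The coefficient 1 - k/d
   vanishes at k = d: any two solutions of I^2 = 1 + O(s^d) with the same
   orientation agree to order s^(d+1), and then so do their I^2. Hence P does
   not depend on s and equals the obstruction density; it inherits naturality
   and conformal weight -d from the invariance of I^2.

   Everything but the first-order behaviour of functions along {s = 0} is
   algebra in a commutative ring with commuting derivations pd a, applied to
   the ring of smooth functions on an open subset of R^d. Order k vanishing is
   defined by iterated derivatives (predicate vanish), which avoids dividing by
   powers of s. *)

From Pilot Require Import Defs.
From HB Require Import structures.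
From mathcomp Require Import all_boot all_order all_algebra.
From mathcomp Require Import all_classical all_reals all_analysis.
From mathcomp Require Import ring lra zify.
From mathcomp Require mpoly.
Set Implicit Arguments.
Unset Strict Implicit.
Unset Printing Implicit Defensive.
Import Order.TTheory GRing.Theory Num.Theory.
Import numFieldNormedType.Exports Pilot.Defs.
Local Open Scope classical_set_scope.
Local Open Scope ring_scope.

(** * Differential algebras and Riemannian geometry in them *)

(** The coefficient 1 - k/d arises as follows. Under a change w of order k+1 the gradient term of
    I^2 varies by 2 G w, but -(2/d) sigma Delta w counts as well: Delta w is G (G w) to leading
    order, and sigma G (G w) is k G w by Euler's identity, since G w has order k. The iteration
    differentiates its own earlier stages, including 1/det g and 1/|ds|, and must still end in one
    polynomial for all manifolds. It is therefore run in an abstract ring that contains these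
    inverses: what holds for all such rings gives a single formal expression, and a change of
    coordinates is a ring morphism that respects every step. The values of P for two defining
    functions or for two conformal metrics are not compared term by term. The approximate solution
    for one set of data, multiplied by Omega in the conformal case, is shown to solve the problem
    for the other, and uniqueness does the rest. Analysis enters the order estimates through one
    fact: a function that vanishes on {s = 0} has its differential proportional to ds there. *)

Record diffalg (R : numFieldType) (d : nat) := DiffAlg {
  dcar :> comPzRingType;
  dcst : {rmorphism R -> dcar};
  pd : 'I_d -> {additive dcar -> dcar};
  pdM : forall a x y, pd a (x * y) = pd a x * y + x * pd a y;
  pd_cst : forall a r, pd a (dcst r) = 0;
  pdC : forall a b x, pd a (pd b x) = pd b (pd a x)
}.

Arguments pd {R d d0} _ : rename.

Section Derivations.
Context {R : numFieldType} {d : nat} {A : diffalg R d}.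
Implicit Types (x y : A) (a b : 'I_d).

Lemma pd1 a : pd a (1 : A) = 0.
Proof. by rewrite -(rmorph1 (dcst A)) pd_cst. Qed.

Lemma dcst_nat n : dcst A n%:R = n%:R.
Proof. by rewrite rmorph_nat. Qed.

Lemma pd_nat a n : pd a (n%:R : A) = 0.
Proof. by rewrite -dcst_nat pd_cst. Qed.

Lemma dcstVK (r : R) : r != 0 -> dcst A r^-1 * dcst A r = 1.
Proof. by move=> r0; rewrite -rmorphM mulVf// rmorph1. Qed.

Lemma dcst_half_double x : dcst A 2^-1 * (x + x) = x.
Proof.
rewrite -mulr2n -[x *+ 2]mulr_natl mulrA -dcst_nat dcstVK ?mul1r//.
Qed.

Definition pdmx m n a (M : 'M[A]_(m, n)) : 'M[A]_(m, n) := map_mx (pd a) M.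

Lemma pdmxM m n p a (M : 'M[A]_(m, n)) (N : 'M[A]_(n, p)) :
  pdmx a (M *m N) = pdmx a M *m N + M *m pdmx a N.
Proof.
apply/matrixP => i k; rewrite !mxE raddf_sum -big_split/=.
by apply: eq_bigr => j _; rewrite !mxE pdM.
Qed.

Lemma pdmxD m n a (M N : 'M[A]_(m, n)) : pdmx a (M + N) = pdmx a M + pdmx a N.
Proof. by apply/matrixP => i k; rewrite !mxE raddfD. Qed.

Lemma pdmx_tr m n a (M : 'M[A]_(m, n)) : pdmx a M^T = (pdmx a M)^T.
Proof. by apply/matrixP => i k; rewrite !mxE. Qed.

Lemma pdmxC m n a b (M : 'M[A]_(m, n)) : pdmx a (pdmx b M) = pdmx b (pdmx a M).
Proof. by apply/matrixP => i k; rewrite !mxE pdC. Qed.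

Lemma pdmx_sum m n a (I : finType) (M : I -> 'M[A]_(m, n)) :
  pdmx a (\sum_i M i) = \sum_i pdmx a (M i).
Proof.
apply/matrixP => i k; rewrite !mxE !summxE raddf_sum.
by apply: eq_bigr => j _; rewrite mxE.
Qed.

Lemma pdmxZ m n a x (M : 'M[A]_(m, n)) :
  pdmx a (x *: M) = pd a x *: M + x *: pdmx a M.
Proof. by apply/matrixP => i k; rewrite !mxE pdM. Qed.

End Derivations.

Lemma sum_delta (A : pzSemiRingType) (I : finType) (i : I) (F : I -> A) :
  \sum_j (i == j)%:R * F j = F i.
Proof.
rewrite (bigD1 i)//= eqxx mul1r big1 ?addr0// => j.
by rewrite eq_sym => /negPf ->; rewrite mul0r.
Qed.

Section Geometry.
Context {R : numFieldType} {d : nat} {A : diffalg R d}.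
Implicit Types (a b c e : 'I_d) (f : A) (h hi : 'M[A]_d).

(** The inverse matrix belongs to the data: a general commutative ring offers no total inversion in
    the style of [invmx]. *)
Definition metric_pair h hi : Prop :=
  [/\ h^T = h, h *m hi = 1%:M & hi *m h = 1%:M].

(* Row b, column c of [conn h hi a] is Gamma^c_ab. *)
Definition conn h hi a : 'M[A]_d := \matrix_(b, c)
  (dcst A 2^-1 * \sum_e hi c e * (pd a (h b e) + pd b (h a e) - pd e (h a b))).

(** The curvature form of a connection. The commutator is reversed against the usual formula because
    [conn] keeps the lower index on the rows, so the connection matrices are transposed. *)
Definition curv (G : 'I_d -> 'M[A]_d) a b : 'M[A]_d :=
  pdmx a (G b) - pdmx b (G a) + (G b *m G a - G a *m G b).

Definition ric (G : 'I_d -> 'M[A]_d) : 'M[A]_d := \matrix_(a, b)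
  \sum_c (pd c (G a b c) - pd a (G c b c)
    + \sum_e (G c e c * G a b e - G a e c * G c b e)).

Definition contr hi (M : 'M[A]_d) : A := \sum_a \sum_b hi a b * M a b.

Definition dscal h hi : A := contr hi (ric (conn h hi)).

Definition hess (G : 'I_d -> 'M[A]_d) f : 'M[A]_d := \matrix_(a, b)
  (pd a (pd b f) - \sum_c G a b c * pd c f).

Definition dlap h hi f : A := contr hi (hess (conn h hi) f).

Definition dgrad hi f g : A := \sum_a \sum_b hi a b * pd a f * pd b g.

Definition djtrace h hi : A := dcst A (2 * d.-1%:R)^-1 * dscal h hi.

Definition disq h hi f : A :=
  dgrad hi f f - dcst A (2 / d%:R) * f * (dlap h hi f + djtrace h hi * f).

Lemma ricE (G : 'I_d -> 'M[A]_d) a b :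
  ric G a b = \sum_c curv G c a b c.
Proof.
rewrite mxE; apply: eq_bigr => c _; rewrite !mxE; congr (_ + _).
rewrite -sumrB; apply: eq_bigr => e _; by rewrite mulrC [_ * G a e c]mulrC.
Qed.

Lemma pair_trV h hi : metric_pair h hi -> hi^T = hi.
Proof.
move=> [hs hhi hih].
by rewrite -[LHS](mul1mx) -hih -mulmxA -{1}hs -trmx_mul hih trmx1 mulmx1.
Qed.

Lemma conn_sym h hi a b c : h^T = h -> conn h hi a b c = conn h hi b a c.
Proof.
move=> hs; rewrite !mxE; congr (_ * _); apply: eq_bigr => e _.
have -> : h b a = h a b by rewrite -{1}hs mxE.
by rewrite [pd a _ + _]addrC.
Qed.

Lemma conn_lower h hi a : metric_pair h hi ->
  conn h hi a *m h = \matrix_(b, e) (dcst A 2^-1 *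
    (pd a (h b e) + pd b (h a e) - pd e (h a b))).
Proof.
move=> mp; have [hs hhi hih] := mp.
have -> : conn h hi a = (\matrix_(b, e) (dcst A 2^-1 *
    (pd a (h b e) + pd b (h a e) - pd e (h a b)))) *m hi.
  apply/matrixP => b c; rewrite !mxE mulr_sumr; apply: eq_bigr => e _.
  by rewrite !mxE -[hi in LHS](pair_trV mp) mxE mulrA mulrAC.
by rewrite -mulmxA hih mulmx1.
Qed.

Lemma conn_metric h hi a : metric_pair h hi ->
  pdmx a h = conn h hi a *m h + h *m (conn h hi a)^T.
Proof.
move=> mp; have [hs _ _] := mp.
have -> : h *m (conn h hi a)^T = (conn h hi a *m h)^T by rewrite trmx_mul hs.
rewrite conn_lower//; apply/matrixP => b e; rewrite !mxE.
rewrite -mulrDr -[LHS]dcst_half_double; congr (_ * _).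
have sw : h e b = h b e by rewrite -{1}hs mxE.
by rewrite sw; ring.
Qed.

(** Koszul's argument: metric compatibility under permutations of the indices, together with
    symmetry, determines the lowered symbols. Transformation laws can then be verified on a
    candidate instead of being computed from the formula for [conn]. *)
Lemma conn_unique h hi (G : 'I_d -> 'M[A]_d) : metric_pair h hi ->
  (forall a, pdmx a h = G a *m h + h *m (G a)^T) ->
  (forall a b c, G a b c = G b a c) -> forall a, G a = conn h hi a.
Proof.
move=> mp Gm Gs a; have [hs hhi hih] := mp.
suff L : G a *m h = conn h hi a *m h.
  by rewrite -[LHS]mulmx1 -hhi mulmxA L -mulmxA hhi mulmx1.
rewrite conn_lower//.
pose L a := G a *m h.
have Ls x y z : L x y z = L y x z.
  by rewrite !mxE; apply: eq_bigr => c _; rewrite Gs.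
have Lm x y z : pd x (h y z) = L x y z + L x z y.
  have := Gm x => /matrixP /(_ y z); rewrite mxE => ->.
  have -> : h *m (G x)^T = (L x)^T by rewrite /L trmx_mul hs.
  by rewrite [LHS]mxE [X in _ + X = _]mxE.
apply/matrixP => b e; rewrite [RHS]mxE -/(L a) !Lm.
rewrite -[LHS]dcst_half_double; congr (_ * _).
rewrite [L e a b]Ls [L e b a]Ls [L b a e]Ls; ring.
Qed.

End Geometry.

(** * Curvature and I^2 under a change of coordinates *)

Section Pullback.
Context {R : numFieldType} {d : nat} {A B : diffalg R d}.
Variables (phi : {rmorphism B -> A}) (J K : 'M[A]_d).
Hypothesis phi_cst : forall r, phi (dcst B r) = dcst A r.
Hypothesis phi_pd : forall a f, pd a (phi f) = \sum_b J a b * phi (pd b f).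
Hypothesis J_closed : forall a b c, pd a (J b c) = pd b (J a c).
Hypotheses (JK : J *m K = 1%:M) (KJ : K *m J = 1%:M).
Variables (h hi : 'M[A]_d) (h' hi' : 'M[B]_d).
Hypotheses (hmp : metric_pair h hi) (h'mp : metric_pair h' hi').
Hypothesis h_pull : h = J *m map_mx phi h' *m J^T.
Local Notation "M ^p" := (map_mx phi M) (at level 2, format "M ^p").

Let G' := conn h' hi'.
(** The pulled-back connection form, still written in the frame of the target; the gauge
    transformation by [J] leads to the frame of the source. *)
Let H a : 'M[A]_d := \sum_k J a k *: (G' k)^p.

Lemma pdmx_pull a m n (M : 'M[B]_(m, n)) :
  pdmx a M^p = \sum_k J a k *: (pdmx k M)^p.
Proof.
apply/matrixP => i j; rewrite !mxE summxE phi_pd.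
by apply: eq_bigr => k _; rewrite !mxE.
Qed.

(** The inhomogeneous law for Christoffel symbols. The right-hand side is metric because
    differentiating [h_pull] yields exactly its terms, and symmetric because [J_closed] makes the
    inhomogeneous part symmetric. *)
Lemma conn_pull a : conn h hi a = (pdmx a J + J *m H a) *m K.
Proof.
apply/esym; pose G a := (pdmx a J + J *m H a) *m K.
have GJ b : G b *m J = pdmx b J + J *m H b by rewrite -mulmxA KJ mulmx1.
have dh' b : pdmx b h'^p = H b *m h'^p + h'^p *m (H b)^T.
  rewrite pdmx_pull /H raddf_sum mulmx_suml mulmx_sumr -big_split/=.
  apply: eq_bigr => k _; rewrite linearZ/= -scalemxAl -scalemxAr -scalerDr.
  by rewrite (conn_metric k h'mp) map_mxD !map_mxM map_trmx.
apply: (conn_unique hmp (G := G)) => [b|b c e].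
  rewrite h_pull !pdmxM dh' pdmx_tr mulmxDl.
  have -> : G b *m (J *m h'^p *m J^T) = (pdmx b J + J *m H b) *m h'^p *m J^T.
    by rewrite !mulmxA GJ.
  have -> : J *m h'^p *m J^T *m (G b)^T = J *m h'^p *m (pdmx b J + J *m H b)^T.
    by rewrite -mulmxA -trmx_mul GJ.
  rewrite [(_ + J *m H b)^T]linearD/= [(J *m H b)^T]trmx_mul.
  rewrite !(mulmxDl, mulmxDr) !mulmxA -!addrA; congr (_ + (_ + _)).
  by rewrite addrC.
suff sym k : (G b *m J) c k = (G c *m J) b k.
  have row1 (x : 'M[A]_d) i j : x i j = \sum_k (x *m J) i k * K k j.
    by rewrite -{1}[x]mulmx1 -JK mulmxA [LHS]mxE.
  by rewrite (row1 (G b)) (row1 (G c)); apply: eq_bigr => k _; rewrite sym.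
rewrite !GJ !mxE J_closed; congr (_ + _).
have E (x y : 'I_d) : \sum_j J x j * H y j k =
   \sum_j \sum_l J x j * J y l * phi (G' l j k).
  apply: eq_bigr => j _; rewrite summxE mulr_sumr; apply: eq_bigr => l _.
  by rewrite !mxE mulrA.
rewrite !E exchange_big/=; apply: eq_bigr => i _; apply: eq_bigr => j _.
have [hs' _ _] := h'mp.
by rewrite [J c j * _]mulrC [G' j i k](conn_sym hi' _ _ _ hs').
Qed.

Let G := conn h hi.

Let GJ a : G a *m J = pdmx a J + J *m H a.
Proof. by rewrite /G conn_pull -mulmxA KJ mulmx1. Qed.

Let pdmxJC a b : pdmx a (pdmx b J) = pdmx b (pdmx a J).
Proof. exact: pdmxC. Qed.

(* J acts as a gauge transformation on the matrices of Christoffel symbols. *)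
Lemma curv_gauge a b : curv G a b *m J = J *m curv H a b.
Proof.
have dG x y : pdmx x (G y) *m J = pdmx x (pdmx y J) + pdmx x J *m H y +
    J *m pdmx x (H y) - G y *m pdmx x J.
  have := congr1 (pdmx x) (GJ y); rewrite pdmxM pdmxD pdmxM => E.
  by apply/eqP; rewrite eq_sym subr_eq -addrA -E eqxx.
have GG x y : G x *m G y *m J =
    G x *m pdmx y J + pdmx x J *m H y + J *m H x *m H y.
  by rewrite -mulmxA GJ mulmxDr mulmxA GJ mulmxDl addrA.
rewrite /curv !(mulmxDl, mulmxDr, mulNmx, mulmxN) !dG !GG !mulmxA pdmxJC.
set X1 := pdmx _ (pdmx _ _); set X2 := pdmx a J *m _; set X3 := J *m pdmx a _.
set X4 := G b *m _; set X5 := pdmx b J *m _; set X6 := J *m pdmx b _.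
set X7 := G a *m _; set X8 := _ *m H b *m H a; set X9 := _ *m H a *m H b.
by apply/matrixP => i j; rewrite !mxE; ring.
Qed.

(** A matrix-valued two-form is pulled back: the terms that contain a derivative of [J] are
    symmetric in [a] and [b], so alternation cancels them. *)
Lemma curv_pull_form a b :
  curv H a b = \sum_k \sum_l (J a k * J b l) *: (curv G' k l)^p.
Proof.
have dH x y : pdmx x (H y) = \sum_k pd x (J y k) *: (G' k)^p +
    \sum_k \sum_l (J x k * J y l) *: (pdmx k (G' l))^p.
  rewrite /H pdmx_sum exchange_big/= -big_split; apply: eq_bigr => l _.
  rewrite pdmxZ pdmx_pull scaler_sumr; congr (_ + _); apply: eq_bigr => k _.
  by rewrite scalerA mulrC.
have HH x y : H x *m H y =
    \sum_k \sum_l (J x k * J y l) *: (G' k *m G' l)^p.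
  rewrite mulmx_suml; apply: eq_bigr => k _; rewrite mulmx_sumr.
  apply: eq_bigr => l _.
  by rewrite -scalemxAl -scalemxAr scalerA map_mxM.
have sw (F : 'I_d -> 'I_d -> 'M[B]_d) :
    \sum_k \sum_l (J b k * J a l) *: (F k l)^p =
    \sum_k \sum_l (J a k * J b l) *: (F l k)^p.
  rewrite exchange_big; apply: eq_bigr => k _; apply: eq_bigr => l _.
  by rewrite mulrC.
rewrite /curv !dH !HH !sw.
have -> : \sum_k pd a (J b k) *: (G' k)^p = \sum_k pd b (J a k) *: (G' k)^p.
  by apply: eq_bigr => k _; rewrite J_closed.
set X := \sum_k pd b _ *: _.
rewrite opprD [X + _ + (- X + _)]addrACA subrr add0r -sumrB -sumrB -big_split/=.
apply: eq_bigr => k _; rewrite -sumrB -sumrB -big_split/=.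
apply: eq_bigr => l _.
by rewrite -!scalerBr -scalerDr !(map_mxD, map_mxN).
Qed.

Lemma ric_pull : ric G = J *m (ric G')^p *m J^T.
Proof.
apply/matrixP => a b; rewrite ricE.
(* The upper index, transformed by [K], is traced against the first form index, transformed by [J];
   the sum over [c] of [K n c * J c k] leaves a Kronecker delta. *)
have -> : \sum_c curv G c a b c = \sum_c \sum_k \sum_l \sum_m \sum_n
    (K n c * J c k) * (J b m * (J a l * phi (curv G' k l m n))).
  apply: eq_bigr => c _.
  have -> : curv G c a = J *m curv H c a *m K.
    by rewrite -curv_gauge -mulmxA JK mulmx1.
  rewrite curv_pull_form mulmx_sumr mulmx_suml summxE; apply: eq_bigr => k _.
  rewrite mulmx_sumr mulmx_suml summxE; apply: eq_bigr => l _.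
  rewrite -scalemxAr -scalemxAl mxE mxE mulr_sumr exchange_big/=.
  rewrite [LHS](eq_bigr (fun n => \sum_m (K n c * J c k) * (J b m *
    (J a l * phi (curv G' k l m n))))) => [|n _].
    by rewrite exchange_big.
  rewrite mxE mulr_suml mulr_sumr; apply: eq_bigr => m _.
  by rewrite mxE; ring.
pose X k l m n := J b m * (J a l * phi (curv G' k l m n)).
rewrite (eq_bigr (fun c => \sum_k \sum_n (K n c * J c k) *
    (\sum_l \sum_m X k l m n))); last first.
  move=> c _; apply: eq_bigr => k _.
  under eq_bigr do rewrite exchange_big.
  rewrite exchange_big/=; apply: eq_bigr => n _; rewrite mulr_sumr.
  by apply: eq_bigr => l _; rewrite mulr_sumr.
rewrite exchange_big/=.
rewrite (eq_bigr (fun k => \sum_l \sum_m X k l m k)); last first.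
  move=> k _; rewrite exchange_big/=.
  rewrite -(sum_delta k (fun n => \sum_l \sum_m X k l m n)).
  apply: eq_bigr => n _; rewrite -mulr_suml; congr (_ * _).
  have := KJ => /matrixP /(_ n k); rewrite !mxE => ->.
  by rewrite eq_sym.
rewrite exchange_big/= [RHS]mxE.
rewrite [RHS](eq_bigr (fun m => \sum_l \sum_k X k l m k)) => [|m _]; last first.
  rewrite mxE mulr_suml; apply: eq_bigr => l _.
  have -> : (ric G')^p l m = phi (\sum_k curv G' k l m k).
    by rewrite [LHS]mxE ricE.
  rewrite [J^T _ _]mxE rmorph_sum mulr_sumr mulr_suml.
  by apply: eq_bigr => k _; rewrite /X; ring.
rewrite [RHS]exchange_big; apply: eq_bigr => l _; exact: exchange_big.
Qed.

Lemma contr_pull (M : 'M[B]_d) :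
  contr hi (J *m M^p *m J^T) = phi (contr hi' M).
Proof.
(* The inverse metric transforms in the opposite direction. A contraction is a trace, and its
   cyclicity brings the three factors of this product together. *)
have hiE : J^T *m hi *m J = hi'^p.
  have [_ hhi _] := hmp; have [_ _ hih'] := h'mp.
  have E : hi'^p *m K *m h = J^T.
    by rewrite h_pull !mulmxA -(mulmxA _ K J) KJ mulmx1 -map_mxM hih' map_mx1 mul1mx.
  by rewrite -E -(mulmxA _ h hi) hhi mulmx1 -mulmxA KJ mulmx1.
have trE (D : diffalg R d) (X Y : 'M[D]_d) : contr X Y = \tr (X *m Y^T).
  rewrite /mxtrace; apply: eq_bigr => a _; rewrite mxE; apply: eq_bigr => b _.
  by rewrite mxE.
rewrite !trE !trmx_mul trmxK map_trmx !mulmxA mxtrace_mulC !mulmxA hiE.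
by rewrite -map_mxM trace_map_mx.
Qed.

Lemma dscal_pull : dscal h hi = phi (dscal h' hi').
Proof. by rewrite /dscal -/G ric_pull contr_pull. Qed.

Lemma hess_pull f : hess G (phi f) = J *m (hess G' f)^p *m J^T.
Proof.
apply/matrixP => a b; rewrite !mxE.
have -> : pd a (pd b (phi f)) = \sum_l pd a (J b l) * phi (pd l f) +
    \sum_k \sum_l J a k * (J b l * phi (pd k (pd l f))).
  rewrite phi_pd raddf_sum exchange_big/= -big_split; apply: eq_bigr => l _.
  rewrite pdM phi_pd mulr_sumr; congr (_ + _); apply: eq_bigr => k _; ring.
have -> : \sum_c G a b c * pd c (phi f) = \sum_l pd a (J b l) * phi (pd l f) +
    \sum_k \sum_l J a k * (J b l * phi (\sum_n G' k l n * pd n f)).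
  rewrite (eq_bigr (fun c => \sum_n G a b c * J c n * phi (pd n f))); last first.
    by move=> c _; rewrite phi_pd mulr_sumr; apply: eq_bigr => n _; rewrite mulrA.
  rewrite exchange_big/=.
  rewrite (eq_bigr (fun n => pd a (J b n) * phi (pd n f) +
      \sum_k \sum_l J a k * (J b l * phi (G' k l n * pd n f)))); last first.
    move=> n _; rewrite -mulr_suml.
    have := GJ a => /matrixP /(_ b n); rewrite !mxE => ->.
    rewrite mulrDl; congr (_ + _); rewrite mulr_suml exchange_big/=.
    apply: eq_bigr => l _; rewrite summxE mulr_sumr mulr_suml.
    by apply: eq_bigr => k _; rewrite !mxE rmorphM; ring.
  rewrite big_split/=; congr (_ + _); rewrite exchange_big/=.
  apply: eq_bigr => k _; rewrite exchange_big/=; apply: eq_bigr => l _.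
  by rewrite rmorph_sum !mulr_sumr.
rewrite opprD addrACA subrr add0r.
rewrite [RHS](eq_bigr (fun l => \sum_k J a k * (J b l * phi (pd k (pd l f)
   - \sum_n G' k l n * pd n f)))); last first.
  move=> l _; rewrite mxE mulr_suml; apply: eq_bigr => k _; rewrite !mxE; ring.
rewrite [RHS]exchange_big/= -sumrB; apply: eq_bigr => k _.
rewrite -sumrB; apply: eq_bigr => l _; by rewrite rmorphB !mulrBr.
Qed.

Lemma dlap_pull f : dlap h hi (phi f) = phi (dlap h' hi' f).
Proof. by rewrite /dlap -/G hess_pull contr_pull. Qed.

Lemma dgrad_pull f g : dgrad hi (phi f) (phi g) = phi (dgrad hi' f g).
Proof.
have E (D : diffalg R d) (X : 'M[D]_d) u v :
    dgrad X u v = contr X (\matrix_(a, b) (pd a u * pd b v)).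
  by apply: eq_bigr => a _; apply: eq_bigr => b _; rewrite mxE mulrA.
rewrite !E -contr_pull; congr (contr _ _); apply/matrixP => a b.
rewrite !mxE !phi_pd mulr_sumr; apply: eq_bigr => l _.
rewrite mulrA mxE !mulr_suml; apply: eq_bigr => k _; rewrite !mxE rmorphM; ring.
Qed.

Lemma disq_pull f : disq h hi (phi f) = phi (disq h' hi' f).
Proof.
rewrite /disq dgrad_pull dlap_pull /djtrace dscal_pull -!phi_cst.
by rewrite !(rmorphB, rmorphM, rmorphD).
Qed.

End Pullback.

(** * Conformal rescaling *)

Section Conformal.
Context {R : numFieldType} {d : nat} {A : diffalg R d}.
Variables (h hi : 'M[A]_d) (Om Oi : A).
Hypothesis hmp : metric_pair h hi.
Hypothesis OmK : Om * Oi = 1.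
Implicit Types (a b c e : 'I_d) (f : A).

Let h' := Om ^+ 2 *: h.
Let hi' := Oi ^+ 2 *: hi.
Let G := conn h hi.
(** [U] is d log Om written without a logarithm, [w] is the same covector with raised index, and [C]
    is the difference of the two Levi-Civita connections. *)
Let U a := Oi * pd a Om.
Let w c := \sum_e hi c e * U e.
Let C a : 'M[A]_d := \matrix_(b, c)
  ((a == c)%:R * U b + (b == c)%:R * U a - h a b * w c).

Lemma conformal_pair : metric_pair h' hi'.
Proof.
have [hs hhi hih] := hmp; split.
- by rewrite /h' linearZ/= hs.
- rewrite /h' /hi' -scalemxAl -scalemxAr scalerA hhi -exprMn OmK expr1n.
  by rewrite scale1r.
- rewrite /h' /hi' -scalemxAl -scalemxAr scalerA hih -exprMn mulrC OmK expr1n.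
  by rewrite scale1r.
Qed.

Let hs a b : h a b = h b a.
Proof. by have [hs _ _] := hmp; rewrite -{1}hs mxE. Qed.

Let his a b : hi a b = hi b a.
Proof. by rewrite -{1}(pair_trV hmp) mxE. Qed.

Let Gs a b c : G a b c = G b a c.
Proof. by have [hT _ _] := hmp; exact: conn_sym. Qed.

Let hhi a b : \sum_c h a c * hi c b = (a == b)%:R.
Proof. by have [_ /matrixP /(_ a b) + _] := hmp; rewrite !mxE. Qed.

Let hw a : \sum_c h a c * w c = U a.
Proof.
rewrite -[RHS](sum_delta a U).
under eq_bigr do rewrite mulr_sumr.
rewrite exchange_big; apply: eq_bigr => e _; rewrite -hhi mulr_suml.
by apply: eq_bigr => c _; rewrite mulrA.
Qed.

Let pdOm a : pd a Om = Om * U a.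
Proof. by rewrite /U mulrA OmK mul1r. Qed.

Let pdOi a : pd a Oi = - (Oi * U a).
Proof.
have /(congr1 (pd a)) := OmK; rewrite pd1 pdM => E.
have -> : pd a Oi = Oi * (Om * pd a Oi) by rewrite mulrA [Oi * Om]mulrC OmK mul1r.
have -> : Om * pd a Oi = - (pd a Om * Oi) by apply/eqP; rewrite -addr_eq0 addrC E.
by rewrite /U; ring.
Qed.

Let U_closed a b : pd a (U b) = pd b (U a).
Proof. by rewrite /U !pdM pdC !pdOi /U; ring. Qed.

Let sumC a b (F : 'I_d -> A) : \sum_c C a b c * F c =
  U b * F a + U a * F b - h a b * \sum_c w c * F c.
Proof.
rewrite -(sum_delta a F) -(sum_delta b F) !mulr_sumr -sumrN -!big_split/=.
by apply: eq_bigr => c _; rewrite mxE; ring.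
Qed.

Lemma conformal_conn a : conn h' hi' a = G a + C a.
Proof.
apply/esym; apply: (conn_unique conformal_pair (G := fun a => G a + C a)).
  move=> {}a; rewrite pdmxZ (conn_metric a hmp) -/G.
  have -> : pd a (Om ^+ 2) *: h = Om ^+ 2 *: (C a *m h + h *m (C a)^T).
    have [hT _ _] := hmp.
    have -> : h *m (C a)^T = (C a *m h)^T by rewrite trmx_mul hT.
    apply/matrixP => b e; rewrite !mxE !sumC.
    have hw' x : \sum_c w c * h c x = U x.
      by rewrite -hw; apply: eq_bigr => c _; rewrite mulrC hs.
    by rewrite !hw' expr2 pdM pdOm (hs e b); ring.
  rewrite -scalerDr [(_ + C a)^T]linearD/= /h' -scalemxAr -scalemxAl -scalerDr.
  by congr (_ *: _); rewrite mulmxDl mulmxDr addrC addrACA.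
move=> {}a b c; rewrite mxE [RHS]mxE Gs; congr (_ + _).
by rewrite !mxE (hs b a); ring.
Qed.

(** [N] is the covariant derivative of d log Om, [L] the Laplacian of log Om and [UU] the squared
    length of d log Om. The contracted symbols [tau] are not tensorial and have to disappear from
    the final formulas. *)
Let N : 'M[A]_d := \matrix_(a, b) (pd a (U b) - \sum_c G a b c * U c).
Let L := contr hi N.
Let UU := \sum_c w c * U c.
Let tau b := \sum_c G c b c.

Let pd_hi c : pdmx c hi = - (hi *m G c + (G c)^T *m hi).
Proof.
have [_ hhi1 hih] := hmp.
have : pdmx c (hi *m h) = 0.
  by rewrite hih; apply/matrixP => i j; rewrite !mxE pd_nat.
rewrite pdmxM => /(congr1 (mulmx^~ hi)).
rewrite mulmxDl mul0mx -mulmxA hhi1 mulmx1 => /eqP; rewrite addr_eq0 => /eqP ->.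
congr (- _); rewrite (conn_metric c hmp) -/G mulmxDr mulmxDl !mulmxA hih mul1mx.
by rewrite -(mulmxA _ h hi) hhi1 mulmx1.
Qed.

(** The Ricci computation produces coordinate derivatives of [w]; they become invariant once the
    contracted Christoffel symbols are added, which is the divergence formula. *)
Let divw : \sum_c pd c (w c) + \sum_c tau c * w c = L.
Proof.
have -> : \sum_c pd c (w c) = \sum_c \sum_e hi c e * pd c (U e)
    - \sum_c \sum_f hi c f * (\sum_e G c f e * U e)
    - \sum_c \sum_f G c f c * w f.
  rewrite -!sumrB; apply: eq_bigr => c _; rewrite raddf_sum.
  rewrite (eq_bigr (fun e => hi c e * pd c (U e) - (hi *m G c) c e * U e
     - ((G c)^T *m hi) c e * U e)); last first.
    move=> e _; rewrite pdM; have /matrixP /(_ c e) := pd_hi c.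
    by rewrite mxE [RHS]mxE [in RHS]mxE => ->; ring.
  rewrite !sumrB; congr (_ - _ - _).
    rewrite (eq_bigr (fun e => \sum_f hi c f * (G c f e * U e))) => [|e _].
      by rewrite exchange_big; apply: eq_bigr => f _; rewrite mulr_sumr.
    by rewrite mxE mulr_suml; apply: eq_bigr => f _; rewrite mulrA.
  rewrite (eq_bigr (fun e => \sum_f G c f c * (hi f e * U e))) => [|e _].
    by rewrite exchange_big; apply: eq_bigr => f _; rewrite mulr_sumr.
  rewrite mxE mulr_suml; apply: eq_bigr => f _; by rewrite mxE mulrA.
have -> : \sum_c tau c * w c = \sum_c \sum_f G c f c * w f.
  by rewrite exchange_big; apply: eq_bigr => f _; rewrite mulr_suml.
rewrite subrK -sumrB; apply: eq_bigr => c _; rewrite -sumrB.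
by apply: eq_bigr => e _; rewrite mxE mulrBr.
Qed.

Let trC b : \sum_c C c b c = d%:R * U b.
Proof.
rewrite (eq_bigr (fun c => U b + (b == c)%:R * U c - h b c * w c)); last first.
  by move=> c _; rewrite mxE eqxx mul1r (hs c).
by rewrite sumrB big_split/= sum_delta hw sumr_const card_ord mulr_natl addrK.
Qed.

(** The Ricci tensor of [G + C] is expanded into derivatives of [C] ([E1], [E2], with [E9] trading
    derivatives of [h] for [G]), terms linear in [C] ([E3], [E4], [E6], [E7]) and quadratic ones
    ([E4], [E5], [E7], [E8]). The leftover symbols [G] complete the derivatives of [U] and [w] to
    [N] and [L]. *)
Lemma conformal_ric a b : ric (conn h' hi') a b = ric G a b
  - (d%:R - 2) * N a b - h a b * L
  + (d%:R - 2) * (U a * U b - h a b * UU).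
Proof.
have E1 : \sum_c pd c (C a b c) = pd a (U b) + pd b (U a)
    - \sum_c w c * pd c (h a b) - h a b * \sum_c pd c (w c).
  rewrite -(sum_delta a (fun c => pd c (U b))).
  rewrite -(sum_delta b (fun c => pd c (U a))) mulr_sumr -sumrN -sumrN -!big_split/=.
  apply: eq_bigr => c _; rewrite mxE raddfB raddfD !pdM !pd_nat; ring.
have E2 : \sum_c pd a (C c b c) = d%:R * pd a (U b).
  by rewrite -raddf_sum trC pdM pd_nat mul0r add0r.
have E3 : \sum_c \sum_e G c e c * C a b e =
    U b * tau a + U a * tau b - h a b * \sum_c tau c * w c.
  rewrite exchange_big/= -[in RHS](eq_bigr _ (fun c _ => mulrC (w c) (tau c))).
  rewrite -sumC; apply: eq_bigr => e _.
  by rewrite mulr_sumr; apply: eq_bigr => c _; rewrite mulrC.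
have E4 (F : 'I_d -> A) : \sum_c \sum_e C c e c * F e =
    d%:R * \sum_e F e * U e.
  rewrite exchange_big mulr_sumr; apply: eq_bigr => e _.
  by rewrite -mulr_suml trC; ring.
have E5 : \sum_e C a b e * U e = 2 * (U a * U b) - h a b * UU.
  by rewrite sumC -/UU; ring.
have E6 : \sum_c \sum_e G a e c * C c b e =
    U b * tau a + \sum_c G a b c * U c - \sum_c w c * (G c *m h) a b.
  rewrite (eq_bigr (fun c => U b * G a c c + U c * G a b c -
     h c b * \sum_e w e * G a e c)) => [|c _]; last first.
    by rewrite -(sumC c b (fun e => G a e c)); apply: eq_bigr => e _; rewrite mulrC.
  rewrite sumrB big_split/= -mulr_sumr; congr (_ * _ + _ - _).
  - by apply: eq_bigr => c _; rewrite Gs.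
  - by apply: eq_bigr => c _; rewrite mulrC.
  under eq_bigr do rewrite mulr_sumr.
  rewrite exchange_big; apply: eq_bigr => e _; rewrite mxE mulr_sumr.
  by apply: eq_bigr => c _; rewrite (Gs e); ring.
have E7 (F : 'I_d -> 'I_d -> A) : \sum_c \sum_e C a e c * F c e =
    \sum_e U e * F a e + U a * \sum_c F c c
    - \sum_c w c * \sum_e F c e * h e a.
  rewrite exchange_big/= (eq_bigr (fun e => U e * F a e + U a * F e e -
     \sum_c h a e * (w c * F c e))) => [|e _]; last by rewrite sumC mulr_sumr.
  rewrite sumrB big_split/= -mulr_sumr; congr (_ - _).
  rewrite exchange_big; apply: eq_bigr => c _; rewrite mulr_sumr.
  by apply: eq_bigr => e _; rewrite (hs a); ring.
have E8 : \sum_c w c * \sum_e C c b e * h e a = h a b * UU.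
  rewrite (eq_bigr (fun c => U b * (h a c * w c) + h a b * (w c * U c)
    - U a * (h b c * w c))) => [|c _].
    by rewrite sumrB big_split/= -!mulr_sumr !hw /UU; ring.
  rewrite sumC.
  have -> : \sum_e w e * h e a = U a.
    by rewrite -hw; apply: eq_bigr => e _; rewrite mulrC hs.
  by rewrite (hs c a) (hs b a) (hs c b); ring.
have E9 : \sum_c w c * pd c (h a b) = \sum_c w c * (G c *m h) a b +
    \sum_c w c * (G c *m h) b a.
  rewrite -big_split/=; apply: eq_bigr => c _; rewrite -mulrDr; congr (_ * _).
  have := conn_metric c hmp => /matrixP /(_ a b).
  rewrite [LHS]mxE => ->; rewrite mxE -/G; congr (_ + _).
  by rewrite !mxE; apply: eq_bigr => e _; rewrite mxE mulrC hs.
have tauE : \sum_c G c b c = tau b by [].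
rewrite mxE (eq_bigr (fun c => (pd c (G a b c) - pd a (G c b c)
    + \sum_e (G c e c * G a b e - G a e c * G c b e)) +
  (pd c (C a b c) - pd a (C c b c) +
   (\sum_e G c e c * C a b e + \sum_e C c e c * G a b e + \sum_e C c e c * C a b e
   - \sum_e G a e c * C c b e - \sum_e C a e c * G c b e
   - \sum_e C a e c * C c b e)))); last first.
  move=> c _; rewrite !conformal_conn -!big_split/= -!sumrB.
  have EE (x y : 'M[A]_d) i j : (x + y) i j = x i j + y i j by rewrite mxE.
  rewrite !EE !raddfD/=.
  rewrite (eq_bigr (fun e => (G c e c * G a b e - G a e c * G c b e) +
    (G c e c * C a b e + C c e c * G a b e + C c e c * C a b e
     - G a e c * C c b e - C a e c * G c b e - C a e c * C c b e))) => [|e _].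
    by rewrite big_split/=; ring.
  by rewrite !EE; ring.
rewrite big_split/=; have -> : \sum_c (pd c (G a b c) - pd a (G c b c)
    + \sum_e (G c e c * G a b e - G a e c * G c b e)) = ric G a b by rewrite mxE.
rewrite big_split/= sumrB !sumrB !big_split/=.
rewrite E1 E2 E3 !E4 E5 E6 !E7 E8 E9 trC tauE.
have -> : \sum_e U e * G a b e = \sum_c G a b c * U c.
  by apply: eq_bigr => e _; rewrite mulrC.
have -> : \sum_e U e * C a b e = 2 * (U a * U b) - h a b * UU.
  by rewrite -E5; apply: eq_bigr => e _; rewrite mulrC.
have -> : \sum_c w c * (\sum_e G c b e * h e a) = \sum_c w c * (G c *m h) b a.
  by apply: eq_bigr => c _; rewrite mxE.
have -> : N a b = pd a (U b) - \sum_c G a b c * U c by rewrite mxE.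
rewrite -divw (U_closed b a).
ring.
Qed.


Let contrD (M M' : 'M[A]_d) : contr hi (M + M') = contr hi M + contr hi M'.
Proof.
rewrite -big_split; apply: eq_bigr => a _; rewrite -big_split.
by apply: eq_bigr => b _; rewrite mxE mulrDr.
Qed.

Let contrZ x (M : 'M[A]_d) : contr hi (x *: M) = x * contr hi M.
Proof.
rewrite mulr_sumr; apply: eq_bigr => a _; rewrite mulr_sumr.
by apply: eq_bigr => b _; rewrite mxE mulrCA.
Qed.

Let contr_h : contr hi h = d%:R.
Proof.
transitivity (\sum_(a < d) (1 : A)); last by rewrite sumr_const card_ord.
apply: eq_bigr => a _.
rewrite (eq_bigr (fun b => h a b * hi b a)) ?hhi ?eqxx// => b _.
by rewrite mulrC his.
Qed.

Let contr_outer (F : 'I_d -> A) :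
  contr hi (\matrix_(a, b) (U a * F b)) = \sum_c w c * F c.
Proof.
rewrite /contr exchange_big; apply: eq_bigr => c _; rewrite mulr_suml.
by apply: eq_bigr => a _; rewrite mxE his mulrA.
Qed.

Let contr_outerr (F : 'I_d -> A) :
  contr hi (\matrix_(a, b) (F a * U b)) = \sum_c w c * F c.
Proof.
apply: eq_bigr => c _; rewrite mulr_suml.
by apply: eq_bigr => a _; rewrite mxE mulrAC -mulrA mulrC -!mulrA; congr (_ * _).
Qed.

Let contr_hi' (M : 'M[A]_d) : contr hi' M = Oi ^+ 2 * contr hi M.
Proof.
rewrite mulr_sumr; apply: eq_bigr => a _; rewrite mulr_sumr.
by apply: eq_bigr => b _; rewrite mxE mulrA.
Qed.

Lemma conformal_scal : dscal h' hi' = Oi ^+ 2 * (dscal h hi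
  - 2 * (d%:R - 1) * L - (d%:R - 1) * (d%:R - 2) * UU).
Proof.
rewrite /dscal contr_hi'; congr (_ * _).
have -> : ric (conn h' hi') = ric G + (- (d%:R - 2)) *: N + (- L) *: h
   + (d%:R - 2) *: (\matrix_(a, b) (U a * U b) + (- UU) *: h).
  by apply/matrixP => a b; rewrite conformal_ric !mxE; ring.
by rewrite !(contrD, contrZ) contr_h contr_outer -/L -/UU; ring.
Qed.

Let wg f := \sum_c w c * pd c f.

Lemma conformal_lap f :
  dlap h' hi' f = Oi ^+ 2 * (dlap h hi f + (d%:R - 2) * wg f).
Proof.
rewrite /dlap contr_hi'; congr (_ * _).
have -> : hess (conn h' hi') f = hess G f
   + (- 1) *: \matrix_(a, b) (U a * pd b f) + (- 1) *: \matrix_(a, b) (pd a f * U b)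
   + wg f *: h.
  apply/matrixP => a b; rewrite !mxE.
  rewrite (eq_bigr (fun c => G a b c * pd c f + C a b c * pd c f)); last first.
    by move=> c _; rewrite conformal_conn -mulrDl mxE.
  by rewrite big_split/= sumC -/(wg f); ring.
by rewrite !(contrD, contrZ) contr_h contr_outer contr_outerr -/(wg f); ring.
Qed.

Lemma lap_rescaled f :
  dlap h hi (Om * f) = Om * (dlap h hi f + 2 * wg f + f * (L + UU)).
Proof.
rewrite /dlap.
have -> : hess G (Om * f) = Om *: (hess G f + \matrix_(a, b) (U a * pd b f)
   + \matrix_(a, b) (pd a f * U b) + f *: (N + \matrix_(a, b) (U a * U b))).
  apply/matrixP => a b.
  have E c : pd c (Om * f) = Om * (U c * f + pd c f).
    by rewrite pdM pdOm; ring.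
  rewrite [LHS]mxE E pdM pdOm raddfD pdM.
  rewrite (eq_bigr (fun c => Om * (G a b c * U c * f + G a b c * pd c f))); last first.
    by move=> c _; rewrite E; ring.
  rewrite -mulr_sumr big_split/= -mulr_suml !mxE -/G.
  have -> : \sum_c conn h hi a b c * U c = \sum_c G a b c * U c by [].
  ring.
rewrite !(contrD, contrZ) contr_outer contr_outer contr_outerr -/(wg f) -/L -/UU.
by congr (_ * _); ring.
Qed.

Lemma dgrad_rescaled f : dgrad hi' (Om * f) (Om * f) =
  dgrad hi f f + 2 * f * wg f + f ^+ 2 * UU.
Proof.
have E (X : 'M[A]_d) u v : dgrad X u v = contr X (\matrix_(a, b) (pd a u * pd b v)).
  by apply: eq_bigr => a _; apply: eq_bigr => b _; rewrite mxE mulrA.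
rewrite !E contr_hi'.
have -> : \matrix_(a, b) (pd a (Om * f) * pd b (Om * f)) = Om ^+ 2 *:
   (\matrix_(a, b) (pd a f * pd b f) + f *: (\matrix_(a, b) (U a * pd b f)
   + \matrix_(a, b) (pd a f * U b)) + (f ^+ 2) *: \matrix_(a, b) (U a * U b)).
  by apply/matrixP => a b; rewrite !mxE !pdM !pdOm; ring.
rewrite !(contrD, contrZ) !contr_outer contr_outerr -/(wg f) -/UU.
by rewrite mulrA -exprMn [Oi * Om]mulrC OmK; ring.
Qed.

Lemma disq_conformal f : (1 < d)%N -> disq h' hi' (Om * f) = disq h hi f.
Proof.
move=> d1; rewrite /disq dgrad_rescaled conformal_lap lap_rescaled.
have -> : wg (Om * f) = Om * (UU * f + wg f).
  rewrite mulr_suml -big_split mulr_sumr; apply: eq_bigr => c _.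
  by rewrite pdM pdOm /=; ring.
rewrite /djtrace conformal_scal.
have d0 : (d%:R : R) != 0 by rewrite pnatr_eq0 -lt0n ltnW.
have dm : (d.-1%:R : R) != 0 by rewrite pnatr_eq0 -lt0n -ltnS prednK// ltnW.
have dE : (d%:R : A) = d.-1%:R + 1.
  by rewrite -(natrD _ _ 1) addn1 prednK// ltnW.
set c1 := dcst A (2 / d%:R); set c2 := dcst A (2 * d.-1%:R)^-1.
have c1E : c1 * d%:R = 2.
  by rewrite -dcst_nat -rmorphM mulfVK// dcst_nat.
have c2E : c2 * (2 * d.-1%:R) = 1.
  have e0 : 2 * d.-1%:R != 0 :> R by rewrite mulf_neq0// pnatr_eq0.
  by rewrite -[RHS](dcstVK (A := A) e0) [in RHS]rmorphM !dcst_nat.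
have OmK2 : Om ^+ 2 * Oi ^+ 2 = 1 by rewrite -exprMn OmK expr1n.
set S := dscal h hi; set D := dlap h hi f; set E := dgrad hi f f.
rewrite dE in c1E *; move: c1E c2E; set e := (d.-1%:R : A) => c1E c2E.
(* The term in [L] carries the factor 1 - 2 (d - 1) [c2] = 0: the scalar curvature in I^2 absorbs
   the second derivatives of Om. What remains cancels the change of the gradient term. *)
have -> : c1 * (Om * f) * (Oi ^+ 2 * (Om * (D + 2 * wg f + f * (L + UU))
      + (e + 1 - 2) * (Om * (UU * f + wg f)))
    + c2 * (Oi ^+ 2 * (S - 2 * (e + 1 - 1) * L - (e + 1 - 1) * (e + 1 - 2) * UU))
      * (Om * f)) =
  Om ^+ 2 * Oi ^+ 2 * (c1 * f * (D + c2 * S * f) + c1 * (e + 1) * f * wg f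
   + c1 * f ^+ 2 * L * (1 - c2 * (2 * e))
   + f ^+ 2 * UU * (c1 * (e - c2 * e * (e - 1)))) by ring.
have -> : c1 * (e - c2 * e * (e - 1)) = 1.
  have -> : c1 * (e - c2 * e * (e - 1)) =
     c1 * e * (1 - c2 * (2 * e)) + c1 * (e + 1) * c2 * e by ring.
  by rewrite c2E c1E -[RHS]c2E; ring.
by rewrite OmK2 c2E c1E; ring.
Qed.

End Conformal.

(** * Order of vanishing along a hypersurface *)

Section Gradient.
Context {R : numFieldType} {d : nat} {A : diffalg R d} (hi : 'M[A]_d).
Implicit Types (u v x : A).

Lemma dgradDr u v x : dgrad hi u (v + x) = dgrad hi u v + dgrad hi u x.
Proof.
rewrite -big_split; apply: eq_bigr => a _; rewrite -big_split.
by apply: eq_bigr => b _; rewrite raddfD mulrDr.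
Qed.

Lemma dgradDl u v x : dgrad hi (u + v) x = dgrad hi u x + dgrad hi v x.
Proof.
rewrite -big_split; apply: eq_bigr => a _; rewrite -big_split.
by apply: eq_bigr => b _; rewrite raddfD mulrDr mulrDl.
Qed.

Lemma dgradMr u x v : dgrad hi u (x * v) = x * dgrad hi u v + v * dgrad hi u x.
Proof.
rewrite !mulr_sumr -big_split; apply: eq_bigr => a _.
rewrite !mulr_sumr -big_split.
by apply: eq_bigr => b _; rewrite pdM /=; ring.
Qed.

Lemma dgrad_cst u r : dgrad hi u (dcst A r) = 0.
Proof. by rewrite /dgrad big1// => a _; rewrite big1// => b _; rewrite pd_cst mulr0. Qed.

Lemma dgradZr u r v : dgrad hi u (dcst A r * v) = dcst A r * dgrad hi u v.
Proof. by rewrite dgradMr dgrad_cst mulr0 addr0. Qed.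

Lemma dgradNr u v : dgrad hi u (- v) = - dgrad hi u v.
Proof.
by rewrite -mulN1r -(rmorphN1 (dcst A)) dgradZr rmorphN1 mulN1r.
Qed.

Lemma dgradC u v : hi^T = hi -> dgrad hi u v = dgrad hi v u.
Proof.
move=> hs; rewrite /dgrad exchange_big; apply: eq_bigr => a _.
by apply: eq_bigr => b _; rewrite -[hi in LHS]hs mxE; ring.
Qed.

End Gradient.

Section Vanishing.
Context {R : numFieldType} {d : nat} {A : diffalg R d}.
Variable (I : A -> Prop).
Hypothesis I0 : I 0.
Hypothesis ID : forall x y, I x -> I y -> I (x + y).
Hypothesis IM : forall x y, I y -> I (x * y).
Implicit Types (a b c : 'I_d) (f u v w x y : A) (k : nat).

(** Plays the role of the k-th power of the ideal of the hypersurface; order 1 is membership in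
    [I]. *)
Fixpoint vanish k f : Prop :=
  if k is k'.+1 then I f /\ forall a, vanish k' (pd a f) else True.
Local Notation J := vanish.

Lemma vanish0 k : J k 0.
Proof. by elim: k => // k IH; split=> // a; rewrite raddf0. Qed.

Lemma vanishD k x y : J k x -> J k y -> J k (x + y).
Proof.
elim: k x y => // k IH x y [x0 xk] [y0 yk]; split; first exact: ID.
by move=> a; rewrite raddfD; apply: IH; [exact: xk|exact: yk].
Qed.

Lemma vanishS k x : J k.+1 x -> J k x.
Proof.
elim: k x => // k IH x [x0 xk]; split=> // a; exact: IH.
Qed.

Lemma vanish_le k k' x : (k' <= k)%N -> J k x -> J k' x.
Proof.
elim: k => [|k IH]; first by rewrite leqn0 => /eqP ->.
by rewrite leq_eqVlt => /predU1P[->//|]; rewrite ltnS => kk /vanishS; exact: IH.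
Qed.

Lemma vanishMl k x y : J k y -> J k (x * y).
Proof.
elim: k x y => // k IH x y yk; split; first by apply: IM; case: yk.
move=> a; rewrite pdM; apply: vanishD; apply: IH; first exact: vanishS.
by case: yk => _; apply.
Qed.

Lemma vanishMr k x y : J k y -> J k (y * x).
Proof. by rewrite mulrC; exact: vanishMl. Qed.

Lemma vanishN k x : J k x -> J k (- x).
Proof. by rewrite -mulN1r; exact: vanishMl. Qed.

Lemma vanishB k x y : J k x -> J k y -> J k (x - y).
Proof. by move=> xk yk; apply: vanishD => //; exact: vanishN. Qed.

Lemma vanishM j k x y : J j x -> J k y -> J (j + k) (x * y).
Proof.
have [n] := ubnP (j + k)%N; elim: n j k x y => // n IH [|j] [|k] x y.
- by [].
- by move=> _ _ yk; exact: vanishMl.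
- by rewrite addn0 => _ xk _; exact: vanishMr.
move=> jkn xj yk; rewrite addSn; split.
  by apply: IM; case: yk.
move=> a; rewrite pdM; apply: vanishD.
  apply: IH => //.
  by case: xj => _; apply.
rewrite addnS -addSn; apply: IH => //; first by lia.
by case: yk => _; apply.
Qed.

Lemma vanishX k x : J 1 x -> J k (x ^+ k).
Proof.
move=> x1; elim: k => // k IH; rewrite exprS -add1n; exact: vanishM.
Qed.

Lemma vanish_sum k (T : finType) (F : T -> A) :
  (forall i, J k (F i)) -> J k (\sum_i F i).
Proof.
by move=> Fk; elim/big_ind: _ => //; [exact: vanish0 | exact: vanishD].
Qed.

Lemma vanish_natK k n x : (0 < n)%N -> J k (n%:R * x) -> J k x.
Proof.
move=> n0 /(vanishMl (dcst A n%:R^-1)).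
by rewrite mulrA -dcst_nat dcstVK ?mul1r// pnatr_eq0 -lt0n.
Qed.

Lemma vanish_cstK k r x : r != 0 -> J k (dcst A r * x) -> J k x.
Proof.
by move=> r0 /(vanishMl (dcst A r^-1)); rewrite mulrA dcstVK ?mul1r.
Qed.

Lemma vanish_pd k a x : J k.+1 x -> J k (pd a x).
Proof. by case=> _; apply. Qed.

Lemma vanish1 x : J 1 x <-> I x.
Proof. by split=> [[]|]. Qed.

Variables (h hi : 'M[A]_d).
Hypothesis hmp : metric_pair h hi.
Local Notation G := (dgrad hi).

Let hiT : hi^T = hi. Proof. exact: pair_trV hmp. Qed.

Lemma vanish_dgrad j k x y : J j.+1 x -> J k.+1 y -> J (j + k) (G x y).
Proof.
move=> xj yk; apply: vanish_sum => a; apply: vanish_sum => b.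
by rewrite -mulrA; apply: vanishMl; apply: vanishM; apply: vanish_pd.
Qed.

Lemma vanish_dgradr k x y : J k.+1 y -> J k (G x y).
Proof.
move=> yk; apply: vanish_sum => a; apply: vanish_sum => b.
by apply: vanishMl; apply: vanish_pd.
Qed.

Lemma vanish_dgradl k x y : J k.+1 x -> J k (G x y).
Proof. by rewrite dgradC//; exact: vanish_dgradr. Qed.

(** Second derivatives of [f] commute and drop out of the commutator, so one order is lost instead
    of two. *)
Lemma vanish_dgrad_comm k b u f : J k.+1 f -> J k (pd b (G u f) - G u (pd b f)).
Proof.
move=> fk.
have -> : pd b (G u f) - G u (pd b f) =
    \sum_c \sum_e (pd b (hi c e * pd c u) * pd e f).
  rewrite raddf_sum -sumrB; apply: eq_bigr => c _.
  rewrite raddf_sum -sumrB; apply: eq_bigr => e _.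
  by rewrite /= [pd b (_ * pd e f)]pdM (pdC b e f) addrK.
by apply: vanish_sum => c; apply: vanish_sum => e; apply: vanishMl; apply: vanish_pd.
Qed.

(* [tangential u] says that every f vanishing on the hypersurface has its
   differential proportional to that of u there. *)
Definition tangential u := forall f a b, I f -> I (pd a f * pd b u - pd b f * pd a u).

(** Unit length of du is imposed on the hypersurface only, so [u] is a signed distance to first
    order. *)
Definition normalized u := [/\ I u, I (G u u - 1) & tangential u].

(* The vector fields [pd a - pd a u * G u] are tangent to the hypersurface, hence
   do not lower the order of vanishing. *)
Lemma vanish_tangent k u f a :
  normalized u -> J k f -> J k (pd a f - pd a u * G u f).
Proof.
move=> [u0 Guu tan]; elim: k f => // k IH f fk; split.
  have f0 : I f by case: fk.
  (* Modulo [I] one may insert [G u u] for 1, and [pd a f * G u u - pd a u * G u f] is a combination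
     of the minors that [tangential] puts into [I]. *)
  have -> : pd a f - pd a u * G u f =
     \sum_b \sum_c (hi b c * pd b u) * (pd a f * pd c u - pd c f * pd a u)
     + (- pd a f) * (G u u - 1).
    have -> : \sum_b \sum_c (hi b c * pd b u) * (pd a f * pd c u - pd c f * pd a u)
        = pd a f * G u u - pd a u * G u f.
      rewrite !mulr_sumr -sumrB; apply: eq_bigr => b _.
      rewrite !mulr_sumr -sumrB; apply: eq_bigr => c _; ring.
    ring.
  apply: ID; last exact: IM.
  by apply/vanish1; apply: vanish_sum => b; apply: vanish_sum => c;
    apply: vanishMl; apply/vanish1; exact: tan.
move=> b.
(* The derivative has the same shape with [pd b f] in place of [f], up to terms of first order in
   [f], for which the extra order of [f] pays. *)
have -> : pd b (pd a f - pd a u * G u f) =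
  (pd a (pd b f) - pd a u * G u (pd b f)) - pd b (pd a u) * G u f
  - pd a u * (pd b (G u f) - G u (pd b f)).
  by rewrite raddfB pdM /= (pdC b a f); ring.
apply: vanishB; last by apply: vanishMl; exact: vanish_dgrad_comm.
apply: vanishB; last by apply: vanishMl; exact: vanish_dgradr.
by apply: IH; exact: vanish_pd.
Qed.

(** Euler's identity for a function that behaves like u^k. For the induction, differentiating the
    case k + 1 gives the case k for [pd a v], plus [u] times a commutator, minus a tangent
    derivative of [v], which keeps its order. *)
Lemma vanish_euler k u v : normalized u -> J k v ->
  J k.+1 (u * G u v - k%:R * v).
Proof.
move=> un; have [u0 _ _] := un; elim: k v => [|k IH] v vk.
  by rewrite mul0r subr0; apply: vanishMr; apply/vanish1.
split.
  apply: ID; first by rewrite mulrC; exact: IM.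
  by rewrite -mulNr; apply: IM; case: vk.
move=> a.
have -> : pd a (u * G u v - k.+1%:R * v) =
   (u * G u (pd a v) - k%:R * pd a v) + u * (pd a (G u v) - G u (pd a v))
   - (pd a v - pd a u * G u v).
  by rewrite raddfB !pdM pd_nat /= -natr1; ring.
apply: vanishB; last exact: vanish_tangent.
apply: vanishD; first by apply: IH; exact: vanish_pd.
by rewrite -add1n; apply: vanishM; [apply/vanish1|exact: vanish_dgrad_comm].
Qed.

(** Division by [u] without quotients: once [v] has order k, Euler's identity turns [G u (u * v)]
    into (k + 1) [v] up to order k + 1, and k + 1 is invertible. *)
Lemma vanish_cancel k u v : normalized u -> J k.+1 (u * v) -> J k v.
Proof.
move=> un; have [u0 Guu _] := un; elim: k => // k IH uvk.
have vk : J k v by apply: IH; exact: vanishS.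
have := vanish_dgradr u uvk.
have -> : G u (u * v) = k.+1%:R * v + (u * G u v - k%:R * v) + (G u u - 1) * v.
  by rewrite dgradMr -natr1; ring.
move=> H; apply: (@vanish_natK _ k.+1) => //.
have -> : k.+1%:R * v = (k.+1%:R * v + (u * G u v - k%:R * v) + (G u u - 1) * v)
   - (u * G u v - k%:R * v) - (G u u - 1) * v by ring.
apply: vanishB; last by rewrite -add1n; apply: vanishM => //; apply/vanish1.
by apply: vanishB => //; exact: vanish_euler.
Qed.

Lemma vanish_cancelX j k u v : normalized u -> J (j + k) (u ^+ j * v) -> J k v.
Proof.
move=> un; elim: j k => [|j IH] k; first by rewrite mul1r.
by rewrite exprS -mulrA => /(vanish_cancel un) /IH.
Qed.

(** Euler's identity, applied at the successive orders k, k - 1, ..., 1, contributes the factors of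
    k!. *)
Lemma vanish_taylor k u f : normalized u -> J k f ->
  J k.+1 (u ^+ k * iter k (G u) f - k`!%:R * f).
Proof.
move=> un; have [u0 _ _] := un; elim: k f => [|k IH] f fk.
  by rewrite [iter 0 _ _]/= fact0 expr0 !mul1r subrr; exact: vanish0.
have -> : u ^+ k.+1 * iter k.+1 (G u) f - (k.+1)`!%:R * f =
  u * (u ^+ k * iter k (G u) (G u f) - k`!%:R * G u f)
  + k`!%:R * (u * G u f - k.+1%:R * f).
  by rewrite -iterSr /= exprS factS natrM; ring.
apply: vanishD; last by apply: vanishMl; exact: vanish_euler.
rewrite -[k.+2]add1n; apply: vanishM; first exact/vanish1.
by apply: IH; exact: vanish_dgradr.
Qed.

Local Notation Isq := (disq h hi).

(** Second derivatives alone would cost two orders. Each [pd b w] differs from its normal part by a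
    tangent derivative, which costs none, and the Christoffel term is of first order, so the
    difference loses only one. *)
Lemma vanish_lap k u w : normalized u -> J k.+1 w ->
  J k (dlap h hi w - G u (G u w)).
Proof.
move=> un wk; rewrite [G u (G u w)]dgradC// /dlap /contr -sumrB.
apply: vanish_sum => a; rewrite -sumrB; apply: vanish_sum => b; rewrite mxE.
rewrite -mulrA -mulrBr; apply: vanishMl.
set S := \sum_c _.
have -> : pd a (pd b w) - S - pd a (G u w) * pd b u =
  pd a (pd b w - pd b u * G u w) + pd a (pd b u) * G u w - S.
  by rewrite raddfB pdM /=; ring.
apply: vanishB; last by apply: vanish_sum => c; apply: vanishMl; exact: vanish_pd.
apply: vanishD; last by apply: vanishMl; exact: vanish_dgradr.
by apply: vanish_pd; exact: vanish_tangent.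
Qed.

Lemma dlapD u w : dlap h hi (u + w) = dlap h hi u + dlap h hi w.
Proof.
rewrite -big_split; apply: eq_bigr => a _; rewrite -big_split.
apply: eq_bigr => b _; rewrite !mxE !raddfD /= -mulrDr; congr (_ * _).
rewrite addrACA -opprD -big_split /=; congr (_ - _).
by apply: eq_bigr => c _; rewrite raddfD mulrDr.
Qed.

(** Beside the leading terms there are only multiples of [w] and [G w w], whose order 2k is at least
    k + 1 for positive k. *)
Lemma vanish_variation k u w : (0 < k)%N -> normalized u -> J k.+1 w ->
  J k.+1 (Isq (u + w) - Isq u - dcst A (2 - 2 * k%:R / d%:R) * G u w).
Proof.
move=> k0 un wk; have [u0 _ _] := un.
set q := dcst A (2 / d%:R).
have -> : dcst A (2 - 2 * k%:R / d%:R) = 2 - k%:R * q.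
  rewrite /q rmorphB dcst_nat -[k%:R in RHS](dcst_nat (A := A)) -rmorphM.
  by rewrite mulrA [k%:R * 2]mulrC.
have -> : Isq (u + w) - Isq u - (2 - k%:R * q) * G u w =
  G w w - q * (u * (dlap h hi w - G u (G u w)) + (u * G u (G u w) - k%:R * G u w)
   + (dlap h hi u + dlap h hi w + djtrace h hi * (2 * u + w)) * w).
  rewrite /disq !dgradDl !dgradDr (dgradC w u hiT) dlapD -/q; ring.
apply: vanishB.
  apply: (@vanish_le (k + k)); first by lia.
  exact: vanish_dgrad.
apply: vanishMl; apply: vanishD; last exact: vanishMl.
apply: vanishD; last by apply: vanish_euler => //; exact: vanish_dgradr.
by rewrite -add1n; apply: vanishM; [exact/vanish1|exact: vanish_lap].
Qed.

(** Tangent derivatives keep the order, so the normal derivative decides whether it rises. *)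
Lemma vanish_gradient k u w : normalized u -> I w -> J k (G u w) -> J k w ->
  J k.+1 w.
Proof.
move=> un w0 Gk wk; split=> // a.
have -> : pd a w = (pd a w - pd a u * G u w) + pd a u * G u w by ring.
by apply: vanishD; [exact: vanish_tangent|exact: vanishMl].
Qed.

(** The condition on [w] fixes the orientation: it gives both solutions the same differential on the
    hypersurface and so rules out a comparison with -u, which has the same I^2 as [u]. *)
Lemma obstruction_unique u w B B' : (1 < d)%N -> normalized u -> J 2 w ->
  J d.+1 (Isq u - 1 - u ^+ d * B) ->
  J d.+1 (Isq (u + w) - 1 - (u + w) ^+ d * B') -> I (B - B').
Proof.
move=> d1 un w2 HB HB'; have [u0 _ _] := un; have w0 : I w by case: w2.
have ud x : I x -> J d (x ^+ d) by move=> /vanish1; exact: vanishX.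
have Id : J d (Isq (u + w) - Isq u).
  have -> : Isq (u + w) - Isq u = (Isq (u + w) - 1 - (u + w) ^+ d * B')
   - (Isq u - 1 - u ^+ d * B) + ((u + w) ^+ d * B' - u ^+ d * B) by ring.
  apply: vanishD; apply: vanishB; [exact: vanishS|exact: vanishS| |];
    by apply: vanishMr; apply: ud => //; exact: ID.
(* The order of [w] climbs from 2 to d + 1. Below order d + 1 the coefficient in [vanish_variation]
   is nonzero, so equality of the two I^2 up to order d forces up the order of [G u w]. *)
have wd : J d.+1 w.
  suff H k : (0 < k <= d)%N -> J k.+1 w by apply: H; lia.
  elim: k => // -[//|k] IH kd; have wk : J k.+2 w by apply: IH; lia.
  apply: (vanish_gradient un) => //.
  have r0 : 2 - 2 * k.+1%:R / d%:R != 0 :> R.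
    have d0 : d%:R != 0 :> R by rewrite pnatr_eq0; lia.
    rewrite -[X in X - _](mulfK d0) -mulrBl mulf_neq0// ?invr_neq0//.
    rewrite -mulrBr mulf_neq0 ?pnatr_eq0// subr_eq0 eqr_nat; lia.
  apply: (vanish_cstK r0).
  have := vanish_variation (ltn0Sn k) un wk.
  set X := dcst _ _ * _ => HX; have -> : X = (Isq (u + w) - Isq u)
    - (Isq (u + w) - Isq u - X) by ring.
  by apply: vanishB => //; apply: (vanish_le _ Id); lia.
(* At k = d the coefficient is zero: the freedom left in [w] is invisible in I^2 at this order. *)
have Id1 : J d.+1 (Isq (u + w) - Isq u).
  have := vanish_variation (ltnW d1) un wd.
  by rewrite mulfK ?pnatr_eq0 ?subrr ?rmorph0 ?mul0r ?subr0//; lia.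
apply/vanish1; apply: (@vanish_cancelX d 1 u) => //; rewrite addn1.
have -> : u ^+ d * (B - B') = (Isq (u + w) - 1 - (u + w) ^+ d * B')
   - (Isq u - 1 - u ^+ d * B) - (Isq (u + w) - Isq u)
   + ((u + w) ^+ d - u ^+ d) * B' by ring.
apply: vanishD; last first.
  by apply: vanishMr; rewrite subrXX addrAC subrr add0r; exact: vanishMr.
by apply: vanishB => //; exact: vanishB.
Qed.

End Vanishing.

(** * The obstruction as a universal expression in jets *)

(** The two inverses are elements subject to equations. The construction thus stays polynomial, and
    no square root has to exist in the ring. *)
Record jetdata (R : numFieldType) (d : nat) := JetData {
  jalg :> diffalg R d;
  jh : 'M[jalg]_d;
  js : jalg;
  jw : jalg;
  jn : jalg;
  jh_sym : jh^T = jh;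
  jw_det : jw * \det jh = 1;
  jn_norm : jn ^+ 2 * dgrad (jw *: \adj jh) js js = 1
}.

Section Obstruction.
Context {R : numFieldType} {d : nat} (S : jetdata R d).

Definition jhi : 'M[S]_d := jw S *: \adj (jh S).

Lemma jet_metric_pair : metric_pair (jh S) jhi.
Proof.
split; first exact: jh_sym.
- by rewrite -scalemxAr mul_mx_adj scale_scalar_mx jw_det.
- by rewrite -scalemxAl mul_adj_mx scale_scalar_mx jw_det.
Qed.

Local Notation G := (dgrad jhi).
Local Notation Isq := (disq (jh S) jhi).

(* The constant solves 1 + 2 (1 - k/d) (k+1) c = 0; the factor 1/k! is there
   because u^k G^k f = k! f to leading order, see [vanish_taylor]. *)
Definition normalize_step k (u : S) : S :=
  u + dcst S (- d%:R / (2 * k.+1%:R * (d - k)%:R) / k`!%:R) *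
      (u ^+ k.+1 * iter k (G u) (Isq u - 1)).

Fixpoint approx m : S :=
  if m is m'.+1 then normalize_step m (approx m') else js S * jn S.

Definition jet_obstruction : S :=
  dcst S (d`!%:R)^-1 * iter d (G (approx d.-1)) (Isq (approx d.-1) - 1).

Variable (I : S -> Prop).
Hypothesis I0 : I 0.
Hypothesis ID : forall x y, I x -> I y -> I (x + y).
Hypothesis IM : forall x y, I y -> I (x * y).
Local Notation J := (vanish I).
Let hmp := jet_metric_pair.
Let hiT := pair_trV hmp.

Lemma normalized_perturb (u w : S) : normalized I jhi u -> J 2 w ->
  normalized I jhi (u + w).
Proof.
move=> [u0 Guu tan] w2; have w0 : I w by case: w2.
have dw a : I (pd a w) by apply/(@vanish1 _ _ _ I); case: w2 => _; apply.
split; first exact: ID.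
  have -> : G (u + w) (u + w) - 1 = (G u u - 1) + (G u w + G w (u + w)).
    by rewrite !dgradDl !dgradDr; ring.
  apply: ID => //; apply/(@vanish1 _ _ _ I); apply: vanishD => //.
    exact: vanish_dgradr.
  exact: (vanish_dgradl I0 ID IM hmp).
move=> f a b f0; rewrite !raddfD /=.
have -> : pd a f * (pd b u + pd b w) - pd b f * (pd a u + pd a w) =
  (pd a f * pd b u - pd b f * pd a u) + pd a f * pd b w + (- pd b f) * pd a w.
  by ring.
by apply: ID; [apply: ID|]; [exact: tan|exact: IM|exact: IM].
Qed.

Lemma normalize_stepP k (u : S) : (0 < k < d)%N -> normalized I jhi u ->
  J k (Isq u - 1) ->
  [/\ normalized I jhi (normalize_step k u), J 2 (normalize_step k u - u)
    & J k.+1 (Isq (normalize_step k u) - 1)].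
Proof.
move=> kd un Fk; have [u0 _ _] := un.
rewrite /normalize_step; set c := dcst S _; set w := c * _; set F := Isq u - 1.
pose c' := dcst S (- d%:R / (2 * k.+1%:R * (d - k)%:R)).
have cE : c * k`!%:R = c'.
  by rewrite -dcst_nat -rmorphM mulfVK// pnatr_eq0 -lt0n fact_gt0.
have uF : J k.+1 (u * F) by rewrite -add1n; apply: vanishM => //; apply/vanish1.
(* By [vanish_taylor], u^(k+1) G^k F may be read as k! u F up to order k + 2. *)
have wk : J k.+2 (w - c' * (u * F)).
  have -> : w - c' * (u * F) = c * (u * (u ^+ k * iter k (G u) F - k`!%:R * F)).
    by rewrite -cE /w exprS -/F; ring.
  apply: vanishMl => //; rewrite -[k.+2]add1n; apply: vanishM => //.
  exact: (vanish_taylor I0 ID IM).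
have wk1 : J k.+1 w.
  have -> : w = (w - c' * (u * F)) + c' * (u * F) by ring.
  by apply: vanishD => //; [exact: vanishS|exact: vanishMl].
have w2 : J 2 w by apply: (vanish_le _ wk1); lia.
split; first exact: normalized_perturb.
  by rewrite addrAC subrr add0r.
have k0 : (0 < k)%N by lia.
have := vanish_variation I0 ID IM hmp k0 un wk1.
set q := dcst S _ => V.
(* To leading order [G u (u * F)] is k F + F, the first part by Euler's identity and the second
   because [G u u] is 1. The old error is thus multiplied by 1 + q c' (k + 1), which the choice of
   c' makes zero. *)
have -> : Isq (u + w) - 1 = (Isq (u + w) - Isq u - q * G u w)
   + q * (G u (w - c' * (u * F)))
   + q * c' * ((u * G u F - k%:R * F) + (G u u - 1) * F)
   + (1 + q * c' * k.+1%:R) * F.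
  have -> : G u (w - c' * (u * F)) = G u w - c' * (u * G u F + F * G u u).
    by rewrite dgradDr dgradNr [G u (c' * _)]dgradZr [G u (u * F)]dgradMr.
  rewrite -natr1 /F; ring.
have -> : 1 + q * c' * k.+1%:R = 0.
  have d0 : d%:R != 0 :> R by rewrite pnatr_eq0; lia.
  have k1 : 1 + k%:R != 0 :> R by rewrite nat1r pnatr_eq0.
  have E : (d - k)%:R = d%:R - k%:R :> R by rewrite natrB//; lia.
  have dk0 : d%:R - k%:R != 0 :> R by rewrite -E pnatr_eq0; lia.
  rewrite -(dcst_nat k.+1) -(rmorph1 (dcst S)) /q /c'.
  rewrite -[dcst S _ * dcst S _]rmorphM -[dcst S _ * dcst S _]rmorphM -rmorphD.
  rewrite [X in dcst S X](_ : _ = 0) ?rmorph0// E -nat1r.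
  by field; rewrite k1 dk0 d0.
rewrite mul0r addr0; apply: vanishD => //.
  apply: vanishD => //; apply: vanishMl => //; exact: vanish_dgradr.
apply: vanishMl => //; apply: vanishD => //.
  exact: (vanish_euler I0 ID IM).
rewrite -add1n; apply: vanishM => //; apply/vanish1; by case: un.
Qed.

Hypothesis Is : I (js S).
Hypothesis tan : tangential I (js S).

Lemma approxP m : (m < d)%N -> [/\ normalized I jhi (approx m),
  J 2 (approx m - js S * jn S) & J m.+1 (Isq (approx m) - 1)].
Proof.
elim: m => [|m IH] md; first change (approx 0) with (js S * jn S).
  have s1 : I (js S * jn S) by rewrite mulrC; exact: IM.
  have Gss : I (G (js S * jn S) (js S * jn S) - 1).
    rewrite dgradMr (dgradC (_ * _) (jn S) hiT) (dgradC (_ * _) (js S) hiT).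
    rewrite !dgradMr; have <- := jn_norm S; rewrite -/jhi.
    set X := G (js S) (js S); set Y := G (jn S) (js S).
    set Z := G (jn S) (jn S); set W := G (js S) (jn S).
    have -> : js S * (js S * Z + jn S * Y) + jn S * (js S * W + jn S * X)
      - jn S ^+ 2 * X = (js S * Z + jn S * Y + jn S * W) * js S by ring.
    exact: IM.
  split; first split=> //.
  - move=> f a b f0; rewrite !pdM.
    have -> : pd a f * (pd b (js S) * jn S + js S * pd b (jn S)) -
       pd b f * (pd a (js S) * jn S + js S * pd a (jn S)) =
       jn S * (pd a f * pd b (js S) - pd b f * pd a (js S))
       + (pd a f * pd b (jn S) - pd b f * pd a (jn S)) * js S by ring.
    by apply: ID; apply: IM => //; exact: tan.
  - by rewrite subrr; exact: vanish0.
  (* Apart from the gradient term, every term of I^2 contains the factor s, so the initial error has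
     order 1. *)
  - apply/vanish1; rewrite /disq.
    set X := dlap _ _ _ + _; set Y := G _ _; set Z := dcst S _.
    have -> : Y - Z * (js S * jn S) * X - 1 = (Y - 1) + (- (Z * X)) * (js S * jn S).
      by ring.
    by apply: ID => //; exact: IM.
have [un s2 Fm] := IH (ltnW md).
change (approx m.+1) with (normalize_step m.+1 (approx m)).
have md' : (0 < m.+1 < d)%N by lia.
have [un' s2' Fm'] := normalize_stepP md' un Fm.
split=> //; rewrite -(subrK (approx m) (normalize_step _ _)) -addrA.
exact: vanishD.
Qed.

Lemma jet_obstructionP : (1 < d)%N -> [/\ normalized I jhi (approx d.-1),
  J 2 (approx d.-1 - js S * jn S)
  & J d.+1 (Isq (approx d.-1) - 1 - approx d.-1 ^+ d * jet_obstruction)].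
Proof.
move=> d1; have [|un s2] := @approxP d.-1; first by lia.
rewrite prednK; last by lia.
move=> Fd; split=> //; rewrite /jet_obstruction.
set u := approx _; set F := Isq u - 1.
have d0 : d`!%:R != 0 :> R by rewrite pnatr_eq0 -lt0n fact_gt0.
apply: (vanish_cstK ID IM d0).
have -> : dcst S d`!%:R * (F - u ^+ d * (dcst S d`!%:R^-1 * iter d (G u) F)) =
   - (u ^+ d * iter d (G u) F - d`!%:R * F)
   + (1 - dcst S d`!%:R^-1 * dcst S d`!%:R) * (u ^+ d * iter d (G u) F).
  by rewrite dcst_nat; ring.
rewrite dcstVK// subrr mul0r addr0; apply: vanishN => //.
exact: (vanish_taylor I0 ID IM).
Qed.

End Obstruction.

(** * Naturality of the construction *)

Section Naturality.
Context {R : numFieldType} {d : nat} (S T : jetdata R d).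
Variables (phi : {rmorphism T -> S}) (J K : 'M[S]_d).
Hypothesis phi_cst : forall r, phi (dcst T r) = dcst S r.
Hypothesis phi_pd : forall a f, pd a (phi f) = \sum_b J a b * phi (pd b f).
Hypothesis J_closed : forall a b c, pd a (J b c) = pd b (J a c).
Hypotheses (JK : J *m K = 1%:M) (KJ : K *m J = 1%:M).
Hypothesis h_pull : jh S = J *m map_mx phi (jh T) *m J^T.
Hypothesis s_pull : js S = phi (js T).
Hypothesis n_pull : jn S = phi (jn T).

Let smp := jet_metric_pair S.
Let tmp := jet_metric_pair T.

Lemma iter_dgrad_pull k u f :
  iter k (dgrad (jhi S) (phi u)) (phi f) = phi (iter k (dgrad (jhi T) u) f).
Proof.
elim: k => //= k ->.
by rewrite (dgrad_pull phi_pd KJ smp tmp h_pull).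
Qed.

Lemma disqB1_pull u :
  disq (jh S) (jhi S) (phi u) - 1 = phi (disq (jh T) (jhi T) u - 1).
Proof.
rewrite (disq_pull phi_cst phi_pd J_closed JK KJ smp tmp h_pull).
by rewrite [RHS]rmorphB /= rmorph1.
Qed.

(** An exact equality rather than one modulo the hypersurface, since [natural] compares values at
    all points. *)
Lemma approx_pull m : approx S m = phi (approx T m).
Proof.
elim: m => [|m IH] /=; first by rewrite s_pull n_pull rmorphM.
rewrite IH /normalize_step disqB1_pull iter_dgrad_pull -phi_cst.
by rewrite -rmorphXn -!rmorphM -rmorphD.
Qed.

Lemma jet_obstruction_pull : jet_obstruction S = phi (jet_obstruction T).
Proof.
rewrite /jet_obstruction approx_pull disqB1_pull iter_dgrad_pull -phi_cst.
by rewrite [RHS]rmorphM.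
Qed.

End Naturality.

(** * One formal expression for all jet data *)

Section Uniform.
Context {R : numFieldType} {d : nat}.
Implicit Types (a b : 'I_d) (l : seq 'I_d).

Inductive jexpr :=
| JConst (r : R) | JMetric a b l | JInvDet | JFun l | JInvNorm
| JAdd (e1 e2 : jexpr) | JMul (e1 e2 : jexpr).

Definition pds (S : jetdata R d) l (x : S) : S := foldr (fun a => pd a) x l.

Fixpoint jeval (S : jetdata R d) e : S :=
  match e with
  | JConst r => dcst S r
  | JMetric a b l => pds l (jh S a b)
  | JInvDet => jw S
  | JFun l => pds l (js S)
  | JInvNorm => jn S
  | JAdd e1 e2 => jeval S e1 + jeval S e2
  | JMul e1 e2 => jeval S e1 * jeval S e2
  end.

Implicit Types F : forall S : jetdata R d, S.

Definition uniform0 F := exists e, forall S, F S = jeval S e.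
(** One derivative is built in so that the Leibniz rule carries the predicate through products;
    [uniform_pd] then supplies all higher derivatives. *)
Definition uniform1 F := uniform0 F /\ forall a, uniform0 (fun S => pd a (F S)).

Lemma uniform1_ext F F' : (forall S, F S = F' S) -> uniform1 F -> uniform1 F'.
Proof.
move=> E [[e He] H]; split; first by exists e => S; rewrite -E.
by move=> a; have [e' He'] := H a; exists e' => S; rewrite -E.
Qed.

Lemma uniform0D F F' : uniform0 F -> uniform0 F' -> uniform0 (fun S => F S + F' S).
Proof. by move=> [e He] [e' He']; exists (JAdd e e') => S; rewrite He He'. Qed.

Lemma uniform0M F F' : uniform0 F -> uniform0 F' -> uniform0 (fun S => F S * F' S).
Proof. by move=> [e He] [e' He']; exists (JMul e e') => S; rewrite He He'. Qed.

Lemma uniform1D F F' : uniform1 F -> uniform1 F' -> uniform1 (fun S => F S + F' S).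
Proof.
move=> [F0 F1] [F0' F1']; split; first exact: uniform0D.
move=> a; have [e He] := uniform0D (F1 a) (F1' a).
by exists e => S; rewrite raddfD -He.
Qed.

Lemma uniform1M F F' : uniform1 F -> uniform1 F' -> uniform1 (fun S => F S * F' S).
Proof.
move=> [F0 F1] [F0' F1']; split; first exact: uniform0M.
move=> a; have [e He] := uniform0D (uniform0M (F1 a) F0') (uniform0M F0 (F1' a)).
by exists e => S; rewrite pdM -He.
Qed.

Lemma uniform1_cst r : uniform1 (fun S => dcst S r).
Proof.
split; first by exists (JConst r).
by move=> a; exists (JConst 0) => S /=; rewrite pd_cst rmorph0.
Qed.

Lemma uniform1_nat n : uniform1 (fun S => n%:R).
Proof.
by apply: (@uniform1_ext (fun S => dcst S n%:R)) (uniform1_cst _) => S;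
  rewrite dcst_nat.
Qed.

Lemma uniform1N F : uniform1 F -> uniform1 (fun S => - F S).
Proof.
move=> F1; apply: (@uniform1_ext (fun S => dcst S (-1) * F S)).
  by move=> S; rewrite rmorphN1 mulN1r.
by apply: uniform1M => //; exact: uniform1_cst.
Qed.

Lemma uniform1_sum (I : Type) (r : seq I) (P : pred I)
  (F : I -> forall S : jetdata R d, S) :
  (forall i, uniform1 (F i)) -> uniform1 (fun S => \sum_(i <- r | P i) F i S).
Proof.
move=> FU; elim: r => [|i r IH].
  by apply: (uniform1_ext _ (uniform1_nat 0)) => S; rewrite big_nil.
apply: (@uniform1_ext (fun S => (if P i then F i S else 0%:R) +
   \sum_(i <- r | P i) F i S)).
  by move=> S; rewrite big_cons; case: (P i); rewrite ?add0r.
by apply: uniform1D IH; case: (P i); [exact: FU|exact: uniform1_nat].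
Qed.

Lemma uniform1_prod (I : Type) (r : seq I) (P : pred I)
  (F : I -> forall S : jetdata R d, S) :
  (forall i, uniform1 (F i)) -> uniform1 (fun S => \prod_(i <- r | P i) F i S).
Proof.
move=> FU; elim: r => [|i r IH].
  by apply: (uniform1_ext _ (uniform1_nat 1)) => S; rewrite big_nil.
apply: (@uniform1_ext (fun S => (if P i then F i S else 1%:R) *
   \prod_(i <- r | P i) F i S)).
  by move=> S; rewrite big_cons; case: (P i); rewrite ?mul1r.
by apply: uniform1M IH; case: (P i); [exact: FU|exact: uniform1_nat].
Qed.

Lemma uniform1X F n : uniform1 F -> uniform1 (fun S => F S ^+ n).
Proof.
move=> F1; elim: n => [|n IH]; first exact: (uniform1_nat 1).
apply: (@uniform1_ext (fun S => F S * F S ^+ n)) => [S|]; first by rewrite exprS.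
exact: uniform1M.
Qed.

Lemma uniform1_sign n : uniform1 (fun S => (-1) ^+ n).
Proof. by apply: uniform1X; apply: uniform1N; exact: (uniform1_nat 1). Qed.

Lemma uniform1_det n (M : forall S : jetdata R d, 'M[S]_n) :
  (forall i j, uniform1 (fun S => M S i j)) -> uniform1 (fun S => \det (M S)).
Proof.
move=> MU; apply: uniform1_sum => s; apply: uniform1M.
  exact: uniform1_sign.
by apply: uniform1_prod => i; exact: MU.
Qed.

Lemma uniform1_h a b : uniform1 (fun S => jh S a b).
Proof. by split=> [|c]; [exists (JMetric a b [::])|exists (JMetric a b [:: c])]. Qed.

Lemma uniform1_w : uniform1 (fun S => jw S).
Proof.
split; first by exists JInvDet.
move=> a; have [_ /(_ a) [e He]] := uniform1_det uniform1_h.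
(* Differentiating w det h = 1 gives pd w = - w^2 pd (det h). *)
exists (JMul (JMul (JConst (-1)) (JMul JInvDet JInvDet)) e) => S /=.
have /(congr1 (pd a)) := jw_det S; rewrite pd1 pdM -He => /eqP.
rewrite addr_eq0 => /eqP /(congr1 ( *%R^~ (jw S))).
rewrite -mulrA [\det _ * _]mulrC jw_det mulr1 => ->.
by rewrite rmorphN1; ring.
Qed.

Lemma uniform1_hi a b : uniform1 (fun S => jhi S a b).
Proof.
apply: (@uniform1_ext (fun S => jw S * ((-1) ^+ (b + a) *
   \det (row' b (col' a (jh S)))))) => [S|].
  by rewrite !mxE.
apply: uniform1M; first exact: uniform1_w.
apply: uniform1M.
  exact: uniform1_sign.
apply: uniform1_det => i j.
by apply: (uniform1_ext _ (uniform1_h (lift b i) (lift a j))) => S; rewrite !mxE.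
Qed.

Lemma uniform1_fun l : uniform1 (fun S => pds l (js S)).
Proof. by split=> [|c]; [exists (JFun l)|exists (JFun (c :: l))]. Qed.

Lemma uniform1_n : uniform1 (fun S => jn S).
Proof.
split; first by exists JInvNorm.
move=> a.
have : uniform1 (fun S => dgrad (jhi S) (js S) (js S)).
  apply: uniform1_sum => b; apply: uniform1_sum => c.
  apply: uniform1M; first apply: uniform1M; first exact: uniform1_hi.
    exact: (uniform1_fun [:: b]).
  exact: (uniform1_fun [:: c]).
case=> _ /(_ a) [e He].
(* Differentiating n^2 N = 1 and multiplying by n gives 2 pd n + n^3 pd N = 0. *)
exists (JMul (JMul (JConst (- 2^-1)) (JMul JInvNorm (JMul JInvNorm JInvNorm))) e) => S /=.
rewrite -He.
have := jn_norm S; rewrite -/(jhi S); set N := dgrad _ _ _ => nN.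
have /(congr1 (pd a)) := nN; rewrite pd1 pdM expr2 pdM => E.
have E2 : (pd a (jn S) + pd a (jn S)) + jn S * jn S * jn S * pd a N = 0.
  have -> : (pd a (jn S) + pd a (jn S)) + jn S * jn S * jn S * pd a N =
    jn S * ((pd a (jn S) * jn S + jn S * pd a (jn S)) * N + jn S * jn S * pd a N)
    + (pd a (jn S) + pd a (jn S)) * (1 - jn S ^+ 2 * N) by ring.
  by rewrite E nN subrr !mulr0 addr0.
rewrite -[LHS]dcst_half_double.
move/eqP: E2; rewrite addr_eq0 => /eqP ->.
by rewrite rmorphN; ring.
Qed.

Lemma jeval_uniform1 e : uniform1 (fun S => jeval S e).
Proof.
elim: e => [r|a b l||l||e1 H1 e2 H2|e1 H1 e2 H2] /=.
- exact: uniform1_cst.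
- by split=> [|c]; [exists (JMetric a b l)|exists (JMetric a b (c :: l))].
- exact: uniform1_w.
- exact: uniform1_fun.
- exact: uniform1_n.
- exact: uniform1D.
- exact: uniform1M.
Qed.

(** The derivative is itself a formal expression, and formal expressions are closed under one more
    derivative by [jeval_uniform1]. *)
Lemma uniform_pd F a : uniform1 F -> uniform1 (fun S => pd a (F S)).
Proof.
case=> _ /(_ a) [e He]; apply: uniform1_ext (jeval_uniform1 e) => S.
by rewrite He.
Qed.

Lemma uniform_conn a b c : uniform1 (fun S => conn (jh S) (jhi S) a b c).
Proof.
apply: (@uniform1_ext (fun S => dcst S 2^-1 * \sum_e jhi S c e *
  (pd a (jh S b e) + pd b (jh S a e) - pd e (jh S a b)))) => [S|].
  by rewrite mxE.
apply: uniform1M; first exact: uniform1_cst.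
apply: uniform1_sum => e; apply: uniform1M; first exact: uniform1_hi.
apply: uniform1D; first apply: uniform1D; last apply: uniform1N;
  apply: uniform_pd; exact: uniform1_h.
Qed.

Lemma uniform_contr (M : forall S : jetdata R d, 'M[S]_d) :
  (forall a b, uniform1 (fun S => M S a b)) ->
  uniform1 (fun S => contr (jhi S) (M S)).
Proof.
move=> MU; apply: uniform1_sum => a; apply: uniform1_sum => b.
by apply: uniform1M; [exact: uniform1_hi|exact: MU].
Qed.

Lemma uniform_scal : uniform1 (fun S => dscal (jh S) (jhi S)).
Proof.
pose G (S : jetdata R d) := conn (jh S) (jhi S).
apply: uniform_contr => a b.
apply: (@uniform1_ext (fun S => \sum_c (pd c (G S a b c) - pd a (G S c b c)
    + \sum_e (G S c e c * G S a b e - G S a e c * G S c b e)))) => [S|].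
  by rewrite mxE.
apply: uniform1_sum => c; apply: uniform1D; first apply: uniform1D.
- by apply: uniform_pd; exact: uniform_conn.
- by apply: uniform1N; apply: uniform_pd; exact: uniform_conn.
apply: uniform1_sum => e; apply: uniform1D; last apply: uniform1N;
  apply: uniform1M; exact: uniform_conn.
Qed.

Lemma uniform_lap F : uniform1 F ->
  uniform1 (fun S => dlap (jh S) (jhi S) (F S)).
Proof.
move=> FU; apply: uniform_contr => a b.
apply: (@uniform1_ext (fun S => pd a (pd b (F S)) -
   \sum_c conn (jh S) (jhi S) a b c * pd c (F S))) => [S|].
  by rewrite mxE.
apply: uniform1D; first by do 2!apply: uniform_pd.
apply: uniform1N; apply: uniform1_sum => c; apply: uniform1M.
  exact: uniform_conn.
exact: uniform_pd.
Qed.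

Lemma uniform_dgrad F F' : uniform1 F -> uniform1 F' ->
  uniform1 (fun S => dgrad (jhi S) (F S) (F' S)).
Proof.
move=> FU FU'; apply: uniform1_sum => a; apply: uniform1_sum => b.
by apply: uniform1M; [apply: uniform1M; [exact: uniform1_hi|]|]; exact: uniform_pd.
Qed.

Lemma uniform_disq F : uniform1 F ->
  uniform1 (fun S => disq (jh S) (jhi S) (F S)).
Proof.
move=> FU; apply: uniform1D; first exact: uniform_dgrad.
apply: uniform1N; apply: uniform1M.
  by apply: uniform1M => //; exact: uniform1_cst.
apply: uniform1D; first exact: uniform_lap.
by apply: uniform1M => //; apply: uniform1M; [exact: uniform1_cst|exact: uniform_scal].
Qed.

Lemma uniform_iter F F' k : uniform1 F -> uniform1 F' ->
  uniform1 (fun S => iter k (dgrad (jhi S) (F S)) (F' S)).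
Proof. by move=> FU FU'; elim: k => //= k IH; exact: uniform_dgrad. Qed.

Lemma uniform_disqB1 F : uniform1 F ->
  uniform1 (fun S => disq (jh S) (jhi S) (F S) - 1).
Proof.
move=> FU; apply: uniform1D; first exact: uniform_disq.
by apply: uniform1N; exact: (uniform1_nat 1).
Qed.

Lemma uniform_approx m : uniform1 (fun S => approx S m).
Proof.
elim: m => [|m IH].
  by apply: uniform1M; [exact: (uniform1_fun [::])|exact: uniform1_n].
apply: uniform1D => //; apply: uniform1M; first exact: uniform1_cst.
apply: uniform1M; first exact: uniform1X.
by apply: uniform_iter => //; exact: uniform_disqB1.
Qed.

Lemma uniform_obstruction : uniform1 (fun S => jet_obstruction S).
Proof.
apply: uniform1M; first exact: uniform1_cst.
apply: uniform_iter; first exact: uniform_approx.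
by apply: uniform_disqB1; exact: uniform_approx.
Qed.

End Uniform.

(** * Calculus of smooth functions *)

Section Differentiation.
Context {R : realType} {d : nat}.
Local Notation V := 'rV[R]_d.
Local Notation ev a := (delta_mx 0 a : 'rV[R]_d).
Implicit Types (f g : V -> R) (x y v : V) (U : set V).

Lemma is_derive_line f y v (t : R) : derivable f (y + t *: v) v ->
  is_derive t 1 (fun u => f (y + u *: v)) ('D_v f (y + t *: v)).
Proof.
move=> df.
have E : (fun h : R => h^-1 *: (((fun u => f (y + u *: v)) \o shift t) (h *: 1)
    - f (y + t *: v))) =
  (fun h => h^-1 *: ((f \o shift (y + t *: v)) (h *: v) - f (y + t *: v))).
  apply/funext => h /=; congr (_ *: (f _ - _)).
  by rewrite [_ *: 1]mulr1 scalerDl addrCA.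
by split; rewrite /derivable /derive E.
Qed.

Lemma mean_value_line f y v (t : R) :
  (forall u : R, `|u| <= `|t| -> derivable f (y + u *: v) v) ->
  exists2 u : R, `|u| <= `|t| & f (y + t *: v) - f y = t * 'D_v f (y + u *: v).
Proof.
move=> df; pose g (u : R) := f (y + u *: v).
have main (a b : R) : a <= b -> (forall u, u \in `[a, b] -> `|u| <= `|t|) ->
    exists2 u, u \in `[a, b] & g b - g a = 'D_v f (y + u *: v) * (b - a).
  move=> ab abt; apply: MVT_segment => // [u uab|].
    by apply: is_derive_line; apply: df; apply: abt; exact: subset_itv_oo_cc.
  apply: derivable_within_continuous => u /abt ut.
  by apply: ex_derive; apply: is_derive_line; exact: df.
have g0 : g 0 = f y by rewrite /g scale0r addr0.
have [t0|t0] := leP 0 t.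
  have [u|u ut E] := main 0 t t0.
    by rewrite in_itv/= => /andP[u0 ut]; rewrite !ger0_norm.
  exists u; last by rewrite -g0 mulrC -[t in RHS]subr0.
  by move: ut; rewrite in_itv/= => /andP[u0 ut]; rewrite !ger0_norm.
have [u|u ut E] := main t 0 (ltW t0).
  by rewrite in_itv/= => /andP[tu u0]; rewrite !ler0_norm ?lerN2// ltW.
exists u; last by rewrite -g0 -[LHS]opprB E; ring.
by move: ut; rewrite in_itv/= => /andP[tu u0]; rewrite !ler0_norm ?lerN2// ltW.
Qed.

Lemma row_norm_le x (r : R) : 0 <= r -> (forall j, `|x 0 j| <= r) -> `|x| <= r.
Proof.
move=> r0 xr; rewrite [leLHS]/Num.Def.normr/= mx_normrE bigmax_le// => -[i j] _.
by rewrite ord1.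
Qed.

Lemma coord_norm_le x j : `|x 0 j| <= `|x|.
Proof.
rewrite [leRHS]/Num.Def.normr/= mx_normrE.
exact: (le_bigmax _ (fun i : 'I_1 * 'I_d => `|x i.1 i.2|) (0, j)).
Qed.

Definition dlin (c : 'I_d -> R) v : R := \sum_a v 0 a * c a.

Lemma dlin_is_linear c : linear (dlin c).
Proof.
move=> k u v; rewrite /dlin scaler_sumr -big_split; apply: eq_bigr => a _ /=.
by rewrite !mxE mulrDl -mulrA.
Qed.

HB.instance Definition _ c :=
  GRing.isLinear.Build R V R *:%R (dlin c) (dlin_is_linear c).

Lemma dlin_continuous c : continuous (dlin c).
Proof.
rewrite /dlin; apply: continuous_big => [|a _ v]; first exact: add_continuous.
by apply: continuousM; [exact: (@coord_continuous R 1 d 0 a v)|exact: cst_continuous].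
Qed.

Lemma C1_diff U f x : open U -> U x ->
  (forall y, U y -> forall a, derivable f y (ev a)) ->
  (forall a, {for x, continuous (pderiv a f)}) ->
  differentiable f x /\ 'd f x = dlin (fun a => pderiv a f x) :> (V -> R).
Proof.
move=> oU Ux df cf; set D := dlin _.
have main : (f : V -> R^o) \o shift x = cst (f x) + (D : V -> R^o) +o_ (0 : V) id.
  apply/eqaddoP => _/posnumP[e].
  (* The error is shared among d coordinate steps; d + 1 keeps the quotient meaningful for d = 0. *)
  pose e' := e%:num / d.+1%:R.
  have e'0 : 0 < e' by rewrite divr_gt0.
  have : \forall y \near x, U y /\
      forall a, `|pderiv a f x - pderiv a f y| <= e'.
    near=> y; split; first by near: y; exact: open_nbhs_nbhs.
    by near: y; apply: filter_forall => a; have /cvgrPdist_le := cf a; apply.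
  move=> /nbhs_ballP[r /= r0 xr].
  apply/nbhs_ballP; exists r => //= h.
  rewrite -ball_normE /ball_/= sub0r normrN => hr.
  (* The points [x + p k] lead from x to x + h parallel to the axes; on each leg the mean value
     theorem needs a single partial derivative. *)
  pose p k : V := \row_j (if (j < k)%N then h 0 j else 0).
  have pS (k : 'I_d) : p k.+1 = p k + h 0 k *: ev k.
    apply/rowP => j; rewrite !mxE eqxx/= ltnS leq_eqVlt.
    have [->|jk] := eqVneq k j; first by rewrite eqxx ltnn mulr1 add0r.
    rewrite -(inj_eq val_inj) in jk.
    by rewrite eq_sym (negPf jk) mulr0 addr0.
  have inb (k : 'I_d) (u : R) : `|u| <= `|h 0 k| ->
      U (x + p k + u *: ev k) /\
      `|pderiv k f x - pderiv k f (x + p k + u *: ev k)| <= e'.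
    move=> uk; have := xr (x + p k + u *: ev k); rewrite -ball_normE /ball_/=.
    rewrite opprD addrA opprD addrA subrr add0r -opprD normrN.
    move=> H; have [|Uy] := H; last by split=> //; exact: b.
    apply: le_lt_trans hr; apply: row_norm_le => // j; rewrite !mxE eqxx/=.
    have [kj|kj] := eqVneq k j.
      by rewrite -kj ltnn add0r mulr1 (le_trans uk)// coord_norm_le.
    by rewrite mulr0 addr0; case: ifP; rewrite ?normr0 ?coord_norm_le.
  have step (k : 'I_d) : `|f (x + p k.+1) - f (x + p k) - h 0 k * pderiv k f x|
      <= `|h| * e'.
    have [|u uk] := @mean_value_line f (x + p k) (ev k) (h 0 k).
      by move=> u /inb[Uy _]; exact: df.
    rewrite pS addrA => ->; rewrite -mulrBr normrM distrC.
    by apply: ler_pM => //; [exact: coord_norm_le|case: (inb k u uk)].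
  have pd : p d = h by apply/rowP => j; rewrite mxE ltn_ord.
  have p0 : p 0 = 0 by apply/rowP => j; rewrite !mxE.
  have -> : (f \o shift x - (cst (f x) + D)) h =
      \sum_(k < d) (f (x + p k.+1) - f (x + p k) - h 0 k * pderiv k f x).
    rewrite sumrB -(big_mkord predT (fun k => f (x + p k.+1) - f (x + p k))).
    rewrite telescope_sumr// pd p0 addr0 !fctE/= [h + x]addrC.
    by rewrite opprD addrA.
  apply: (le_trans (ler_norm_sum _ _ _)).
  apply: (@le_trans _ _ (\sum_(k < d) `|h| * e')); first exact: ler_sum.
  rewrite sumr_const card_ord -mulr_natr -mulrA mulrC ler_wpM2r//.
  rewrite /e' -mulrA ler_piMr// mulrC ler_pdivrMr// mul1r ler_nat//.
have dD := diff_unique (@dlin_continuous (fun a => pderiv a f x)) main.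
split; last exact: dD.
by apply/diff_locallyP; rewrite dD; split=> //; exact: dlin_continuous.
Unshelve. all: by end_near. Qed.

Lemma derive_line (W : normedModType R) (F : V -> W) x v :
  (derivable (fun u : R => F (x + u *: v)) 0 1 <-> derivable F x v) /\
  'D_1 (fun u : R => F (x + u *: v)) 0 = 'D_v F x.
Proof.
have E : (fun h : R => h^-1 *: (((fun u => F (x + u *: v)) \o shift 0) (h *: 1)
    - F (x + 0 *: v))) =
  (fun h => h^-1 *: ((F \o shift x) (h *: v) - F x)).
  apply/funext => h /=; rewrite scale0r !addr0; congr (_ *: (F _ - _)).
  by rewrite [_ *: 1]mulr1 addrC.
by split; rewrite /derivable /derive E.
Qed.

(** [F] is differentiable along [v] only, so the chain rule is applied to the curve that it traces
    over the line through x in direction [v]. *)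
Lemma derive_chain (F : V -> V) f x v (c : 'I_d -> R) :
  (forall b, derivable (fun y => F y 0 b) x v) ->
  differentiable f (F x) -> 'd f (F x) = dlin c :> (V -> R) ->
  derivable (f \o F) x v /\
  'D_v (f \o F) x = \sum_b 'D_v (fun y => F y 0 b) x * c b.
Proof.
move=> dF df dfE.
have dFx : derivable F x v by apply/derivable_mxP => i j; rewrite ord1.
pose gam (u : R) := F (x + u *: v).
have [gi gE] := derive_line F x v.
have dgam : differentiable gam 0 by apply/derivable1_diffP; apply/gi.
have g0 : gam 0 = F x by rewrite /gam scale0r addr0.
have df0 : differentiable f (gam 0) by rewrite g0.
have [ci cE] := derive_line (f \o F : V -> R^o) x v.
have dc : differentiable (f \o gam) 0 by exact: differentiable_comp.
split; first by apply/ci; apply/derivable1_diffP.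
rewrite -cE (@deriveE _ _ _ (f \o gam)) // diff_comp//= -(deriveE _ dgam) gE.
by rewrite g0 dfE (derive_mx dFx); apply: eq_bigr => b _; rewrite mxE.
Qed.

Lemma derive_shift_add f x v c : derivable f (x + c) v ->
  derivable (fun y => f (y + c)) x v /\ 'D_v (fun y => f (y + c)) x = 'D_v f (x + c).
Proof.
move=> df; have E : (fun h : R => h^-1 *: (((fun y => f (y + c)) \o shift x) (h *: v)
    - f (x + c))) = (fun h => h^-1 *: ((f \o shift (x + c)) (h *: v) - f (x + c))).
  by apply/funext => h /=; rewrite addrA.
by split; rewrite /derivable /derive E.
Qed.

(** Smoothness in finite stages: derivatives of products and composites are sums of products one
    stage lower, an induction for which lists of iterated derivatives are ill suited. *)
Fixpoint Cn n U f : Prop := (forall x, U x -> {for x, continuous f}) /\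
  if n is n'.+1 then (forall x, U x -> forall a, derivable f x (ev a)) /\
    forall a, Cn n' U (pderiv a f) else True.

Lemma Cn_cont n U f x : Cn n U f -> U x -> {for x, continuous f}.
Proof. by case: n => [|n] [H _]; exact: H. Qed.

Lemma CnS n U f : Cn n.+1 U f -> Cn n U f.
Proof.
elim: n f => [|n IH] f [cf [df Cf]]; split=> //; split=> // a.
by apply: IH; exact: Cf.
Qed.

Lemma pderivs_rcons l a f : pderivs (rcons l a) f = pderivs l (pderiv a f).
Proof. by rewrite /pderivs foldr_rcons. Qed.

Lemma smooth_pderiv U f a : smooth_on U f -> smooth_on U (pderiv a f).
Proof. by move=> sf l x Ux; rewrite -pderivs_rcons; exact: sf. Qed.

Lemma smooth_Cn U f : smooth_on U f <-> forall n, Cn n U f.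
Proof.
split=> [sf n|Cf].
  elim: n f sf => [|n IH] f sf; first by split=> // x Ux; case: (sf [::] x Ux).
  split; first by move=> x Ux; case: (sf [::] x Ux).
  split; first by move=> x Ux; case: (sf [::] x Ux).
  by move=> a; apply: IH; exact: smooth_pderiv.
move=> l; elim/last_ind: l f Cf => [|l a IH] f Cf x Ux.
  by have [cf [df _]] := Cf 1; split; [exact: cf|exact: df].
rewrite pderivs_rcons; apply: IH => // n.
by have [_ [_ H]] := Cf n.+1; exact: H.
Qed.

Section Open.
Variables (U : set V).
Hypothesis oU : open U.

Lemma eq_near f g x : U x -> (forall y, U y -> f y = g y) -> \near x, f x = g x.
Proof. by move=> Ux fg; near=> y; apply: fg; near: y; exact: open_nbhs_nbhs.
Unshelve. all: by end_near. Qed.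

Lemma eq_pderiv f g a x : U x -> (forall y, U y -> f y = g y) ->
  pderiv a f x = pderiv a g x.
Proof. by move=> Ux fg; exact: near_eq_derive (eq_near Ux fg). Qed.

(** The rules for derivatives hold on [U] only, so each closure lemma replaces a derivative by a
    formula that agrees with it there. *)
Lemma Cn_ext n f g : (forall y, U y -> f y = g y) -> Cn n U f -> Cn n U g.
Proof.
have cext (f' g' : V -> R) : (forall y, U y -> f' y = g' y) ->
    (forall x, U x -> {for x, continuous f'}) -> forall x, U x -> {for x, continuous g'}.
  move=> fg cf x Ux; rewrite /prop_for /continuous_at -(fg _ Ux).
  apply: cvg_trans (cf x Ux); apply: near_eq_cvg.
    exact: (@nbhs_filter V x).
  exact: (eq_near Ux fg).
elim: n f g => [|n IH] f g fg; first by move=> [cf _]; split=> //; exact: cext cf.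
move=> [cf [df Cf]]; split; first exact: cext cf.
split; first by move=> x Ux a; exact: near_eq_derivable (eq_near Ux fg) (df x Ux a).
by move=> a; apply: IH (Cf a) => y Uy; exact: eq_pderiv.
Qed.

Lemma smooth_ext f g : (forall y, U y -> f y = g y) -> smooth_on U f -> smooth_on U g.
Proof. by move=> fg /smooth_Cn sf; apply/smooth_Cn => n; exact: Cn_ext (sf n). Qed.

Lemma CnD n f g : Cn n U f -> Cn n U g -> Cn n U (f + g).
Proof.
elim: n f g => [|n IH] f g; first by move=> [cf _] [cg _]; split=> // x Ux;
  apply: continuousD; [exact: cf|exact: cg].
move=> [cf [df Cf]] [cg [dg Cg]]; split.
  by move=> x Ux; apply: continuousD; [exact: cf|exact: cg].
split; first by move=> x Ux a; apply: derivableD; [exact: df|exact: dg].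
move=> a; apply: (Cn_ext (f := pderiv a f + pderiv a g)).
  2: by apply: IH; [exact: Cf|exact: Cg].
by move=> x Ux; rewrite /pderiv deriveD//; [exact: df|exact: dg].
Qed.

Lemma CnM n f g : Cn n U f -> Cn n U g -> Cn n U (f * g).
Proof.
elim: n f g => [|n IH] f g; first by move=> [cf _] [cg _]; split=> // x Ux;
  apply: continuousM; [exact: cf|exact: cg].
move=> Hf Hg; have [cf [df Cf]] := Hf; have [cg [dg Cg]] := Hg; split.
  by move=> x Ux; apply: continuousM; [exact: cf|exact: cg].
split; first by move=> x Ux a; apply: derivableM; [exact: df|exact: dg].
move=> a; apply: (Cn_ext (f := f * pderiv a g + g * pderiv a f)).
  by move=> x Ux; rewrite /pderiv deriveM//; [exact: df|exact: dg].
by apply: CnD; apply: IH; [exact: CnS|exact: Cg|exact: CnS|exact: Cf].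
Qed.

Lemma Cn_cst n (c : R) : Cn n U (cst c).
Proof.
elim: n c => [|n IH] c; first by split=> // x _; exact: cst_continuous.
split; first by move=> x _; exact: cst_continuous.
split; first by move=> x Ux a; exact: derivable_cst.
move=> a; have -> : pderiv a (cst c) = cst 0 by apply/funext => y; exact: derive_cst.
exact: IH.
Qed.

Lemma CnV n f : (forall x, U x -> f x != 0) -> Cn n U f -> Cn n U (fun x => (f x)^-1).
Proof.
move=> f0; have cV (g : V -> R) : (forall x, U x -> g x != 0) ->
    (forall x, U x -> {for x, continuous g}) ->
    forall x, U x -> {for x, continuous (fun x => (g x)^-1)}.
  by move=> g0 cg x Ux; apply: continuousV; [exact: g0|exact: cg].
elim: n => [|n IH]; first by move=> [cf _]; split=> //; exact: cV.
move=> Hf; have [cf [df Cf]] := Hf; split; first exact: cV.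
split; first by move=> x Ux a; apply: derivableV; [exact: f0|exact: df].
move=> a; pose g x := (f x)^-1.
apply: (Cn_ext (f := cst (-1) * (g * g * pderiv a f))).
  move=> x Ux; rewrite /pderiv deriveV//; [|exact: f0|exact: df].
  rewrite !fctE /g -invfM -expr2 /GRing.scale/= mulNr mul1r mulNr.
  by [].
have Cg : Cn n U g by apply: IH; exact: CnS.
by apply: CnM; [exact: Cn_cst|apply: CnM; [exact: CnM|exact: Cf]].
Qed.

Lemma Cn_differentiable f x : U x -> Cn 1 U f ->
  differentiable f x /\ 'd f x = dlin (fun a => pderiv a f x) :> (V -> R).
Proof.
move=> Ux [cf [df Cf]]; apply: (C1_diff oU Ux df) => a.
by have [H _] := Cf a; exact: H.
Qed.

Lemma derive_sqrt f x v : 0 < f x -> derivable f x v ->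
  derivable (fun y => Num.sqrt (f y)) x v /\
  'D_v (fun y => Num.sqrt (f y)) x = (2 * Num.sqrt (f x))^-1 * 'D_v f x.
Proof.
move=> f0 df; have [/proj2 /(_ df) dl lE] := derive_line (f : V -> R^o) x v.
have [[ci _] cE] := derive_line ((fun y => Num.sqrt (f y)) : V -> R^o) x v.
have f0' : 0 < f (x + 0 *: v) by rewrite scale0r addr0.
have H := is_derive1_sqrt f0'.
have H2 : is_derive (0 : R) 1 (fun u : R => f (x + u *: v)) ('D_v f x).
  by rewrite -lE; exact/derivableP.
have [H3 H4] := @is_derive1_comp R Num.sqrt (fun u : R => f (x + u *: v)) 0 _ _ H H2.
split; first exact: ci.
by rewrite -cE H4 scale0r addr0.
Qed.

Lemma Cn_sqrt n f : (forall x, U x -> 0 < f x) -> Cn n U f ->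
  Cn n U (fun x => Num.sqrt (f x)).
Proof.
move=> f0; have cV (g : V -> R) : (forall x, U x -> {for x, continuous g}) ->
    forall x, U x -> {for x, continuous (fun x => Num.sqrt (g x))}.
  move=> cg x Ux; apply: continuous_comp; [exact: cg|exact: sqrt_continuous].
elim: n => [|n IH]; first by move=> [cf _]; split=> //; exact: cV.
move=> Hf; have [cf [df Cf]] := Hf; split; first exact: cV.
split; first by move=> x Ux a; have [] := derive_sqrt (f0 x Ux) (df x Ux a).
move=> a; pose g x := (2 * Num.sqrt (f x))^-1.
apply: (Cn_ext (f := g * pderiv a f)).
  by move=> x Ux; have [_ H] := derive_sqrt (f0 x Ux) (df x Ux a); exact: esym H.
apply: CnM; last exact: Cf.
apply: CnV.
  by move=> x Ux; rewrite mulf_neq0 ?pnatr_eq0// gt_eqF// sqrtr_gt0 f0.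
apply: (CnM (f := cst 2)); first exact: Cn_cst.
by apply: IH; exact: CnS.
Qed.

End Open.

Lemma Cn_comp n U U' (F : V -> V) f : open U -> open U' ->
  (forall x, U x -> U' (F x)) ->
  (forall b, Cn n U (fun x => F x 0 b)) -> Cn n U' f -> Cn n U (f \o F).
Proof.
move=> oU oU' UF.
have cF : (forall b x, U x -> {for x, continuous (fun x => F x 0 b)}) ->
    forall x, U x -> {for x, continuous F}.
  move=> H x Ux; apply/(@cvgrPdist_le _ _ _ _ (@nbhs_filter V x)) => e e0; near=> y.
  apply: row_norm_le => [|j]; first exact: ltW.
  rewrite !mxE; move: j; near: y; apply: filter_forall => j.
  by have /cvgrPdist_le := H j x Ux; apply.
have cc g : (forall b x, U x -> {for x, continuous (fun x => F x 0 b)}) ->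
    (forall x, U' x -> {for x, continuous g}) ->
    forall x, U x -> {for x, continuous (g \o F)}.
  by move=> H1 H2 x Ux; apply: continuous_comp; [exact: cF|apply: H2; exact: UF].
elim: n f => [|n IH] f CF Cf.
  by split=> //; apply: cc => [b x|x]; apply: Cn_cont; [exact: CF|exact: Cf].
have chain x a : U x -> derivable (f \o F) x (ev a) /\
    pderiv a (f \o F) x = \sum_b pderiv a (fun y => F y 0 b) x * pderiv b f (F x).
  move=> Ux; have [] := Cn_differentiable (f := f) oU' (UF x Ux).
    by elim: n Cf {IH CF} => // n IH /CnS.
  move=> df dfE; apply: derive_chain => // b.
  by have [_ [H _]] := CF b; exact: H.
split; first by apply: cc => [b x|x]; apply: Cn_cont; [exact: CF|exact: Cf].
split; first by move=> x Ux a; have [] := chain x a Ux.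
move=> a; apply: (Cn_ext oU (f := \sum_b
    (pderiv a (fun y => F y 0 b) * (pderiv b f \o F)))).
  move=> x Ux; have [_ ->] := chain x a Ux; rewrite fct_sumE.
  by apply: eq_bigr.
elim/big_ind: _; first exact: (Cn_cst _ _ 0).
  by move=> f1 f2; exact: CnD.
move=> b _; apply: (CnM oU).
  by have [_ [_ H]] := CF b; exact: H.
apply: IH; last by have [_ [_ H]] := Cf; exact: H.
by move=> c; exact: CnS.
Unshelve. all: by end_near. Qed.

End Differentiation.

Section MoreCalculus.
Context {R : realType} {d : nat}.
Local Notation V := 'rV[R]_d.
Local Notation ev a := (delta_mx 0 a : 'rV[R]_d).
Implicit Types (f g : V -> R) (x y v : V) (U : set V).

Lemma ev_norm a (u : R) : `|u *: ev a| <= `|u|.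
Proof.
apply: row_norm_le => // j; rewrite !mxE eqxx/=.
by case: (j == a); rewrite ?mulr1// mulr0 normr0.
Qed.

Lemma smooth_cont U f x : smooth_on U f -> U x -> {for x, continuous f}.
Proof. by move=> sf Ux; case: (sf [::] x Ux). Qed.

Lemma smooth_derivable U f x a : smooth_on U f -> U x -> derivable f x (ev a).
Proof. by move=> sf Ux; case: (sf [::] x Ux). Qed.

Lemma smooth_sub U U' f : U' `<=` U -> smooth_on U f -> smooth_on U' f.
Proof. by move=> UU sf l x /UU; exact: sf. Qed.

(** The mean value theorem twice: along [a] for the increment of f in direction [b], then along [b]
    for the derivative in direction [a]. *)
Lemma second_difference U f a b x (t : R) :
  (forall y, U y -> forall a, derivable f y (ev a)) ->
  (forall y, U y -> derivable (pderiv a f) y (ev b)) ->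
  (forall u w : R, `|u| <= `|t| -> `|w| <= `|t| -> U (x + u *: ev a + w *: ev b)) ->
  exists u w, [/\ `|u| <= `|t|, `|w| <= `|t| &
   f (x + t *: ev a + t *: ev b) - f (x + t *: ev a) - f (x + t *: ev b) + f x =
   t * (t * pderiv b (pderiv a f) (x + u *: ev a + w *: ev b))].
Proof.
move=> df ddf xU.
have tt : `|t| <= `|t| by [].
have z0 : `|0 : R| <= `|t| by rewrite normr0.
pose F : V -> R := (fun y => f (y + t *: ev b)) - f.
have dF u : `|u| <= `|t| -> derivable F (x + u *: ev a) (ev a) /\
    'D_(ev a) F (x + u *: ev a) =
    pderiv a f (x + u *: ev a + t *: ev b) - pderiv a f (x + u *: ev a).
  move=> ut; have [d1 e1] := derive_shift_add (df _ (xU u t ut tt) a).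
  have d2 : derivable f (x + u *: ev a) (ev a).
    by have := df _ (xU u 0 ut z0) a; rewrite scale0r addr0.
  by split; [exact: (derivableB d1 d2)|rewrite (deriveB d1 d2) e1].
have [u ut E] := @mean_value_line _ _ F x (ev a) t (fun u H => (dF u H).1).
have [w wt E2] := @mean_value_line _ _ (pderiv a f) (x + u *: ev a) (ev b) t
  (fun w H => ddf _ (xU u w ut H)).
exists u, w; split => //; rewrite -E2 -(dF u ut).2 -E /F !fctE; ring.
Qed.

Lemma pderivC U f a b x : open U -> smooth_on U f -> U x ->
  pderiv a (pderiv b f) x = pderiv b (pderiv a f) x.
Proof.
move=> oU sf Ux.
apply/eqP; rewrite -subr_eq0 -normr_le0; apply/ler_addgt0Pr => e e0; rewrite add0r.
have sfa := smooth_pderiv a sf; have sfb := smooth_pderiv b sf.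
have c1 := smooth_cont (smooth_pderiv a sfb) Ux.
have c2 := smooth_cont (smooth_pderiv b sfa) Ux.
have e2 : 0 < e / 2 by rewrite divr_gt0.
have /(@cvgrPdist_le _ _ _ _ (@nbhs_filter V x))/(_ _ e2) n1 := c1.
have /(@cvgrPdist_le _ _ _ _ (@nbhs_filter V x))/(_ _ e2) n2 := c2.
move: (pderiv a (pderiv b f) x) (pderiv b (pderiv a f) x) n1 n2 => L1 L2 n1 n2.
have n0 : \forall y \near x, U y by exact: open_nbhs_nbhs.
have /nbhs_ballP[r /= r0 xr] := @filterI _ _ (@nbhs_filter V x) _ _ n0
  (@filterI _ _ (@nbhs_filter V x) _ _ n1 n2).
pose t := r / 3; have t0 : 0 < t by rewrite divr_gt0.
have inb (c c' : 'I_d) (u w : R) : `|u| <= `|t| -> `|w| <= `|t| ->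
    ball x r (x + u *: ev c + w *: ev c').
  move=> ut wt; rewrite -ball_normE /ball_/= opprD addrA opprD addrA subrr add0r.
  rewrite -opprD normrN (le_lt_trans (ler_normD _ _))//.
  rewrite (@le_lt_trans _ _ (t + t))//.
    rewrite lerD// (le_trans (ev_norm _ _))//.
      by rewrite (le_trans ut)// gtr0_norm.
    by rewrite (le_trans wt)// gtr0_norm.
  by rewrite /t; lra.
have df y : U y -> forall c, derivable f y (ev c) by move=> Uy c; exact: smooth_derivable sf Uy.
have [u [w [ut wt E1]]] := second_difference (x := x) (t := t) df
  (fun y Uy => smooth_derivable sfb Uy)
  (fun u w Hu Hw => (xr _ (inb b a u w Hu Hw)).1).
have [u' [w' [ut' wt' E2]]] := second_difference (x := x) (t := t) df
  (fun y Uy => smooth_derivable sfa Uy)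
  (fun u w Hu Hw => (xr _ (inb a b u w Hu Hw)).1).
have [_ [H1 _]] := xr _ (inb b a u w ut wt).
have [_ [_ H2]] := xr _ (inb a b u' w' ut' wt').
have tn : t != 0 by rewrite gt_eqF.
move: (pderiv a _ _) H1 E1 (pderiv b _ _) H2 E2 => P1 H1 E1 P2 H2 E2.
(* The second difference is symmetric in [a] and [b], so both intermediate values equal its quotient
   by t^2; each is within e/2 of its limit. *)
have P12 : P1 = P2.
  have E : t * (t * P1) = t * (t * P2).
    by rewrite -E1 -E2 (addrAC x) (addrAC (f _)).
  by move: E => /(mulfI tn) /(mulfI tn).
rewrite (_ : L1 - L2 = (L1 - P1) - (L2 - P2)); last by rewrite P12; ring.
by rewrite (le_trans (ler_normB _ _))// [leRHS]splitr (lerD H1 H2).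
Qed.

Lemma smooth_differentiable U f x : open U -> smooth_on U f -> U x ->
  differentiable f x /\ 'd f x = dlin (fun a => pderiv a f x) :> (V -> R).
Proof.
by move=> oU /smooth_Cn sf Ux; exact: (Cn_differentiable oU Ux (sf 1)).
Qed.

(* By the intermediate value theorem the zero set of s comes arbitrarily close,
   to first order, to any tangent line at x. *)
Lemma tangential_derivatives U f s x a b : open U -> smooth_on U f ->
  smooth_on U s -> U x -> s x = 0 -> (exists c, pderiv c s x != 0) ->
  (forall y, U y -> s y = 0 -> f y = 0) ->
  pderiv a f x * pderiv b s x = pderiv b f x * pderiv a s x.
Proof.
move=> oU sf ss Ux sx0 [c sc] fs0.
have [df dfE] := smooth_differentiable oU sf Ux.
have [ds dsE] := smooth_differentiable oU ss Ux.
set Df := dlin _ in dfE; set Ds := dlin _ in dsE.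
(* [v] is tangent and [n] transversal, with [Ds v = 0] and [Ds n = 1]; the claim becomes [Df v = 0].
   The zero summand gives [n] the shape that [dlin_comb] expects. *)
pose v : V := pderiv b s x *: ev a + (- pderiv a s x) *: ev b.
pose n : V := (pderiv c s x)^-1 *: ev c + 0 *: ev c.
have dlin_comb k (p q : R) (u w : V) :
    dlin k (p *: u + q *: w) = p * dlin k u + q * dlin k w.
  by rewrite [LHS]dlin_is_linear -[q *: w]addr0 dlin_is_linear linear0 addr0.
have dlin_ev (k : 'I_d -> R) e : dlin k (ev e) = k e.
  rewrite /dlin (bigD1 e)//= big1 ?addr0 => [|j je]; rewrite mxE ?eqxx ?mul1r//=.
  by rewrite (negPf je) mul0r.
have dsv : Ds v = 0.
  by rewrite /Ds dlin_comb !dlin_ev mulNr [X in X - _]mulrC; exact: subrr.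
have dsn : Ds n = 1 by rewrite /Ds dlin_comb dlin_ev mul0r addr0 mulVf.
suff dfv : Df v = 0.
  move: dfv; rewrite /Df dlin_comb !dlin_ev mulNr => /eqP.
  by rewrite subr_eq0 => /eqP E; rewrite [LHS]mulrC E [LHS]mulrC.
have fx0 : f x = 0 by exact: fs0.
(* t N bounds the displacement t v + q n for |q| <= t; C gathers the constants of the final estimate
   |Df v| <= e C <= e0. *)
pose N := `|v| + `|n| + 1; have N0 : 0 < N.
  by rewrite ltr_wpDl// addr_ge0.
pose C := `|Df n| + N + 1; have C0 : 0 < C.
  by rewrite ltr_wpDl// addr_ge0// ltW.
apply/eqP; rewrite -normr_le0; apply/ler_addgt0Pr => e0 e00; rewrite add0r.
pose e := Num.min 1 (e0 / C).
have e_gt0 : 0 < e by rewrite lt_min ltr01 divr_gt0.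
have e1 : e <= 1 by rewrite ge_min lexx.
have eC : e * C <= e0 by rewrite -ler_pdivlMr// ge_min lexx orbT.
pose e' := e / (2 * N); have e'0 : 0 < e' by rewrite divr_gt0// mulr_gt0.
have e'N : e' * N = e / 2 by rewrite /e' invfM mulrA divfK ?gt_eqF.
have /eqaddoP /(_ _ e'0) Hf := diff_locally df; rewrite dfE in Hf.
have /eqaddoP /(_ _ e'0) Hs := diff_locally ds; rewrite dsE in Hs.
have /nbhs_ballP[r1 /= r10 U1] : nbhs x U by exact: open_nbhs_nbhs.
have /nbhs_ballP[r2 /= r20 xf] := Hf; have /nbhs_ballP[r3 /= r30 xs] := Hs.
pose r := Num.min r1 (Num.min r2 r3).
have r0 : 0 < r by rewrite !lt_min r10 r20 r30.
have xr h : `|h| < r -> [/\ U (h + x), `|f (h + x) - Df h| <= e' * `|h|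
    & `|s (h + x) - Ds h| <= e' * `|h| ].
  rewrite !lt_min => /and3P[h1 h2 h3]; split.
  - by apply: U1; rewrite -ball_normE /ball_/= opprD addrCA subrr addr0 normrN.
  - have := xf h; rewrite -ball_normE /ball_/= sub0r normrN => /(_ h2).
    by rewrite !fctE/= fx0 add0r.
  - have := xs h; rewrite -ball_normE /ball_/= sub0r normrN => /(_ h3).
    by rewrite !fctE/= sx0 add0r.
have [t t0 tN] : exists2 t, 0 < t & t * N < r.
  exists (r / (2 * N)); first by rewrite divr_gt0// mulr_gt0.
  by rewrite invfM mulrA divfK ?gt_eqF//; lra.
(* On this transversal segment s equals q up to an error e t / 2, so it changes sign between - e t
   and e t. *)
pose h (q : R) := t *: v + q *: n.
have hN q : `|q| <= t -> `|h q| <= t * N.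
  move=> qt; rewrite (le_trans (ler_normD _ _))// !normrZ gtr0_norm//.
  have -> : t * N = t * `|v| + (t * `|n| + t) by rewrite /N; ring.
  rewrite lerD//; apply: (@le_trans _ _ (t * `|n|)); first by rewrite ler_wpM2r.
  by rewrite lerDl ltW.
have inb q : `|q| <= t -> [/\ U (h q + x),
    `|f (h q + x) - Df (h q)| <= e / 2 * t
    & `|s (h q + x) - Ds (h q)| <= e / 2 * t].
  move=> qt; have hq := hN q qt.
  have hr : `|h q| < r by exact: le_lt_trans tN.
  have eN : e' * `|h q| <= e / 2 * t.
    apply: (le_trans (ler_wpM2l (ltW e'0) hq)).
    by rewrite -e'N [leRHS]mulrAC mulrA.
  have [Uh H1 H2] := xr _ hr.
  by split=> //; [exact: le_trans H1 eN|exact: le_trans H2 eN].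
have dsh q : Ds (h q) = q.
  by rewrite /Ds dlin_comb -/Ds dsv dsn mulr0 add0r mulr1.
have dfh q : Df (h q) = t * Df v + q * Df n.
  by rewrite /Df dlin_comb.
have etq : e * t <= t by rewrite ler_piMl// ltW.
have et0 : 0 < e * t by rewrite mulr_gt0.
have range q : q \in `[- (e * t), e * t] -> `|q| <= e * t.
  by rewrite in_itv/= ler_norml.
have cont : {within `[- (e * t), e * t], continuous (fun q => s (h q + x))}.
  apply: continuous_in_subspaceT => q; rewrite inE/= => /range qt.
  have [Uh _ _] := inb q (le_trans qt etq).
  apply: (@continuous_comp _ _ _ (fun q => h q + x) s); last exact: smooth_cont ss Uh.
  rewrite /h; apply: cvgD; last exact: cvg_cst.
  by apply: cvgD; [exact: cvg_cst|apply: cvgZl; exact: cvg_id].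
have q1 : `|e * t| <= t by rewrite gtr0_norm.
have q2 : `|- (e * t)| <= t by rewrite normrN.
have [_ _ Hp] := inb _ q1; have [_ _ Hm] := inb _ q2.
rewrite !dsh in Hp Hm.
have sp : 0 <= s (h (e * t) + x).
  by move: Hp; rewrite ler_norml => /andP[+ _]; move: et0; rewrite mulrAC; lra.
have sm : s (h (- (e * t)) + x) <= 0.
  by move: Hm; rewrite ler_norml => /andP[_]; move: et0; rewrite mulrAC; lra.
have le2 : - (e * t) <= e * t by lra.
(* At the zero of s found here f vanishes too, while f is t Df v + q Df n up to e t / 2, with |q| <=
   e t. *)
have [|q /range qt sq] := IVT le2 cont (v := 0).
  by rewrite ge_min sm le_max sp orbT.
have [Uh Hfq _] := inb q (le_trans qt etq).
rewrite (fs0 _ Uh sq) sub0r normrN dfh in Hfq.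
have H : t * `|Df v| <= e * t * `|Df n| + e / 2 * t.
  rewrite -{1}(gtr0_norm t0) -normrM.
  rewrite (_ : t * _ = (t * Df v + q * Df n) - q * Df n); last by ring.
  rewrite (le_trans (ler_normB _ _))// addrC lerD// normrM.
  by rewrite ler_wpM2r.
have : t * `|Df v| <= t * (e * C).
  have -> : t * (e * C) = e * t * `|Df n| + e * t * (N + 1) by rewrite /C; ring.
  apply: (le_trans H); rewrite lerD2l mulrAC ler_pM2l//.
  by rewrite (@le_trans _ _ 1)// ?invf_le1 ?ler1n// lerDr ltW.
by rewrite ler_pM2l// => /le_trans; apply.
Qed.

Lemma smooth_jacobian U (F : V -> V) x a b : open U -> smooth_map_on U F -> U x ->
  jacobian F x a b = pderiv a (fun y => F y 0 b) x.
Proof.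
move=> oU sF Ux.
have dF : differentiable F x.
  have -> : F = \sum_b (fun y => F y 0 b *: ev b).
    apply/funext => y; rewrite fct_sumE; apply/rowP => j.
    rewrite summxE (bigD1 j)//= big1 ?addr0 => [|i ij]; rewrite !mxE eqxx/= ?eqxx ?mulr1//.
    by rewrite eq_sym (negPf ij) mulr0.
  apply: differentiable_sum => c; apply: differentiableZl.
  by have [] := smooth_differentiable oU (sF c) Ux.
rewrite /jacobian /lin1_mx mxE -deriveE// derive_mx ?mxE//.
exact: diff_derivable.
Qed.

End MoreCalculus.

(** * The differential algebra of smooth functions on an open set *)

(* Smooth functions on U, extended by 0 so that Leibniz equality is equality
   on U. *)
Record sfun (R : realType) (d : nat) (U : set 'rV[R]_d) (oU : open U) := SFun {
  sfun_val :> 'rV[R]_d -> R;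
  sfun_smooth : smooth_on U sfun_val;
  sfun_supp : forall x, ~ U x -> sfun_val x = 0
}.

HB.instance Definition _ R d U oU := gen_eqMixin (@sfun R d U oU).
HB.instance Definition _ R d U oU := gen_choiceMixin (@sfun R d U oU).

Section SmoothRing.
Context {R : realType} {d : nat} {U : set 'rV[R]_d} {oU : open U}.
Local Notation V := 'rV[R]_d.
Implicit Types (f g k : sfun oU) (x : V) (u v : V -> R).

Lemma sfunP f g : (forall x, U x -> f x = g x) -> f = g.
Proof.
case: f g => [f sf f0] [g sg g0] /= fg.
have E : f = g.
  by apply/funext => x; have [/fg//|Ux] := pselect (U x); rewrite f0// g0.
by case: _ / E sg g0 {fg} => sg g0; congr (SFun _ _ _); exact: Prop_irrelevance.
Qed.

Definition cut u x : R := if `[< U x >] then u x else 0.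

Lemma cutE u x : U x -> cut u x = u x.
Proof. by move=> Ux; rewrite /cut asboolT. Qed.

Lemma cut_smooth u : smooth_on U u -> smooth_on U (cut u).
Proof. by apply: (smooth_ext oU) => x Ux; rewrite cutE. Qed.

Lemma cut_supp u x : ~ U x -> cut u x = 0.
Proof. by move=> Ux; rewrite /cut asboolF. Qed.

Definition mksf u (su : smooth_on U u) : sfun oU :=
  SFun oU (cut_smooth su) (@cut_supp u).

Lemma mksfE u (su : smooth_on U u) x : U x -> mksf su x = u x.
Proof. exact: cutE. Qed.

Lemma smoothD u v : smooth_on U u -> smooth_on U v -> smooth_on U (u + v).
Proof. by move=> /smooth_Cn su /smooth_Cn sv; apply/smooth_Cn => n; exact: CnD. Qed.

Lemma smoothM u v : smooth_on U u -> smooth_on U v -> smooth_on U (u * v).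
Proof. by move=> /smooth_Cn su /smooth_Cn sv; apply/smooth_Cn => n; exact: CnM. Qed.

Lemma smooth_cst (r : R) : smooth_on U (cst r : V -> R).
Proof. by apply/smooth_Cn => n; exact: Cn_cst. Qed.

Lemma smoothV u : (forall x, U x -> u x != 0) -> smooth_on U u ->
  smooth_on U (fun x => (u x)^-1).
Proof. by move=> u0 /smooth_Cn su; apply/smooth_Cn => n; exact: CnV. Qed.

Lemma smooth_sqrt u : (forall x, U x -> 0 < u x) -> smooth_on U u ->
  smooth_on U (fun x => Num.sqrt (u x)).
Proof. by move=> u0 /smooth_Cn su; apply/smooth_Cn => n; exact: Cn_sqrt. Qed.

Definition sfun_cst r := mksf (smooth_cst r).
Definition sfun_add f g := mksf (smoothD (sfun_smooth f) (sfun_smooth g)).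
Definition sfun_mul f g := mksf (smoothM (sfun_smooth f) (sfun_smooth g)).
Definition sfun_opp f := sfun_mul (sfun_cst (-1)) f.

Fact sfun_addA : associative sfun_add.
Proof. by move=> f g k; apply: sfunP => x Ux; rewrite !mksfE// !fctE !mksfE// addrA. Qed.
Fact sfun_addC : commutative sfun_add.
Proof. by move=> f g; apply: sfunP => x Ux; rewrite !mksfE// !fctE addrC. Qed.
Fact sfun_add0 : left_id (sfun_cst 0) sfun_add.
Proof. by move=> f; apply: sfunP => x Ux; rewrite !mksfE// !fctE !mksfE// add0r. Qed.
Fact sfun_addN : left_inverse (sfun_cst 0) sfun_opp sfun_add.
Proof.
move=> f; apply: sfunP => x Ux.
by rewrite !mksfE// !fctE !mksfE// !fctE !mksfE// mulN1r addNr.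
Qed.

HB.instance Definition _ :=
  GRing.isZmodule.Build (sfun oU) sfun_addA sfun_addC sfun_add0 sfun_addN.

Fact sfun_mulA : associative sfun_mul.
Proof. by move=> f g k; apply: sfunP => x Ux; rewrite !mksfE// !fctE !mksfE// mulrA. Qed.
Fact sfun_mulC : commutative sfun_mul.
Proof. by move=> f g; apply: sfunP => x Ux; rewrite !mksfE// !fctE mulrC. Qed.
Fact sfun_mul1 : left_id (sfun_cst 1) sfun_mul.
Proof. by move=> f; apply: sfunP => x Ux; rewrite !mksfE// !fctE !mksfE// mul1r. Qed.
Fact sfun_mulD : left_distributive sfun_mul sfun_add.
Proof.
move=> f g k; apply: sfunP => x Ux.
by rewrite !mksfE// !fctE !mksfE// !fctE mulrDl.
Qed.

HB.instance Definition _ := GRing.Zmodule_isComPzRing.Build (sfun oU)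
  sfun_mulA sfun_mulC sfun_mul1 sfun_mulD.

Lemma sfun0E x : (0 : sfun oU) x = 0.
Proof.
have [Ux|Ux] := pselect (U x); first exact: (mksfE (smooth_cst 0) Ux).
exact: (sfun_supp (0 : sfun oU) Ux).
Qed.

Lemma sfunDE f g x : U x -> (f + g) x = f x + g x.
Proof. exact: mksfE. Qed.

Lemma sfunME f g x : U x -> (f * g) x = f x * g x.
Proof. exact: mksfE. Qed.

Lemma sfunNE f x : U x -> (- f) x = - f x.
Proof. by move=> Ux; rewrite [LHS]mksfE// fctE mksfE// mulN1r. Qed.

Lemma sfun1E x : U x -> (1 : sfun oU) x = 1.
Proof. exact: mksfE. Qed.

(** The proof of [U x] is an argument because outside U evaluation sends 1 to 0 and is no ring
    morphism. *)
Definition evx (x : V) (Ux : U x) f : R := f x.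

Fact evx_zmod x (Ux : U x) : zmod_morphism (evx Ux).
Proof. by move=> f g; rewrite /evx sfunDE// sfunNE. Qed.
Fact evx_monoid x (Ux : U x) : monoid_morphism (evx Ux).
Proof. by split=> [|f g]; rewrite /evx ?sfun1E// sfunME. Qed.

HB.instance Definition _ x (Ux : U x) :=
  GRing.isZmodMorphism.Build (sfun oU) R (evx Ux) (evx_zmod Ux).
HB.instance Definition _ x (Ux : U x) :=
  GRing.isMonoidMorphism.Build (sfun oU) R (evx Ux) (evx_monoid Ux).

Fact sfun_cst_zmod : zmod_morphism sfun_cst.
Proof.
move=> r r'; apply: sfunP => x Ux.
by rewrite sfunDE// sfunNE// !mksfE.
Qed.
Fact sfun_cst_monoid : monoid_morphism sfun_cst.
Proof.
split=> [//|r r']; apply: sfunP => x Ux.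
by rewrite sfunME// !mksfE.
Qed.

HB.instance Definition _ :=
  GRing.isZmodMorphism.Build R (sfun oU) sfun_cst sfun_cst_zmod.
HB.instance Definition _ :=
  GRing.isMonoidMorphism.Build R (sfun oU) sfun_cst sfun_cst_monoid.

Definition sfun_pd a f := mksf (smooth_pderiv a (sfun_smooth f)).

Lemma sfun_pdE a f x : U x -> sfun_pd a f x = pderiv a f x.
Proof. exact: mksfE. Qed.

Let der a f x (Ux : U x) : derivable f x (delta_mx 0 a) :=
  smooth_derivable (sfun_smooth f) Ux.

Fact sfun_pd_zmod a : zmod_morphism (sfun_pd a).
Proof.
move=> f g; apply: sfunP => x Ux; rewrite sfunDE// sfunNE// !sfun_pdE//.
rewrite (eq_pderiv (g := (f : V -> R) - (g : V -> R)) oU a Ux) => [|y Uy].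
  exact: (deriveB (@der a f x Ux) (@der a g x Ux)).
by rewrite sfunDE// sfunNE.
Qed.

HB.instance Definition _ a :=
  GRing.isZmodMorphism.Build (sfun oU) (sfun oU) (sfun_pd a) (sfun_pd_zmod a).

Fact sfun_pdM a f g : sfun_pd a (f * g) = sfun_pd a f * g + f * sfun_pd a g.
Proof.
apply: sfunP => x Ux; rewrite sfunDE// !sfunME// !sfun_pdE//.
rewrite (eq_pderiv (g := (f : V -> R) * (g : V -> R)) oU a Ux) => [|y Uy].
  apply: (etrans (deriveM (@der a f x Ux) (@der a g x Ux))).
  by rewrite addrC; congr (_ + _); exact: mulrC.
by rewrite sfunME.
Qed.

Fact sfun_pd_cst a r : sfun_pd a (sfun_cst r) = 0.
Proof.
apply: sfunP => x Ux; rewrite sfun_pdE// sfun0E.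
rewrite (eq_pderiv (g := cst r) oU a Ux) => [|y Uy]; last by rewrite mksfE.
exact: derive_cst.
Qed.

Fact sfun_pdC a b f : sfun_pd a (sfun_pd b f) = sfun_pd b (sfun_pd a f).
Proof.
refine (sfunP _) => x Ux.
refine (etrans (sfun_pdE a _ Ux) (etrans _ (esym (sfun_pdE b _ Ux)))).
refine (etrans (eq_pderiv oU a Ux (fun y Uy => sfun_pdE b f Uy)) _).
refine (etrans _ (esym (eq_pderiv oU b Ux (fun y Uy => sfun_pdE a f Uy)))).
exact: (pderivC a b oU (sfun_smooth f) Ux).
Qed.

End SmoothRing.

Arguments evx {R d U oU x} Ux f : simpl never.

Definition sfun_alg (R : realType) (d : nat) (U : set 'rV[R]_d) (oU : open U) :
    diffalg R d :=
  @DiffAlg R d (sfun oU) sfun_cst (fun a => sfun_pd a : {additive sfun oU -> sfun oU})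
    (@sfun_pdM R d U oU) (@sfun_pd_cst R d U oU) (@sfun_pdC R d U oU).

Lemma ev_cst (R : realType) (d : nat) (U : set 'rV[R]_d) (oU : open U) x (Ux : U x) (r : R) :
  evx Ux (dcst (sfun_alg oU) r) = r.
Proof. exact: mksfE. Qed.

(** * Local evaluation *)

#[local] Opaque derive sfun_add sfun_mul sfun_opp sfun_cst sfun_pd.

Section PositiveDefinite.
Context {R : realType} {d : nat} (A : 'M[R]_d).
Hypothesis Asym : A^T = A.
Hypothesis Apos : forall v : 'rV_d, v != 0 -> 0 < (v *m A *m v^T) 0 0.

Lemma posdef_unit : A \in unitmx.
Proof.
rewrite -row_free_unit -kermx_eq0; apply/rowV0P => v.
rewrite sub_kermx => /eqP vA; apply/eqP/negPn/negP => /Apos.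
by rewrite vA mul0mx mxE ltxx.
Qed.

(** With w = v A^-1 the value is w A w^T. *)
Lemma posdef_inv (v : 'rV_d) : v != 0 -> 0 < (v *m invmx A *m v^T) 0 0.
Proof.
move=> v0; have wA : v *m invmx A *m A = v by rewrite mulmxKV// posdef_unit.
have w0 : v *m invmx A != 0.
  by apply: contraNneq v0 => w0; rewrite -wA w0 mul0mx.
have := Apos w0; rewrite wA trmx_mul trmx_inv Asym.
suff -> : (v *m (invmx A *m v^T)) = (v *m invmx A *m v^T) by [].
by rewrite mulmxA.
Qed.

End PositiveDefinite.

(** The differential of [s] is nonzero on all of [U], not just at its zeros, which makes 1/|ds| a
    smooth function on [U]. *)
Record local_data (R : realType) (d : nat) (U : set 'rV[R]_d)
    (h : 'rV[R]_d -> 'M[R]_d) (s : 'rV[R]_d -> R) : Prop := LocalData {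
  ld_smooth : forall a b, smooth_on U (fun x => h x a b);
  ld_sym : forall x, U x -> (h x)^T = h x;
  ld_pos : forall x, U x -> forall v : 'rV_d, v != 0 -> 0 < (v *m h x *m v^T) 0 0;
  ld_fun : smooth_on U s;
  ld_neq0 : forall x, U x -> exists a, pderiv a s x != 0
}.

Section Evaluation.
Context {R : realType} {d : nat} {U : set 'rV[R]_d} (oU : open U).
Implicit Types (a b c e : 'I_d) (h : 'rV[R]_d -> 'M[R]_d).
Local Notation A := (sfun_alg oU).
Variables (h : 'rV[R]_d -> 'M[R]_d) (Lh Li : 'M[A]_d).
Hypothesis LhE : forall x, U x -> forall a b, (Lh a b : sfun oU) x = h x a b.
Hypothesis LiE : forall x, U x -> forall a b, (Li a b : sfun oU) x = invmx (h x) a b.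


Lemma evB (f g : A) x (Ux : U x) : evx Ux (f - g) = evx Ux f - evx Ux g.
Proof. exact: rmorphB. Qed.

Lemma evD (f g : A) x (Ux : U x) : evx Ux (f + g) = evx Ux f + evx Ux g.
Proof. exact: rmorphD. Qed.

Lemma evM (f g : A) x (Ux : U x) : evx Ux (f * g) = evx Ux f * evx Ux g.
Proof. exact: rmorphM. Qed.

Lemma ev1 x (Ux : U x) : evx Ux (1 : A) = 1.
Proof. exact: rmorph1. Qed.

Lemma ev_pd a (f : A) x (Ux : U x) : evx Ux (pd a f) = pderiv a (f : sfun oU) x.
Proof. exact: sfun_pdE. Qed.

Lemma ev_pd_eq a (f : A) (u : 'rV[R]_d -> R) x (Ux : U x) :
  (forall y, U y -> (f : sfun oU) y = u y) -> evx Ux (pd a f) = pderiv a u x.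
Proof.
move=> fu; refine (etrans (ev_pd a f Ux) _).
by refine (eq_pderiv oU a Ux fu).
Qed.

Lemma ev_dgrad (f g : A) (u v : 'rV[R]_d -> R) x (Ux : U x) :
  (forall y, U y -> (f : sfun oU) y = u y) ->
  (forall y, U y -> (g : sfun oU) y = v y) ->
  evx Ux (dgrad Li f g) =
  \sum_a \sum_b invmx (h x) a b * pderiv a u x * pderiv b v x.
Proof.
move=> fu gv; rewrite rmorph_sum; apply: eq_bigr => a _.
rewrite rmorph_sum; apply: eq_bigr => b _.
by rewrite !rmorphM /= (ev_pd_eq a Ux fu) (ev_pd_eq b Ux gv) /evx LiE.
Qed.

Lemma ev_conn a b c x (Ux : U x) :
  evx Ux (conn Lh Li a b c) = christoffel h c a b x.
Proof.
rewrite mxE rmorphM rmorph_sum; congr (_ * _); first exact: ev_cst.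
apply: eq_bigr => e _; rewrite rmorphM rmorphB rmorphD /=.
rewrite (ev_pd_eq a (u := fun y => h y b e) Ux) => [|y Uy]; last exact: LhE.
rewrite (ev_pd_eq b (u := fun y => h y a e) Ux) => [|y Uy]; last exact: LhE.
rewrite (ev_pd_eq e (u := fun y => h y a b) Ux) => [|y Uy]; last exact: LhE.
by rewrite /evx LiE.
Qed.

Lemma ev_ric_gen (G : 'I_d -> 'M[A]_d) (gam : 'I_d -> 'I_d -> 'I_d -> 'rV[R]_d -> R)
    a b x (Ux : U x) :
  (forall a b c y, U y -> (G a b c : sfun oU) y = gam c a b y) ->
  evx Ux (ric G a b) = \sum_c (pderiv c (gam c a b) x - pderiv a (gam c c b) x
     + \sum_e (gam c c e x * gam e a b x - gam c a e x * gam e c b x)).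
Proof.
move=> E; rewrite mxE rmorph_sum; apply: eq_bigr => c _.
rewrite rmorphD rmorphB rmorph_sum /=.
rewrite (ev_pd_eq c Ux (E a b c)) (ev_pd_eq a Ux (E c b c)); congr (_ + _).
by apply: eq_bigr => e _; rewrite rmorphB !rmorphM /= /evx !E.
Qed.

Lemma ev_ric a b x (Ux : U x) : evx Ux (ric (conn Lh Li) a b) = ricci h a b x.
Proof. by apply: ev_ric_gen => a' b' c' y Uy; exact: (ev_conn a' b' c' Uy). Qed.

Lemma ev_scal x (Ux : U x) : evx Ux (dscal Lh Li) = scal h x.
Proof.
rewrite rmorph_sum; apply: eq_bigr => a _; rewrite rmorph_sum.
by apply: eq_bigr => b _; rewrite rmorphM /= ev_ric /evx LiE.
Qed.

Lemma ev_hess_gen (G : 'I_d -> 'M[A]_d) (gam : 'I_d -> 'I_d -> 'I_d -> 'rV[R]_d -> R)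
    (f : A) (u : 'rV[R]_d -> R) a b x (Ux : U x) :
  (forall a b c y, U y -> (G a b c : sfun oU) y = gam c a b y) ->
  (forall y, U y -> (f : sfun oU) y = u y) ->
  evx Ux (hess G f a b) =
  pderiv a (pderiv b u) x - \sum_c gam c a b x * pderiv c u x.
Proof.
move=> E fu; rewrite mxE rmorphB rmorph_sum /=.
rewrite (ev_pd_eq a Ux (fun y Uy => ev_pd_eq b Uy fu)); congr (_ - _).
by apply: eq_bigr => c _; rewrite rmorphM /= (ev_pd_eq c Ux fu) /evx E.
Qed.

Lemma ev_lap (f : A) (u : 'rV[R]_d -> R) x (Ux : U x) :
  (forall y, U y -> (f : sfun oU) y = u y) ->
  evx Ux (dlap Lh Li f) = laplacian h u x.
Proof.
move=> fu; rewrite rmorph_sum; apply: eq_bigr => a _; rewrite rmorph_sum.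
apply: eq_bigr => b _; rewrite rmorphM /=; congr (_ * _); first exact: LiE.
by apply: ev_hess_gen => // a' b' c' y Uy; exact: (ev_conn a' b' c' Uy).
Qed.

Lemma ev_disq (f : A) (u : 'rV[R]_d -> R) x (Ux : U x) :
  (forall y, U y -> (f : sfun oU) y = u y) ->
  evx Ux (disq Lh Li f) = Isq h u x.
Proof.
move=> fu.
have morph (p q t r j k : A) : evx Ux (p - q * t * (r + j * k * t)) =
    evx Ux p - evx Ux q * evx Ux t * (evx Ux r + evx Ux j * evx Ux k * evx Ux t).
  by rewrite !(rmorphB, rmorphM, rmorphD).
have fx : evx Ux f = u x by exact: fu.
rewrite morph !ev_cst (ev_dgrad Ux fu fu) (ev_lap Ux fu) ev_scal fx.
by rewrite /Isq /grad_sqnorm /Jtrace [_^-1 * _]mulrC.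
Qed.

End Evaluation.

Section LocalJets.
Context {R : realType} {d : nat}.

Definition local_jet (h : 'rV[R]_d -> 'M[R]_d) (s : 'rV[R]_d -> R) x
    (v : @jet_var d) : R :=
  match v with
  | MetricJet a b l => pderivs l (fun y => h y a b) x
  | InvDet => (\det (h x))^-1
  | FunctionJet l => pderivs l s x
  | InvNorm => (Num.sqrt (grad_sqnorm h s x))^-1
  | VolumeForm _ => 0
  end.

Fixpoint jexpr_eval (val : @jet_var d -> R) (e : @jexpr R d) : R :=
  match e with
  | JConst r => r
  | JMetric a b l => val (MetricJet a b l)
  | JInvDet => val InvDet
  | JFun l => val (FunctionJet l)
  | JInvNorm => val InvNorm
  | JAdd e1 e2 => jexpr_eval val e1 + jexpr_eval val e2
  | JMul e1 e2 => jexpr_eval val e1 * jexpr_eval val e2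
  end.

Variables (U : set 'rV[R]_d) (oU : open U).
Variables (h : 'rV[R]_d -> 'M[R]_d) (s : 'rV[R]_d -> R).
Hypothesis H : local_data U h s.
Local Notation A := (sfun_alg oU).

Definition loc_h : 'M[A]_d := \matrix_(a, b) (mksf (oU := oU) (ld_smooth H a b)).

Lemma loc_hE x : U x -> forall a b, (loc_h a b : sfun oU) x = h x a b.
Proof. by move=> Ux a b; rewrite mxE; exact: mksfE. Qed.

Lemma loc_h_map x (Ux : U x) : map_mx (evx Ux) loc_h = h x.
Proof. by apply/matrixP => a b; rewrite mxE; exact: loc_hE. Qed.

Lemma loc_detE x : U x -> (\det loc_h : sfun oU) x = \det (h x).
Proof. by move=> Ux; rewrite -(loc_h_map Ux) det_map_mx. Qed.

Lemma loc_unit x : U x -> h x \in unitmx.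
Proof. by move=> Ux; exact: posdef_unit (ld_pos H Ux). Qed.

Lemma loc_det_neq0 x : U x -> \det (h x) != 0.
Proof. by move=> /loc_unit; rewrite unitmxE unitfE. Qed.

Lemma loc_det_smooth : smooth_on U (fun x => \det (h x)).
Proof. exact: (smooth_ext oU loc_detE (sfun_smooth (\det loc_h : sfun oU))). Qed.

Definition loc_w : A := mksf (oU := oU) (smoothV (oU := oU) loc_det_neq0 loc_det_smooth).

Definition loc_hi : 'M[A]_d := loc_w *: \adj loc_h.

Lemma loc_hiE x : U x -> forall a b, (loc_hi a b : sfun oU) x = invmx (h x) a b.
Proof.
move=> Ux a b; rewrite mxE /invmx loc_unit// [RHS]mxE -(loc_h_map Ux) -map_mx_adj.
rewrite [in RHS]mxE -[LHS]/(evx Ux _) rmorphM /=; congr (_ * _).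
by rewrite loc_h_map; exact: mksfE.
Qed.

Definition loc_s : A := mksf (oU := oU) (ld_fun H).

Lemma loc_sE x : U x -> (loc_s : sfun oU) x = s x.
Proof. exact: mksfE. Qed.

Lemma loc_normE x : U x -> (dgrad loc_hi loc_s loc_s : sfun oU) x = grad_sqnorm h s x.
Proof. by move=> Ux; exact: (ev_dgrad loc_hiE Ux loc_sE loc_sE). Qed.

Lemma loc_norm_gt0 x : U x -> 0 < grad_sqnorm h s x.
Proof.
move=> Ux; pose v : 'rV_d := \row_a pderiv a s x.
have [a sa] := ld_neq0 H Ux.
have v0 : v != 0 by apply: contraNneq sa => /rowP /(_ a); rewrite !mxE => ->.
have := posdef_inv (ld_sym H Ux) (ld_pos H Ux) v0.
suff -> : grad_sqnorm h s x = (v *m invmx (h x) *m v^T) 0 0 by [].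
rewrite mxE /grad_sqnorm exchange_big; apply: eq_bigr => b _.
rewrite !mxE mulr_suml; apply: eq_bigr => c _; rewrite !mxE.
by rewrite [pderiv c s x * _]mulrC.
Qed.

Lemma loc_norm_smooth : smooth_on U (grad_sqnorm h s).
Proof.
exact: (smooth_ext oU loc_normE (sfun_smooth (dgrad loc_hi loc_s loc_s : sfun oU))).
Qed.

Lemma loc_sqrt_neq0 x : U x -> Num.sqrt (grad_sqnorm h s x) != 0.
Proof. by move=> Ux; rewrite gt_eqF// sqrtr_gt0 loc_norm_gt0. Qed.

Definition loc_n : A := mksf (oU := oU)
  (smoothV (oU := oU) loc_sqrt_neq0 (smooth_sqrt (oU := oU) loc_norm_gt0 loc_norm_smooth)).

Lemma loc_nE x : U x -> (loc_n : sfun oU) x = (Num.sqrt (grad_sqnorm h s x))^-1.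
Proof. exact: mksfE. Qed.

Fact loc_sym : loc_h^T = loc_h.
Proof.
apply/matrixP => a b; refine (sfunP _) => x Ux.
by rewrite [in LHS]mxE !loc_hE// -[in RHS](ld_sym H Ux) mxE.
Qed.

Fact loc_w_det : loc_w * \det loc_h = 1.
Proof.
refine (sfunP _) => x Ux; refine (etrans (sfunME _ _ Ux) _).
by rewrite loc_detE// mksfE// mulVf ?loc_det_neq0// sfun1E.
Qed.

Fact loc_norm : loc_n ^+ 2 * dgrad loc_hi loc_s loc_s = 1.
Proof.
refine (sfunP _) => x Ux; refine (etrans (sfunME _ _ Ux) _).
rewrite loc_normE// expr2 sfunME// loc_nE// -invfM -expr2 sqr_sqrtr.
  by rewrite mulVf ?sfun1E// gt_eqF// loc_norm_gt0.
by rewrite ltW// loc_norm_gt0.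
Qed.

Definition jet_of : jetdata R d := JetData loc_sym loc_w_det loc_norm.

Lemma ev_pds l (f : A) (u : 'rV[R]_d -> R) x (Ux : U x) :
  (forall y, U y -> (f : sfun oU) y = u y) ->
  evx Ux (pds (S := jet_of) l f) = pderivs l u x.
Proof.
move=> fu; elim: l x Ux => [|a l IH] x Ux; first exact: fu.
exact: (ev_pd_eq (oU := oU) a Ux (fun y Uy => IH y Uy)).
Qed.

Lemma ev_jeval e x (Ux : U x) :
  evx Ux (jeval jet_of e : sfun oU) = jexpr_eval (local_jet h s x) e.
Proof.
elim: e => [r|a b l||l||e1 IH1 e2 IH2|e1 IH1 e2 IH2].
- exact: ev_cst.
- by apply: ev_pds => y Uy; exact: loc_hE.
- exact: mksfE.
- by apply: ev_pds => y Uy; exact: loc_sE.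
- exact: mksfE.
- by rewrite rmorphD /= IH1 IH2.
- by rewrite rmorphM /= IH1 IH2.
Qed.

End LocalJets.

(** A choice made once for each [R] and [d], before any manifold, chart or point; the universal
    polynomial comes from it. *)
Definition obstruction_expr (R : realType) (d : nat) : @jexpr R d :=
  sval (cid (@uniform_obstruction R d).1).

(** Depends on the jets at [x] and on no open set, so that rings over different open sets compute
    the same number. *)
Definition obstruction_value (R : realType) (d : nat)
    (h : 'rV[R]_d -> 'M[R]_d) (s : 'rV[R]_d -> R) x : R :=
  jexpr_eval (local_jet h s x) (obstruction_expr R d).

Lemma obstruction_valueE (R : realType) (d : nat) (U : set 'rV[R]_d) (oU : open U)
    (h : 'rV[R]_d -> 'M[R]_d) (s : 'rV[R]_d -> R) (H : local_data U h s) x :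
  U x -> obstruction_value h s x = (jet_obstruction (jet_of oU H) : sfun oU) x.
Proof.
move=> Ux; rewrite /obstruction_value -(ev_jeval oU H _ Ux) /obstruction_expr.
by case: (cid _) => e He; rewrite -[LHS]/(evx Ux _) -He.
Qed.

(** * Characterization of the obstruction by uniqueness *)

Section Uniqueness.
Context {R : realType} {d : nat} (U : set 'rV[R]_d) (oU : open U).
Variables (h : 'rV[R]_d -> 'M[R]_d) (s : 'rV[R]_d -> R).
Hypothesis H : local_data U h s.
Hypothesis d1 : (1 < d)%N.
Local Notation A := (sfun_alg oU).
Let Lh : 'M[A]_d := loc_h oU H.
Let Li : 'M[A]_d := loc_hi oU H.
Let Ls : A := loc_s oU H.
Let Ln : A := loc_n oU H.

Definition vanish_on (f : A) : Prop := forall y, U y -> s y = 0 -> (f : sfun oU) y = 0.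

Lemma vanish_on0 : vanish_on 0.
Proof. by move=> y _ _; exact: sfun0E. Qed.

Lemma vanish_onD f g : vanish_on f -> vanish_on g -> vanish_on (f + g).
Proof.
move=> f0 g0 y Uy sy; refine (etrans (sfunDE _ _ Uy) _).
by rewrite f0// g0// addr0.
Qed.

Lemma vanish_onM f g : vanish_on g -> vanish_on (f * g).
Proof.
move=> g0 y Uy sy; refine (etrans (sfunME _ _ Uy) _).
by rewrite g0// mulr0.
Qed.

Lemma ev_loc_s a y (Uy : U y) : evx Uy (pd a Ls) = pderiv a s y.
Proof. exact: (ev_pd_eq a Uy (loc_sE oU H)). Qed.

Lemma vanish_on_tangential : tangential vanish_on Ls.
Proof.
move=> f a b f0 y Uy sy.
have Ea := ev_loc_s a Uy; have Eb := ev_loc_s b Uy.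
move: (pd a Ls) (pd b Ls) Ea Eb => p q Ea Eb; refine (etrans (evB _ _ Uy) _).
rewrite !evM Ea Eb (ev_pd a f) (ev_pd b f).
apply/eqP; rewrite subr_eq0; apply/eqP.
apply: (tangential_derivatives _ _ oU (sfun_smooth (f : sfun oU)) (ld_fun H) Uy sy).
  exact: ld_neq0 H _ Uy.
exact: f0.
Qed.

Lemma vanish_on_s : vanish_on Ls.
Proof. by move=> y Uy sy; refine (etrans (loc_sE oU H Uy) sy). Qed.

(** Hides the iteration and keeps what uniqueness uses. All corrections to s/|ds| have order 2, so
    they leave its differential on the hypersurface unchanged. *)
Lemma canonical_density : exists u B : A, [/\ normalized vanish_on Li u,
  forall y (Uy : U y) a, s y = 0 ->
    evx Uy (pd a u) = (Num.sqrt (grad_sqnorm h s y))^-1 * pderiv a s y,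
  vanish vanish_on d.+1 (disq Lh Li u - 1 - u ^+ d * B) &
  forall y, U y -> (B : sfun oU) y = obstruction_value h s y].
Proof.
have [un u2 uI] := @jet_obstructionP _ _ (jet_of oU H) vanish_on vanish_on0
  vanish_onD vanish_onM vanish_on_s vanish_on_tangential d1.
exists (approx (jet_of oU H) d.-1), (jet_obstruction (jet_of oU H)); split=> //.
  move: (approx _ _) u2 => u; change (vanish vanish_on 2 (u - Ls * Ln : A) ->
    forall y (Uy : U y) a, s y = 0 -> evx Uy (pd a (u : A)) =
      (Num.sqrt (grad_sqnorm h s y))^-1 * pderiv a s y) => -[_ +] y Uy a sy.
  move=> /(_ a) [v _].
  have E : evx Uy (pd a (u : A)) - evx Uy (pd a (Ls * Ln)) = 0.
    by rewrite -evB -raddfB; exact: v.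
  move/eqP: E; rewrite subr_eq0 => /eqP ->; rewrite pdM evD !evM ev_loc_s.
  have -> : evx Uy Ls = 0 by exact: vanish_on_s.
  by rewrite mul0r addr0 mulrC; congr (_ * _); exact: loc_nE.
by move=> y Uy; rewrite (obstruction_valueE oU H Uy).
Qed.

Let pairH : metric_pair Lh Li := jet_metric_pair (jet_of oU H).

(** The common source of independence of [s], of the conformal weight and of the agreement with the
    obstruction density: each of them supplies a suitable pair [sigma], [B]. *)
Lemma obstruction_value_unique (sigma B : A) :
  vanish_on sigma ->
  (forall y (Uy : U y), s y = 0 -> exists2 lambda : R, 0 < lambda &
    forall a, evx Uy (pd a sigma) = lambda * pderiv a s y) ->
  vanish vanish_on d.+1 (disq Lh Li sigma - 1 - sigma ^+ d * B) ->
  forall y, U y -> s y = 0 -> (B : sfun oU) y = obstruction_value h s y.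
Proof.
move=> sig0 sigpd sigI y Uy sy.
have [u [P [un updE uI PE]]] := canonical_density; rewrite -PE//.
have [u0 _ _] := un.
have w2 : vanish vanish_on 2 (sigma - u).
  split.
    by apply: vanish_onD => //; rewrite -mulN1r; exact: vanish_onM.
  move=> a; apply/(vanish1 vanish_on) => z Uz sz.
  rewrite (raddfB (pd a)); refine (etrans (evB _ _ Uz) _); rewrite (updE z Uz a sz).
  have [lam lam0 lamE] := sigpd z Uz sz.
  have N0 := loc_norm_gt0 H Uz.
  (* On the hypersurface the equation reduces to lam^2 |ds|^2 = 1, and positivity of lam selects the
     root; this is where the orientation is used. *)
  suff -> : (Num.sqrt (grad_sqnorm h s z))^-1 = lam by rewrite lamE subrr.
  have : evx Uz (disq Lh Li sigma - 1 - sigma ^+ d * B) = 0.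
    by case: sigI => + _; apply.
  have sz0 : evx Uz sigma = 0 by exact: sig0.
  have -> : disq Lh Li sigma - 1 - sigma ^+ d * B =
     dgrad Li sigma sigma - 1 - (dcst A (2 / d%:R) *
     (dlap Lh Li sigma + djtrace Lh Li * sigma) +
      sigma ^+ d.-1 * B) * sigma.
    rewrite /disq; have -> : sigma ^+ d = sigma * sigma ^+ d.-1.
      by rewrite -exprS prednK// ltnW.
    ring.
  rewrite evB evM sz0 mulr0 subr0 evB ev1.
  rewrite (ev_dgrad (loc_hiE oU H) Uz (u := sigma : sfun oU) (v := sigma : sfun oU))//.
  have -> : \sum_a \sum_b invmx (h z) a b * pderiv a (sigma : sfun oU) z *
      pderiv b (sigma : sfun oU) z = lam ^+ 2 * grad_sqnorm h s z.
    rewrite mulr_sumr; apply: eq_bigr => b _; rewrite mulr_sumr.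
    apply: eq_bigr => c _; have := lamE b; have := lamE c; rewrite !ev_pd => -> ->.
    by move: (invmx _ _ _) (pderiv b s z) (pderiv c s z) => p q r; ring.
  move/eqP; rewrite subr_eq0 => /eqP E.
  have E2 : lam * Num.sqrt (grad_sqnorm h s z) = 1.
    apply: (pexpIrn (n := 2)) => //; rewrite ?nnegrE ?mulr_ge0 ?sqrtr_ge0// ?ltW//.
    by rewrite exprMn sqr_sqrtr ?ltW// E expr1n.
  have q0 := loc_sqrt_neq0 H Uz.
  by rewrite -[LHS]mul1r -E2 mulfK.
have sE : sigma = u + (sigma - u) by rewrite addrC subrK.
rewrite sE in sigI.
have D := obstruction_unique vanish_on0 vanish_onD vanish_onM pairH
  d1 un w2 uI sigI.
have E : evx Uy P - evx Uy B = 0 by rewrite -evB; exact: D.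
by move/eqP: E; rewrite subr_eq0 => /eqP.
Qed.

End Uniqueness.

Lemma vanish_mono (R : numFieldType) (d : nat) (A : diffalg R d) (I I' : A -> Prop) :
  (forall f, I f -> I' f) -> forall k f, vanish I k f -> vanish I' k f.
Proof.
move=> II; elim=> // k IH f [f0 fk]; split; first exact: II.
by move=> a; apply: IH; exact: fk.
Qed.

Section SameMetric.
Context {R : realType} {d : nat} (U : set 'rV[R]_d) (oU : open U).
Variables (h : 'rV[R]_d -> 'M[R]_d) (s : 'rV[R]_d -> R).
Hypothesis H : local_data U h s.
Hypothesis d1 : (1 < d)%N.

(** The solution built from [s'] also solves the problem for [s]; orders of vanishing carry over
    because the zero sets in [U] coincide. *)
Lemma obstruction_value_defining s' (H' : local_data U h s') :
  (forall x, U x -> (s x = 0 <-> s' x = 0)) ->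
  (forall x, U x -> s x = 0 -> exists2 lambda : R, 0 < lambda &
    forall a, pderiv a s' x = lambda * pderiv a s x) ->
  forall x, U x -> s x = 0 -> obstruction_value h s x = obstruction_value h s' x.
Proof.
move=> ss' conormal x Ux sx.
have [u [P [un updE uI PE]]] := canonical_density oU H' d1; rewrite -PE//.
have EL : loc_h oU H = loc_h oU H'.
  apply/matrixP => a b; refine (sfunP _) => y Uy.
  by refine (etrans (loc_hE oU H Uy a b) (esym (loc_hE oU H' Uy a b))).
have Ei : loc_hi oU H = loc_hi oU H'.
  apply/matrixP => a b; refine (sfunP _) => y Uy.
  by refine (etrans (loc_hiE oU H Uy a b) (esym (loc_hiE oU H' Uy a b))).
refine (esym (obstruction_value_unique (H := H) d1 (sigma := u) _ _ _ Ux sx)).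
- by have [u0 _ _] := un; move=> y Uy sy; exact: (u0 y Uy ((ss' y Uy).1 sy)).
- move=> y Uy sy; have [lam lam0 lamE] := conormal y Uy sy.
  exists ((Num.sqrt (grad_sqnorm h s' y))^-1 * lam).
    apply: (mulr_gt0 _ lam0); rewrite invr_gt0 sqrtr_gt0; exact: (loc_norm_gt0 H' Uy).
  by move=> a; rewrite (updE y Uy a ((ss' y Uy).1 sy)) lamE mulrA.
rewrite EL Ei; apply: vanish_mono uI => f f0 y Uy sy.
exact: (f0 y Uy ((ss' y Uy).1 sy)).
Qed.

Lemma obstruction_value_density (sigma B : 'rV[R]_d -> R) :
  smooth_on U sigma -> smooth_on U B ->
  (forall x, U x -> s x = 0 -> sigma x = 0) ->
  (forall x, U x -> s x = 0 -> exists2 lambda : R, 0 < lambda &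
    forall a, pderiv a sigma x = lambda * pderiv a s x) ->
  (forall x, U x -> Isq h sigma x = 1 + sigma x ^+ d * B x) ->
  forall x, U x -> s x = 0 -> B x = obstruction_value h s x.
Proof.
move=> ssig sB sig0 conormal IsqE x Ux sx.
pose sg : sfun_alg oU := mksf (oU := oU) ssig.
pose Bg : sfun_alg oU := mksf (oU := oU) sB.
have sgE y : U y -> (sg : sfun oU) y = sigma y by exact: mksfE.
have BgE y : U y -> (Bg : sfun oU) y = B y by exact: mksfE.
rewrite -BgE//.
refine (obstruction_value_unique (H := H) d1 (sigma := sg) _ _ _ Ux sx).
- by move=> y Uy sy; rewrite sgE// sig0.
- move=> y Uy sy; have [lam lam0 lamE] := conormal y Uy sy; exists lam => // a.
  by rewrite -lamE; exact: (ev_pd_eq a Uy sgE).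
have -> : disq (loc_h oU H) (loc_hi oU H) sg = 1 + sg ^+ d * Bg.
  refine (sfunP _) => y Uy.
  refine (etrans (ev_disq (loc_hE oU H) (loc_hiE oU H) Uy sgE) _).
  rewrite IsqE// -[RHS]/(evx Uy _) evD ev1 evM; congr (_ + _ * _).
    by rewrite rmorphXn /=; congr (_ ^+ _); rewrite -sgE.
  by rewrite -BgE.
by rewrite addrAC addrK subrr; exact: (vanish0 (@vanish_on0 _ _ _ oU s)).
Qed.

End SameMetric.

Section Rescaling.
Context {R : realType} {d : nat} (U : set 'rV[R]_d) (oU : open U).
Variables (h h' : 'rV[R]_d -> 'M[R]_d) (s Om : 'rV[R]_d -> R).
Hypothesis H : local_data U h s.
Hypothesis H' : local_data U h' s.
Hypothesis d1 : (1 < d)%N.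
Hypothesis sOm : smooth_on U Om.
Hypothesis Om0 : forall x, U x -> 0 < Om x.
Hypothesis h'E : forall x, U x -> h' x = Om x ^+ 2 *: h x.

(** If [u] solves the problem for [h] with obstruction P, then Om u solves it for Om^2 h with Om^-d
    P: I^2 is unchanged, and the powers of Om cancel in (Om u)^d Om^-d P. *)
Lemma obstruction_value_rescaled x : U x -> s x = 0 ->
  obstruction_value h' s x = (Om x)^-1 ^+ d * obstruction_value h s x.
Proof.
move=> Ux sx.
have Om_neq0 y : U y -> Om y != 0 by move=> /Om0 /gt_eqF ->.
pose O : sfun_alg oU := mksf (oU := oU) sOm.
pose Oi : sfun_alg oU := mksf (oU := oU) (smoothV (oU := oU) Om_neq0 sOm).
have OK : O * Oi = 1.
  refine (sfunP _) => y Uy; refine (etrans (sfunME _ _ Uy) _).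
  refine (etrans (congr2 *%R (mksfE _ Uy) (mksfE _ Uy)) (esym (etrans (sfun1E Uy) _))).
  by rewrite mulfV// Om_neq0.
have mp := jet_metric_pair (jet_of oU H).
have mp' := jet_metric_pair (jet_of oU H').
have cp := conformal_pair mp OK.
have hE : loc_h oU H' = O ^+ 2 *: loc_h oU H.
  apply/matrixP => a b; refine (sfunP _) => y Uy.
  refine (etrans (loc_hE oU H' Uy a b) _); rewrite (h'E Uy) mxE [in RHS]mxE.
  refine (esym (etrans (sfunME _ _ Uy) _)); congr (_ * _); last exact: loc_hE.
  rewrite expr2; refine (etrans (sfunME _ _ Uy) _).
  by rewrite expr2; congr (_ * _); exact: mksfE.
have hiE : loc_hi oU H' = Oi ^+ 2 *: loc_hi oU H.
  have [_ _ hih'] := mp'; have [_ hhi _] := cp.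
  rewrite -[LHS]mulmx1 -hhi mulmxA.
  have -> : O ^+ 2 *: jh (jet_of oU H) = loc_h oU H' by rewrite hE.
  have -> : loc_hi oU H' *m loc_h oU H' = 1%:M by exact: hih'.
  by rewrite mul1mx.
have [u [P [un updE uI PE]]] := canonical_density oU H d1; have [u0 _ _] := un.
have OE y (Uy : U y) : evx Uy O = Om y by exact: mksfE.
have -> : (Om x)^-1 ^+ d * obstruction_value h s x = (Oi ^+ d * P : sfun_alg oU) x.
  rewrite -[RHS]/(evx Ux _) evM rmorphXn -PE//; congr (_ ^+ _ * _).
  by apply/esym; exact: mksfE.
refine (esym (obstruction_value_unique (H := H') d1 (sigma := O * u) _ _ _ Ux sx)).
- exact: (vanish_onM _ u0).
- move=> y Uy sy; exists (Om y * (Num.sqrt (grad_sqnorm h s y))^-1).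
    apply: mulr_gt0; first exact: Om0.
    by rewrite invr_gt0 sqrtr_gt0; exact: (loc_norm_gt0 H Uy).
  move=> a; rewrite pdM evD !evM (updE y Uy a sy) OE.
  have -> : evx Uy u = 0 by exact: u0.
  by rewrite mulr0 add0r mulrA.
rewrite hE hiE (disq_conformal mp OK u d1).
have -> : (O * u) ^+ d * (Oi ^+ d * P) = u ^+ d * P.
  rewrite exprMn mulrACA -exprMn OK expr1n mul1r //.
exact: uI.
Qed.

End Rescaling.

Section Pullback.
Context {R : realType} {d : nat} (U U' : set 'rV[R]_d) (oU : open U) (oU' : open U').
Variables (F : 'rV[R]_d -> 'rV[R]_d).
Hypothesis sF : smooth_map_on U F.
Hypothesis UF : forall x, U x -> U' (F x).

Lemma smooth_comp f : smooth_on U' f -> smooth_on U (f \o F).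
Proof.
move=> /smooth_Cn sf; apply/smooth_Cn => n; apply: (Cn_comp oU oU' UF) => // b.
by have /smooth_Cn := sF b; apply.
Qed.

Lemma pderiv_comp f a x : smooth_on U' f -> U x -> pderiv a (f \o F) x =
  \sum_b pderiv a (fun y => F y 0 b) x * pderiv b f (F x).
Proof.
move=> sf Ux; have [df dfE] := smooth_differentiable oU' sf (UF Ux).
have [|_ E] := derive_chain (F := F) (v := delta_mx 0 a) (x := x) _ df dfE.
  by move=> b; exact: smooth_derivable (sF b) Ux.
exact: E.
Qed.

Definition comp_sfun (f : sfun oU') : sfun oU :=
  mksf (oU := oU) (smooth_comp (sfun_smooth f)).

Lemma comp_sfunE f x : U x -> comp_sfun f x = f (F x).
Proof. exact: mksfE. Qed.

Fact comp_sfun_zmod : zmod_morphism comp_sfun.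
Proof.
move=> f g; refine (sfunP _) => x Ux.
by rewrite sfunDE// sfunNE// !comp_sfunE// sfunDE ?sfunNE//; exact: UF.
Qed.

Fact comp_sfun_monoid : monoid_morphism comp_sfun.
Proof.
split=> [|f g]; refine (sfunP _) => x Ux.
  by rewrite comp_sfunE// !sfun1E//; exact: UF.
by rewrite sfunME// !comp_sfunE// sfunME//; exact: UF.
Qed.

HB.instance Definition _ :=
  GRing.isZmodMorphism.Build (sfun oU') (sfun oU) comp_sfun comp_sfun_zmod.
HB.instance Definition _ :=
  GRing.isMonoidMorphism.Build (sfun oU') (sfun oU) comp_sfun comp_sfun_monoid.

Variables (h h' : 'rV[R]_d -> 'M[R]_d) (s s' : 'rV[R]_d -> R).
Hypothesis H : local_data U h s.
Hypothesis H' : local_data U' h' s'.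
Hypothesis h_pull : forall x, U x ->
  h x = jacobian F x *m h' (F x) *m (jacobian F x)^T.
Hypothesis s_pull : forall x, U x -> s x = s' (F x).

Let J : 'M[sfun_alg oU]_d :=
  \matrix_(a, b) (mksf (oU := oU) (smooth_pderiv a (sF b))).
Let phi : {rmorphism sfun_alg oU' -> sfun_alg oU} := comp_sfun.

Let JE a b x : U x -> (J a b : sfun oU) x = pderiv a (fun y => F y 0 b) x.
Proof. by move=> Ux; rewrite mxE; exact: mksfE. Qed.

Lemma obstruction_value_pullback x : U x ->
  obstruction_value h s x = obstruction_value h' s' (F x).
Proof.
move=> Ux; rewrite (obstruction_valueE oU H Ux) (obstruction_valueE oU' H' (UF Ux)).
have phi_cst r : phi (dcst (sfun_alg oU') r) = dcst (sfun_alg oU) r.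
  refine (sfunP _) => y Uy; refine (etrans (comp_sfunE _ Uy) _).
  by refine (etrans (ev_cst oU' (UF Uy) r) (esym (ev_cst oU Uy r))).
have phi_pd a f : pd a (phi f) = \sum_b J a b * phi (pd b f).
  refine (sfunP _) => y Uy; rewrite -[RHS]/(evx Uy _) rmorph_sum /=.
  refine (etrans (ev_pd_eq (oU := oU) (u := (f : sfun oU') \o F) a Uy _) _).
    by move=> z Uz; exact: comp_sfunE.
  rewrite pderiv_comp//; last exact: sfun_smooth.
  apply: eq_bigr => b _; rewrite rmorphM /=; congr (_ * _).
    by apply/esym; exact: JE.
  apply/esym; refine (etrans (comp_sfunE _ Uy) _).
  exact: (ev_pd b _ (UF Uy)).
have J_closed a b c : pd a (J b c) = pd b (J a c).
  refine (sfunP _) => y Uy.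
  refine (etrans (ev_pd_eq (oU := oU) a Uy (JE b c)) _).
  refine (etrans _ (esym (ev_pd_eq (oU := oU) b Uy (JE a c)))).
  exact: (pderivC a b oU (sF c) Uy).
have hE : loc_h oU H = J *m map_mx phi (loc_h oU' H') *m J^T.
  have JxE y (Uy : U y) : map_mx (evx Uy) J = jacobian F y.
    apply/matrixP => a b; rewrite mxE (smooth_jacobian a b oU sF Uy); exact: JE.
  have hxE y (Uy : U y) : map_mx (evx Uy) (map_mx phi (loc_h oU' H')) = h' (F y).
    apply/matrixP => a b; rewrite !mxE.
    refine (etrans (comp_sfunE _ Uy) _).
    by refine (mksfE _ (UF Uy)).
  apply/matrixP => a b; refine (sfunP _) => y Uy; rewrite loc_hE// h_pull//.
  rewrite -(JxE y Uy) -(hxE y Uy) map_trmx -!map_mxM mxE; reflexivity.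
have [_ hhi _] := jet_metric_pair (jet_of oU H).
(* The inverse Jacobian is read off from the pullback equation: J times this product is h h^-1. *)
pose K := map_mx phi (loc_h oU' H') *m J^T *m loc_hi oU H.
have JK : J *m K = 1%:M.
  by rewrite /K !mulmxA -hE; exact: hhi.
have KJ := mulmx1C JK.
have sE : loc_s oU H = phi (loc_s oU' H').
  refine (sfunP _) => y Uy; rewrite loc_sE// s_pull//.
  by refine (esym (etrans (comp_sfunE _ Uy) _)); exact: (loc_sE oU' H' (UF Uy)).
have nE : loc_n oU H = phi (loc_n oU' H').
  refine (sfunP _) => y Uy; rewrite loc_nE//.
  refine (esym (etrans (comp_sfunE _ Uy) _)).
  refine (etrans (loc_nE oU' H' (UF Uy)) _); congr ((Num.sqrt _)^-1).
  rewrite -(loc_normE oU H Uy) sE.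
  rewrite (dgrad_pull phi_pd KJ (jet_metric_pair (jet_of oU H))
    (jet_metric_pair (jet_of oU' H')) hE).
  apply/esym; refine (etrans (comp_sfunE _ Uy) _).
  exact: (loc_normE oU' H' (UF Uy)).
rewrite (jet_obstruction_pull (S := jet_of oU H) (T := jet_of oU' H')
  phi_cst phi_pd J_closed JK KJ hE sE nE).
exact: comp_sfunE.
Qed.

End Pullback.

Lemma jexpr_mpoly (R : realType) (d : nat) (e : @jexpr R d) :
  exists (n : nat) (vars : 'I_n -> @jet_var d) (Q : mpoly.mpoly n R),
  forall val : @jet_var d -> R,
    jexpr_eval val e = mpoly.meval (fun k => val (vars k)) Q.
Proof.
have comb (op : forall n, mpoly.mpoly n R -> mpoly.mpoly n R -> mpoly.mpoly n R)
  (opR : R -> R -> R) (e1 e2 : @jexpr R d) :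
  (forall n v P Q, mpoly.meval v (op n P Q) = opR (mpoly.meval v P) (mpoly.meval v Q)) ->
  (exists (n : nat) (vars : 'I_n -> @jet_var d) (Q : mpoly.mpoly n R),
  forall val : @jet_var d -> R,
    jexpr_eval val e1 = mpoly.meval (fun k => val (vars k)) Q) ->
  (exists (n : nat) (vars : 'I_n -> @jet_var d) (Q : mpoly.mpoly n R),
  forall val : @jet_var d -> R,
    jexpr_eval val e2 = mpoly.meval (fun k => val (vars k)) Q) ->
  exists (n : nat) (vars : 'I_n -> @jet_var d) (Q : mpoly.mpoly n R),
  forall val : @jet_var d -> R,
    opR (jexpr_eval val e1) (jexpr_eval val e2) =
    mpoly.meval (fun k => val (vars k)) Q.
  move=> opE [n1 [v1 [Q1 E1]]] [n2 [v2 [Q2 E2]]].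
  (* The variables of the two polynomials are placed side by side, and substitution renames them. *)
  pose vars (k : 'I_(n1 + n2)) := match fintype.split k with inl i => v1 i | inr i => v2 i end.
  exists (n1 + n2)%N, vars, (op _
    (mpoly.comp_mpoly [tuple mpoly.mpolyX _ (mpoly.mnm1 (lshift n2 i)) | i < n1] Q1)
    (mpoly.comp_mpoly [tuple mpoly.mpolyX _ (mpoly.mnm1 (rshift n1 i)) | i < n2] Q2)).
  move=> val; rewrite opE !mpoly.comp_mpoly_meval E1 E2; congr (opR _ _).
    apply: mpoly.meval_eq => i; rewrite tnth_mktuple mpoly.mevalXU.
    by rewrite /vars (unsplitK (inl i)).
  apply: mpoly.meval_eq => i; rewrite tnth_mktuple mpoly.mevalXU.
  by rewrite /vars (unsplitK (inr i)).
have var (v : @jet_var d) : exists (n : nat) (vars : 'I_n -> @jet_var d)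
    (Q : mpoly.mpoly n R), forall val : @jet_var d -> R,
    val v = mpoly.meval (fun k => val (vars k)) Q.
  exists 1%N, (fun=> v), (mpoly.mpolyX R (mpoly.mnm1 ord0)) => val.
  by rewrite mpoly.mevalXU.
elim: e => [r|a b l||l||e1 IH1 e2 IH2|e1 IH1 e2 IH2] /=.
- exists 0%N, (fun=> InvDet), (mpoly.mpolyC 0 r) => val; by rewrite mpoly.mevalC.
- exact: var.
- exact: var.
- exact: var.
- exact: var.
- refine (comb (fun n => @mpoly.mpoly_add n R) +%R e1 e2 _ IH1 IH2) => n v P Q.
  exact: mpoly.mevalD.
- refine (comb (fun n => @mpoly.mpoly_mul n R) *%R e1 e2 _ IH1 IH2) => n v P Q.
  exact: mpoly.mevalM.
Qed.

(** * Manifolds *)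

Lemma local_data_sub (R : realType) (d : nat) (U U' : set 'rV[R]_d) h s :
  U' `<=` U -> local_data U h s -> local_data U' h s.
Proof.
move=> UU [h1 h2 h3 h4 h5]; split.
- by move=> a b; exact: smooth_sub UU (h1 a b).
- by move=> x /UU; exact: h2.
- by move=> x /UU; exact: h3.
- exact: smooth_sub UU h4.
- by move=> x /UU; exact: h5.
Qed.

Section Charts.
Context {R : realType} {d : nat}.
Implicit Types M N : manifold R d.

Definition chart_range M (i : chart M) (W : set M) : set 'rV[R]_d :=
  coord i @` (dom i `&` W).

Lemma chart_range_sub M (i : chart M) W : chart_range i W `<=` coord i @` dom i.
Proof. by move=> _ [p [ip _] <-]; exists p. Qed.

Lemma chart_range_open M (i : chart M) (W : set M) : open W -> open (chart_range i W).
Proof.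
move=> oW; rewrite openE => _ [p [ip Wp] <-].
have n1 : nbhs (coord i p) (coord i @` dom i).
  by apply: open_nbhs_nbhs; split; [exact: range_open|exists p].
have n2 : nbhs (coord i p) (param i @^-1` W).
  apply: (param_cont ip); rewrite coordK//.
  exact: open_nbhs_nbhs.
rewrite /interior; apply: filterS (filterI n1 n2) => y [[q iq <-]].
by rewrite /preimage/= coordK// => Wq; exists q.
Qed.

(** The open part of the chart on which the hypotheses of [local_data] hold; it contains the
    coordinates of every hypersurface point of the chart in [W], for a defining function [s]. *)
Definition regular_range M (s : M -> R) (i : chart M) (W : set M) : set 'rV[R]_d :=
  [set x | chart_range i W x /\ exists a, pderiv a (s \o param i) x != 0].

Lemma regular_range_open M (s : M -> R) (i : chart M) (W : set M) :
  smooth_fun s -> open W -> open (regular_range s i W).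
Proof.
move=> ss oW; rewrite openE => x [Wx [a sa]].
have sx : (coord i @` dom i) x := chart_range_sub Wx.
have n1 : nbhs x (chart_range i W).
  by apply: open_nbhs_nbhs; split => //; exact: chart_range_open.
have n2 : nbhs x (pderiv a (s \o param i) @^-1` [set r | r != 0]).
  apply: (smooth_cont (smooth_pderiv a (ss i)) sx).
  by apply: open_nbhs_nbhs; split => //; exact: open_neq.
rewrite /interior; apply: filterS (filterI n1 n2) => y [Wy ay].
by split=> //; exists a.
Qed.

Lemma metric_local_data M (g : metric M) (s : M -> R) (i : chart M) (W : set M) :
  smooth_fun s -> local_data (regular_range s i W) (g i \o param i) (s \o param i).
Proof.
move=> ss; have sub : regular_range s i W `<=` coord i @` dom i.
  by move=> x [/chart_range_sub].
split.
- by move=> a b; apply: smooth_sub sub _; exact: metric_smooth.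
- by move=> x /sub[p ip <-]; rewrite /= coordK// metric_sym.
- by move=> x /sub[p ip <-] v v0; rewrite /= coordK//; exact: metric_pos.
- exact: smooth_sub sub (ss i).
- by move=> x [_].
Qed.

Definition chart_value M (g : metric M) (s : M -> R) (i : chart M) (p : M) : R :=
  obstruction_value (g i \o param i) (s \o param i) (coord i p).

Section Maps.
Variables (M N : manifold R d) (phi : M -> N).
Hypothesis sphi : smooth_map phi.
Implicit Types (i : chart M) (j : chart N) (s : N -> R).

Let F i j : 'rV[R]_d -> 'rV[R]_d := coord j \o phi \o param i.

Let preim_open j : open (phi @^-1` dom j).
Proof. by apply: open_comp; [move=> p _; apply: sphi.1|exact: dom_open]. Qed.

Let FE i j p : dom i p -> F i j (coord i p) = coord j (phi p).
Proof. by move=> ip; rewrite /F /= coordK. Qed.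

Let F_range i j x : chart_range i (phi @^-1` dom j) x -> (coord j @` dom j) (F i j x).
Proof. by move=> [p [ip jp] <-]; rewrite FE//; exists (phi p). Qed.

Let compE s i j x : chart_range i (phi @^-1` dom j) x ->
  ((s \o param j) \o F i j) x = ((s \o phi) \o param i) x.
Proof. by move=> [p [ip jp] <-]; rewrite /F /= !coordK. Qed.

Lemma smooth_fun_comp s : smooth_fun s -> smooth_fun (s \o phi).
Proof.
move=> ss i l x [p ip <-]; have [j jp] := dom_cover (phi p).
have oO : open (chart_range i (phi @^-1` dom j)) := chart_range_open (preim_open j).
have sc := smooth_comp oO (@range_open _ _ N j) (sphi.2 i j) (@F_range i j) (ss j).
by apply: (smooth_ext oO (compE s (i := i) (j := j)) sc); exists p.
Qed.

Lemma pderiv_neq0_comp s i j x : smooth_fun s -> chart_range i (phi @^-1` dom j) x ->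
  (exists a, pderiv a ((s \o phi) \o param i) x != 0) ->
  exists b, pderiv b (s \o param j) (F i j x) != 0.
Proof.
move=> ss Ox [a]; apply: contra_neqP => /forallNP s0.
have oO : open (chart_range i (phi @^-1` dom j)) := chart_range_open (preim_open j).
rewrite -(eq_pderiv oO a Ox (compE s (i := i) (j := j))).
rewrite (pderiv_comp (@range_open _ _ N j) (sphi.2 i j) (@F_range i j) a (ss j) Ox).
rewrite big1// => b _.
by have /negP/negPn/eqP -> := s0 b; rewrite mulr0.
Qed.

Lemma differential_neq0_comp s p : smooth_fun s ->
  differential_neq0 (s \o phi) p -> differential_neq0 s (phi p).
Proof.
move=> ss dn j jp; have [i ip] := dom_cover p.
have Ox : chart_range i (phi @^-1` dom j) (coord i p) by exists p.
have [b] := pderiv_neq0_comp ss Ox (dn i ip).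
by rewrite FE// => sb; exists b.
Qed.

Lemma chart_value_pullback (gM : metric M) (gN : metric N) s i j p :
  pullback_comp phi gN gM -> smooth_fun s -> dom i p -> dom j (phi p) ->
  differential_neq0 (s \o phi) p ->
  chart_value gM (s \o phi) i p = chart_value gN s j (phi p).
Proof.
move=> gpull ss ip jp dn; have ssphi := smooth_fun_comp ss.
pose U := regular_range (s \o phi) i (phi @^-1` dom j).
pose U' := regular_range s j setT.
have oU : open U := regular_range_open ssphi (preim_open j).
have oU' : open U' := regular_range_open ss openT.
have sF : smooth_map_on U (F i j).
  by move=> b; apply: smooth_sub (sphi.2 i j b) => x [].
have UF x : U x -> U' (F i j x).
  move=> [Ox dx]; split; last exact: pderiv_neq0_comp dx.
  by have [q jq <-] := F_range Ox; exists q.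
have H : local_data U (gM i \o param i) ((s \o phi) \o param i).
  exact: metric_local_data.
have H' : local_data U' (gN j \o param j) (s \o param j).
  exact: metric_local_data.
have Up : U (coord i p).
  by split; [exists p|have [a sa] := dn i ip; exists a].
rewrite /chart_value -(FE j ip).
apply: (obstruction_value_pullback oU oU' sF UF H H') => // x [Ox _].
  case: Ox => q [iq jq] <-; rewrite FE//= !coordK//.
  exact: gpull.
by rewrite -(compE s Ox).
Qed.

End Maps.

Lemma smooth_map_id M : smooth_map (@idfun M).
Proof. by split; [move=> p|move=> i j; exact: transition_smooth]. Qed.

Definition chart_at M (p : M) : chart M := sval (cid (dom_cover p)).

Lemma chart_atP M (p : M) : dom (chart_at p) p.
Proof. exact: svalP (cid (dom_cover p)). Qed.

(** At critical points of [s] the value is 0 by default. Since [natural] concerns every point, the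
    default must be one that diffeomorphisms respect. *)
Definition obstruction_invariant : @assignment R d := fun M o g s p =>
  if pselect (differential_neq0 s p) then chart_value g s (chart_at p) p else 0.

(** Independence of the chart is naturality under the identity map read in two charts, for which
    [metric_change] is the pullback condition. *)
Lemma obstruction_invariantE M (o : orientation M) (g : metric M) s i p :
  smooth_fun s -> dom i p -> differential_neq0 s p ->
  obstruction_invariant o g s p = chart_value g s i p.
Proof.
move=> ss ip dn; rewrite /obstruction_invariant; case: pselect => [dn'|ndn] /=; last by case: ndn.
exact: (chart_value_pullback (smooth_map_id M) (metric_change g) ss (chart_atP p) ip dn).
Qed.

Lemma obstruction_natural : natural obstruction_invariant.
Proof.
move=> M N phi [psi [phiK psiK sphi spsi]] oM oN gM gN s _ gpull [ss _] p.
have ssphi := smooth_fun_comp sphi ss.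
(* Both sides must take the default value at the same points; the converse comes from the inverse
   diffeomorphism. *)
have dnE : differential_neq0 (s \o phi) p <-> differential_neq0 s (phi p).
  split; first exact: differential_neq0_comp.
  move=> dn; rewrite -[p]phiK; apply: (differential_neq0_comp spsi) => //.
  suff -> : (s \o phi) \o psi = s by [].
  by apply/funext => q /=; rewrite psiK.
have [dn|ndn] := pselect (differential_neq0 (s \o phi) p).
  have [j jp] := dom_cover (phi p); have [i ip] := dom_cover p.
  rewrite (obstruction_invariantE oM gM ssphi ip dn).
  rewrite (obstruction_invariantE oN gN ss jp (dnE.1 dn)).
  exact: (chart_value_pullback sphi gpull ss ip jp dn).
rewrite /obstruction_invariant; case: pselect => [dn|ndn'] /=; first by case: ndn.
by case: pselect => [/dnE dn|] //=; case: ndn.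
Qed.

Lemma obstruction_polynomial : universal_polynomial obstruction_invariant.
Proof.
have [n [vars [Q QE]]] := jexpr_mpoly (obstruction_expr R d).
exists n, vars, Q => M o g s [ss _] i p ip dn.
rewrite (obstruction_invariantE o g ss ip dn) -QE /chart_value /obstruction_value.
elim: (obstruction_expr R d) => //= [|e1 -> e2 ->|e1 -> e2 ->]//.
by rewrite coordK.
Qed.

Hypothesis d1 : (1 < d)%N.

Lemma obstruction_independent : defining_function_independent obstruction_invariant.
Proof.
move=> M o g s s' [ss ds] [ss' ds'] [zE conormal] p sp.
have dn := ds p sp.
have dn' : differential_neq0 s' p by apply: ds'; rewrite -zE.
have [i ip] := dom_cover p.
rewrite (obstruction_invariantE o g ss ip dn) (obstruction_invariantE o g ss' ip dn').
(* Uniqueness compares both constructions in one ring, so both functions have to be regular on the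
   same open set. *)
pose U := regular_range s i setT `&` regular_range s' i setT.
have oU : open U by apply: openI; apply: regular_range_open => //; exact: openT.
have H : local_data U (g i \o param i) (s \o param i).
  by apply: local_data_sub (metric_local_data g i setT ss) => x [].
have H' : local_data U (g i \o param i) (s' \o param i).
  by apply: local_data_sub (metric_local_data g i setT ss') => x [].
have zE' q : s q = 0 <-> s' q = 0.
  by have := congr1 (@^~ q) zE; rewrite /zero_locus /= => ->.
have sub : U `<=` coord i @` dom i by move=> x [[/chart_range_sub]].
apply: (obstruction_value_defining oU H d1 H').
- by move=> x _; exact: zE'.
- move=> x /sub[q iq <-]; rewrite /= coordK// => sq.
  have [lam lam0 lamE] := conormal q sq; exists lam => // a.
  exact: lamE iq.
- split; split; try by exists p.
    by have [a sa] := dn i ip; exists a.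
  by have [a sa] := dn' i ip; exists a.
- by rewrite /= coordK.
Qed.

Lemma obstruction_covariant :
  conformally_covariant (- d%:R) obstruction_invariant.
Proof.
move=> M o g g' Omega s [sOm Om0 OmE] [ss ds] p sp; have dn := ds p sp.
have [i ip] := dom_cover p.
rewrite (obstruction_invariantE o g ss ip dn) (obstruction_invariantE o g' ss ip dn).
pose U := regular_range s i setT.
have oU : open U by apply: regular_range_open => //; exact: openT.
have H := metric_local_data g i setT ss; have H' := metric_local_data g' i setT ss.
have sub : U `<=` coord i @` dom i by move=> x [/chart_range_sub].
have sOmU : smooth_on U (Omega \o param i) by exact: smooth_sub sub (sOm i).
have Om0U x : U x -> 0 < (Omega \o param i) x by move=> _; exact: Om0.
have OmEU x : U x -> (g' i \o param i) x = (Omega \o param i) x ^+ 2 *: (g i \o param i) x.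
  by move=> /sub[q iq <-]; rewrite /= coordK//; exact: OmE.
have Up : U (coord i p) by split; [exists p|have [a sa] := dn i ip; exists a].
have sp' : (s \o param i) (coord i p) = 0 by rewrite /= coordK.
rewrite /chart_value (obstruction_value_rescaled oU H H' d1 sOmU Om0U OmEU Up sp').
by rewrite /= coordK// exprVn powRN powR_mulrn// ltW.
Qed.

Lemma obstruction_invariant_density M (o : orientation M) (c : set (metric M))
    (s : M -> R) (b : metric M -> M -> R) :
  defining_function s -> obstruction_density c s b ->
  forall (g : metric M) (p : M), c g -> zero_locus s p ->
  b g p = obstruction_invariant o g s p.
Proof.
move=> [ss ds] [sigma [B [sdef IsqE bE]]] g p cg sp; have dn := ds p sp.
have [[ssig _] [zE conormal]] := sdef g cg.
have sB : smooth_fun (B g) by exact: density_smooth.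
have [i ip] := dom_cover p.
rewrite (obstruction_invariantE o g ss ip dn) bE//.
pose U := regular_range s i setT.
have oU : open U by apply: regular_range_open => //; exact: openT.
have H := metric_local_data g i setT ss.
have sub : U `<=` coord i @` dom i by move=> x [/chart_range_sub].
rewrite /chart_value -[in LHS](coordK ip).
apply: (obstruction_value_density oU H d1 (sigma := sigma g \o param i)
  (B := B g \o param i)).
- exact: smooth_sub sub (ssig i).
- exact: smooth_sub sub (sB i).
- move=> x /sub[q iq <-]; rewrite /= coordK// => sq.
  by have := congr1 (@^~ q) zE; rewrite /zero_locus /= => <-.
- move=> x /sub[q iq <-]; rewrite /= coordK// => sq.
  have [lam lam0 lamE] := conormal q sq; exists lam => // a.
  exact: lamE iq.
- by move=> x /sub[q iq <-]; rewrite IsqE//= coordK.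
- by split; [exists p|have [a sa] := dn i ip; exists a].
- by rewrite /= coordK.
Qed.

End Charts.

Theorem theorem6p5 (R : realType) (d : nat) (hd : (3 <= d)%N) :
  conformal_hypersurface_invariant (- d%:R : R) (@obstruction_density R d).
Proof.
have d1 : (1 < d)%N := ltnW hd.
exists obstruction_invariant; split.
- split; [exact: obstruction_natural|exact: obstruction_independent|].
  exact: obstruction_polynomial.
- exact: obstruction_covariant.
- by move=> M o c s b _; exact: obstruction_invariant_density.
Qed.
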